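(* Let $\beta>-1$ be real, let $n\ge1$ be an integer, let $\alpha\in\mathbb{D}$ and let $\kappa\in\mathbb{C}$ satisfy $|\kappa|=1$ and $\kappa\alpha=\overline{\alpha}$. Let $\vartheta\in\mathfrak{S}(\mathbb{D})$ and let $u\in\mathcal{H}(\mathbb{D})$ be non-zero (not identically zero), such that the operator $W^n_{u,\vartheta}$ is bounded on $\mathcal{A}^2_\beta$. Suppose that $W^n_{u,\vartheta}$ is complex symmetric with respect to the conjugation $JW_{u_\alpha,\vartheta_\alpha}$ and that $\vartheta(\overline{\alpha})=\overline{\alpha}$. Then $W^n_{u,\vartheta}$ is normal if and only if, for all $z\in\mathbb{D}$, $$u(z)=a z^n\quad\text{and}\quad\vartheta(z)=cz,$$ where $a=u^{(n)}(0)/n!$ and $c=\vartheta'(0)$.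
   Context: $\mathbb{D}=\{z\in\mathbb{C}:|z|<1\}$; $\mathcal{H}(\mathbb{D})$ is the set of analytic functions on $\mathbb{D}$; $\mathfrak{S}(\mathbb{D})$ is the set of holomorphic self-maps of $\mathbb{D}$. For $\beta>-1$, the weighted Bergman space $\mathcal{A}^2_\beta$ is the Hilbert space of all $f\in\mathcal{H}(\mathbb{D})$ with $\|f\|^2=\int_{\mathbb{D}}|f(z)|^2\,d\mathcal{A}_\beta(z)<\infty$, with inner product $\langle f,g\rangle=\int_{\mathbb{D}}f\overline{g}\,d\mathcal{A}_\beta$, where $d\mathcal{A}_\beta(z)=(\beta+1)(1-|z|^2)^\beta\,d\mathcal{A}(z)$ and $d\mathcal{A}$ is area measure normalized so that $\mathcal{A}(\mathbb{D})=1$; its reproducing kernel is $K_\xi(z)=(1-\overline{\xi}z)^{-(\beta+2)}$. Non-integer powers are principal branches. The weighted composition-differentiation operator of order $n$ is $W^n_{u,\vartheta}f=u\cdot(f^{(n)}\circ\vartheta)$, where $f^{(n)}$ is the $n$-th derivative of $f$. A conjugation on a complex Hilbert space $\mathcal{H}$ is a conjugate-linear, isometric map $\Upsilon:\mathcal{H}\to\mathcal{H}$ with $\Upsilon^2=I$. A bounded operator $L$ on $\mathcal{H}$ is complex symmetric with respect to $\Upsilon$ if $L=\Upsilon L^*\Upsilon$, and normal if $LL^*=L^*L$. $J$ is the conjugation $(Jf)(z)=\overline{f(\overline{z})}$. For $\alpha\in\mathbb{D}$ and $|\kappa|=1$ with $\kappa\alpha=\overline{\alpha}$, put $$u_\alpha(z)=\frac{(1-|\alpha|^2)^{\frac{\beta+2}{2}}}{(1-\overline{\alpha}z)^{\beta+2}},\qquad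 \vartheta_\alpha(z)=\kappa\,\frac{\alpha-z}{1-\overline{\alpha}z},$$ and $W_{u_\alpha,\vartheta_\alpha}f=u_\alpha\cdot(f\circ\vartheta_\alpha)$, a unitary operator on $\mathcal{A}^2_\beta$; $JW_{u_\alpha,\vartheta_\alpha}$ denotes the composition of $J$ with $W_{u_\alpha,\vartheta_\alpha}$, which is a conjugation on $\mathcal{A}^2_\beta$. *)

(* Defs.v *)
From HB Require Import structures.
From mathcomp Require Import all_boot all_order all_algebra.
From mathcomp Require Import all_classical all_reals all_analysis.
From mathcomp Require Export complex.
Export ComplexField.Normc.
Set Implicit Arguments.
Unset Strict Implicit.
Unset Printing Implicit Defensive.
Import Order.TTheory GRing.Theory Num.Theory.
Import numFieldNormedType.Exports.
Local Open Scope classical_set_scope.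
Local Open Scope ring_scope.
Local Open Scope complex_scope.

(* The ascription lets R[i] inherit the topology and normed-module structure
   that every numFieldType carries, so that [derive1n] below is the n-th
   complex derivative. *)
Notation Cplx R := (Num.ClosedField.sort (complex R : numClosedFieldType)).

Section Disk.
Variable R : realType.
Local Notation C := (Cplx R).

(* The order and norm of R[i] are C-valued, hence the use of [normc : C -> R]. *)
Definition disk : set C := [set z | normc z < 1].

(* Functions on the disk are represented by total functions on C of which only
   the values on the disk matter. *)
Definition eq_on_disk (f g : C -> C) : Prop := forall z, disk z -> f z = g z.

(* f is the sum of a convergent power series around each point of the disk. *)
Definition analytic_on_disk (f : C -> C) : Prop :=
  forall z0, disk z0 ->
  exists (r : R) (a : nat -> C), 0 < r /\
    forall z, disk z -> normc (z - z0) < r ->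
      series (fun k : nat => a k * (z - z0) ^+ k) @ \oo --> f z.

Definition holomorphic_self_map (t : C -> C) : Prop :=
  analytic_on_disk t /\ forall z, disk z -> disk (t z).

(* Principal argument, in ]-pi, pi], of a non-zero complex number. *)
Definition carg (w : C) : R :=
  let t := acos (complex.Re w / normc w) in
  if 0 <= complex.Im w then t else - t.

(* Principal branch of w ^ s. *)
Definition cpow (w : C) (s : R) : C :=
  let m := normc w `^ s in (m * cos (s * carg w)) +i* (m * sin (s * carg w)).

(* The plane as R * R with its two-dimensional Lebesgue measure. *)
Definition planar_disk : set (R * R) := [set p | disk (p.1 +i* p.2)].

(* Density of dA_beta with respect to planar Lebesgue measure; the factor
   pi^-1 makes the total area of the disk equal to 1. *)
Definition bergman_density (beta : R) (p : R * R) : R :=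
  (beta + 1) / pi * (1 - normc (p.1 +i* p.2) ^+ 2) `^ beta.

Local Notation area := (@lebesgue_measure R \x @lebesgue_measure R)%E.

Definition bergman (beta : R) : set (C -> C) :=
  [set f | analytic_on_disk f /\
     (\int[area]_(p in planar_disk)
        (normc (f (p.1 +i* p.2)) ^+ 2 * bergman_density beta p)%:E < +oo)%E].

Definition bergman_norm (beta : R) (f : C -> C) : R :=
  Num.sqrt (\int[area]_(p in planar_disk)
     (normc (f (p.1 +i* p.2)) ^+ 2 * bergman_density beta p)).

Definition bergman_inner (beta : R) (f g : C -> C) : C :=
  (\int[area]_(p in planar_disk)
     (complex.Re (f (p.1 +i* p.2) * conjc (g (p.1 +i* p.2)))
        * bergman_density beta p))
  +i*
  (\int[area]_(p in planar_disk)
     (complex.Im (f (p.1 +i* p.2) * conjc (g (p.1 +i* p.2)))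
        * bergman_density beta p)).

Definition maps_bergman (beta : R) (L : (C -> C) -> (C -> C)) : Prop :=
  forall f, bergman beta f -> bergman beta (L f).

(* Linearity is not included; it is automatic for the operators considered. *)
Definition bounded_on_bergman (beta : R) (L : (C -> C) -> (C -> C)) : Prop :=
  maps_bergman beta L /\
  exists M : R, forall f, bergman beta f ->
    bergman_norm beta (L f) <= M * bergman_norm beta f.

(* Ls is the adjoint of L; it exists for every bounded linear L and, as an
   operator on functions on the disk, it is unique. *)
Definition is_adjoint (beta : R) (L Ls : (C -> C) -> (C -> C)) : Prop :=
  maps_bergman beta Ls /\
  forall f g, bergman beta f -> bergman beta g ->
    bergman_inner beta (L f) g = bergman_inner beta f (Ls g).

(* L = Y L^* Y *)
Definition complex_symmetric (beta : R) (L Y : (C -> C) -> (C -> C)) : Prop :=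
  exists Ls, is_adjoint beta L Ls /\
    forall f, bergman beta f -> eq_on_disk (L f) (Y (Ls (Y f))).

(* L L^* = L^* L *)
Definition normal_on_bergman (beta : R) (L : (C -> C) -> (C -> C)) : Prop :=
  exists Ls, is_adjoint beta L Ls /\
    forall f, bergman beta f -> eq_on_disk (L (Ls f)) (Ls (L f)).

Definition wcomp_diff (n : nat) (u t : C -> C) (f : C -> C) : C -> C :=
  fun z => u z * (derive1n n f) (t z).

Definition wcomp (u t : C -> C) (f : C -> C) : C -> C :=
  fun z => u z * f (t z).

Definition conjJ (f : C -> C) : C -> C := fun z => conjc (f (conjc z)).

Definition u_alpha (beta : R) (alpha : C) : C -> C := fun z =>
  ((1 - normc alpha ^+ 2) `^ ((beta + 2) / 2))%:C
    / cpow (1 - conjc alpha * z) (beta + 2).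

Definition theta_alpha (kappa alpha : C) : C -> C := fun z =>
  kappa * ((alpha - z) / (1 - conjc alpha * z)).

Definition JW (beta : R) (kappa alpha : C) (f : C -> C) : C -> C :=
  conjJ (wcomp (u_alpha beta alpha) (theta_alpha kappa alpha) f).

End Disk.

(* Main.v *)
Require Import Defs.
From mathcomp Require Import all_boot all_order all_algebra.
From mathcomp Require Import all_classical all_reals all_analysis.
From mathcomp Require Import measurable_realfun ring lra.
Import Order.TTheory GRing.Theory Num.Theory.
Import numFieldNormedType.Exports.
Set Implicit Arguments.
Unset Strict Implicit.
Unset Printing Implicit Defensive.
Local Open Scope classical_set_scope.
Local Open Scope ring_scope.
Local Open Scope complex_scope.

(** Write [W] for the weighted composition-differentiation operator, [Y] for the
    conjugation and [e_k] for the monomial [z^k].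

    If [alpha <> 0], a symmetric [W] cannot be normal. Indeed [W] kills the
    constants, so the symmetry [W = Y W^* Y] gives [W^* g = 0] for [g = Y 1].
    A normal operator has the same kernel as its adjoint, so [W g = 0], that is,
    [u] times the composite of the [n]-th derivative of [g] with [theta] is zero.
    But [g] is a non-zero multiple of the kernel function
    [(1 - alpha z)^-(beta + 2)], none of whose derivatives has a zero in the disk
    when [alpha <> 0], and [u] is not zero: contradiction ([normal_alpha0]).

    If [alpha = 0], then [Y] multiplies each [e_k] by a unimodular constant, so
    symmetry says that the [(j, k)] and [(k, j)] entries of the matrix of [W] in
    the orthogonal system of the monomials vanish together
    ([symmetric_coef_zero]). As [W e_k = 0] for [k < n], the weight [u] vanishes to
    order [n] at 0; as [theta 0 = 0], the function [W e_j] vanishes to order [j],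
    so the matrix is triangular, hence diagonal ([W_diagonal]). Reading off
    [W e_n = n! u] and [W e_(n+1) = (n+1)! u theta] gives [u = a z^n] and
    [theta = c z] ([symmetric_origin_form]).

    Conversely, for [u = a z^n] and [theta = c z] the monomials are eigenvectors
    of [W], hence of [W^*], and [W] is normal ([diagonal_normal]).

    Both directions rest on the fact that the inner product with [e_k] is, up to
    a non-zero constant, the [k]-th Taylor coefficient at 0 ([inner_monomial]),
    and hence that the monomials are complete ([monomial_complete]), although
    analyticity is given only by power series with small radii. On a disk of radius [rho < 1], put
    [F(s) = int h(s z) conj(z^k)], integrated against the weight. Rotation
    invariance of the weighted area gives [F(s mu) = mu^k F(s)] for [|mu| = 1], so
    the derivative of [F] in the tangential direction is known; by the
    Cauchy-Riemann relation between tangential and radial increments of [h], the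
    radial derivative satisfies [s F' = k F], and [F(s) / s^k] is constant. If [h]
    vanishes to order [k + 1] at 0, letting [s] tend to 0 shows that this constant
    is zero ([moment_vanish]).

    The remaining ingredients are the rotation invariance of planar Lebesgue
    measure ([area_rotation]), the integrability of the density for [beta > -1]
    ([density_integrable]), the identity theorem ([analytic_identity]) and the
    binomial series for the principal power ([hpow_binomial]). *)

(** * Modulus and series of complex numbers *)

Section ComplexModulus.
Variable R : realType.
Local Notation C := (Cplx R).
Implicit Types x y z w : C.

Lemma nm_ge0 x : 0 <= normc x.
Proof. by case: x => a b; exact: sqrtr_ge0. Qed.

Lemma nmD x y : normc (x + y) <= normc x + normc y.
Proof. exact: le_normcD. Qed.

Lemma nmN x : normc (- x) = normc x.
Proof. exact: normcN. Qed.

Lemma nmM x y : normc (x * y) = normc x * normc y.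
Proof. exact: normcM. Qed.

Lemma nmB x y : normc (x - y) <= normc x + normc y.
Proof. by rewrite -(nmN y) nmD. Qed.

Lemma nm_subC x y : normc (x - y) = normc (y - x).
Proof. by rewrite -nmN opprB. Qed.

Lemma nm0 : normc (0 : C) = 0.
Proof. exact: normc0. Qed.

Lemma nm1 : normc (1 : C) = 1.
Proof. exact: normc1. Qed.

Lemma nmX x n : normc (x ^+ n) = normc x ^+ n.
Proof. by elim: n => [|n IH]; [exact: nm1|rewrite !exprS nmM IH]. Qed.

Lemma nmV x : normc x^-1 = (normc x)^-1.
Proof. exact: normcV. Qed.

Lemma nm_eq0 x : (normc x == 0) = (x == 0).
Proof.
by apply/eqP/eqP => [|->]; [exact: eq0_normc|exact: nm0].
Qed.

Lemma nm_gt0 x : (0 < normc x) = (x != 0).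
Proof. by rewrite lt_def nm_ge0 andbT nm_eq0. Qed.

Lemma nm_real (r : R) : normc (r%:C : C) = `|r|.
Proof. by rewrite /= expr0n /= addr0 sqrtr_sqr. Qed.

Lemma nmi : normc ('i : C) = 1.
Proof. by rewrite /= expr0n expr1n add0r sqrtr1. Qed.

Lemma nmJ x : normc (conjc x) = normc x.
Proof. by case: x => a b /=; rewrite sqrrN. Qed.

Lemma nm_sqr x : normc x ^+ 2 = complex.Re x ^+ 2 + complex.Im x ^+ 2.
Proof. by case: x => a b /=; rewrite sqr_sqrtr // addr_ge0 ?sqr_ge0. Qed.

Lemma Re_le_nm x : `|complex.Re x| <= normc x.
Proof.
rewrite -(@ler_pXn2r _ 2) ?nnegrE ?nm_ge0 // nm_sqr real_normK ?num_real //.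
by rewrite lerDl sqr_ge0.
Qed.

Lemma Im_le_nm x : `|complex.Im x| <= normc x.
Proof.
rewrite -(@ler_pXn2r _ 2) ?nnegrE ?nm_ge0 // nm_sqr real_normK ?num_real //.
by rewrite lerDr sqr_ge0.
Qed.

Lemma nm_le_ReIm x : normc x <= `|complex.Re x| + `|complex.Im x|.
Proof.
rewrite -(@ler_pXn2r _ 2) ?nnegrE ?nm_ge0 ?addr_ge0 // nm_sqr.
rewrite -[X in X + _]real_normK ?num_real // -[X in _ + X]real_normK ?num_real //.
rewrite sqrrD addrAC lerDl mulrn_wge0 // mulr_ge0 //.
Qed.

Lemma normCE x : `|x| = (normc x)%:C.
Proof. by case: x. Qed.

Lemma re_add x y : complex.Re (x + y) = complex.Re x + complex.Re y.
Proof. by case: x y => a b [c d]. Qed.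
Lemma im_add x y : complex.Im (x + y) = complex.Im x + complex.Im y.
Proof. by case: x y => a b [c d]. Qed.
Lemma re_opp x : complex.Re (- x) = - complex.Re x.
Proof. by case: x. Qed.
Lemma im_opp x : complex.Im (- x) = - complex.Im x.
Proof. by case: x. Qed.
Lemma re_mul x y : complex.Re (x * y) =
  complex.Re x * complex.Re y - complex.Im x * complex.Im y.
Proof. by case: x y => a b [c d]. Qed.
Lemma im_mul x y : complex.Im (x * y) =
  complex.Re x * complex.Im y + complex.Im x * complex.Re y.
Proof. by case: x y => a b [c d] /=. Qed.

Lemma eq_ReIm x y :
  complex.Re x = complex.Re y -> complex.Im x = complex.Im y -> x = y.
Proof. by case: x y => a b [c d] /= -> ->. Qed.

Lemma mulJ_nm x : x * conjc x = ((normc x) ^+ 2)%:C.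
Proof. by apply: eq_ReIm; rewrite ?re_mul ?im_mul nm_sqr; case: x => a b /=; ring. Qed.

(** The norm of [R[i]] is itself complex-valued; this puts limits in terms of the
    real-valued modulus, in which all estimates below are made. *)
Lemma cvgC_normP (u : nat -> C) (l : C) : u @ \oo --> l <->
  forall e : R, 0 < e ->
    exists N, forall n, (N <= n)%N -> normc (u n - l) < e.
Proof.
split=> [/cvgrPdist_lt h e e0|h].
  have /h [N _ hN] : (0 : C) < e%:C by rewrite ltcR.
  exists N => n Nn; have := hN n Nn.
  by rewrite normCE ltcR nm_subC.
apply/cvgrPdist_lt => e e0.
have e_real : e = (complex.Re e)%:C by rewrite RRe_real // gtr0_real.
have e0' : 0 < complex.Re e by move: e0; rewrite e_real ltcR.
have [N hN] := h _ e0'; exists N => // n Nn.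
by rewrite normCE e_real ltcR nm_subC hN.
Qed.

End ComplexModulus.

Section ComplexSeries.
Variable R : realType.
Local Notation C := (Cplx R).
Implicit Types (c : nat -> C) (S T : C).

Definition csum c S := series c @ \oo --> S.

Lemma csumP c S : csum c S <-> forall e : R, 0 < e ->
  exists N, forall n, (N <= n)%N -> normc (\sum_(0 <= k < n) c k - S) < e.
Proof. exact: cvgC_normP. Qed.

Lemma csum_uniq c S T : csum c S -> csum c T -> S = T.
Proof. by move=> /cvg_lim <- // /cvg_lim <-. Qed.

Lemma eq_csum c c' S : c =1 c' -> csum c S -> csum c' S.
Proof. by move=> /funext ->. Qed.

Lemma csumZ (a : C) c S : csum c S -> csum (fun k => a * c k) (a * S).
Proof.
move=> /csumP h; apply/csumP => e e0.
have a1 : 0 < normc a + 1 by rewrite ltr_wpDl ?nm_ge0.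
have [N hN] := h (e / (normc a + 1)) (divr_gt0 e0 a1); exists N => n /hN.
rewrite -mulr_sumr -mulrBr nmM ltr_pdivlMr // mulrC; apply: le_lt_trans.
by rewrite ler_wpM2r ?nm_ge0 // lerDl.
Qed.

Lemma csumD c c' S S' : csum c S -> csum c' S' ->
  csum (fun k => c k + c' k) (S + S').
Proof.
move=> /csumP h /csumP h'; apply/csumP => e e0.
have e20 : 0 < e / 2 by rewrite divr_gt0.
have [N hN] := h _ e20; have [N' hN'] := h' _ e20.
exists (maxn N N') => n; rewrite geq_max => /andP[/hN g /hN' g'].
rewrite big_split /= opprD addrACA; apply: le_lt_trans (nmD _ _) _.
by rewrite [ltRHS]splitr ltrD.
Qed.

Lemma csumB c c' S S' : csum c S -> csum c' S' ->
  csum (fun k => c k - c' k) (S - S').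
Proof.
move=> h /(csumZ (a := -1)) h'; rewrite -[- S']mulN1r.
by apply: eq_csum (csumD h h') => k; rewrite mulN1r.
Qed.

Lemma csum_recl c S : csum (fun k => c k.+1) S -> csum c (c 0%N + S).
Proof.
move=> /csumP h; apply/csumP => e e0; have [N hN] := h e e0.
exists N.+1 => -[//|n] Nn; have := hN n Nn.
by rewrite big_nat_recl // opprD addrACA subrr add0r.
Qed.

Lemma csumJ c S : csum c S -> csum (fun k => conjc (c k)) (conjc S).
Proof.
move=> /csumP h; apply/csumP => e e0; have [N hN] := h e e0.
exists N => n /hN; rewrite -nmJ rmorphB rmorph_sum; exact.
Qed.

Lemma csum_finite c N : (forall k, (N <= k)%N -> c k = 0) ->
  csum c (\sum_(0 <= k < N) c k).
Proof.
move=> h; apply/csumP => e e0; exists N => n Nn.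
rewrite (big_cat_nat (n := N)) //= addrAC subrr add0r big_nat.
by rewrite big1 ?nm0 // => k /andP[/h].
Qed.

Lemma csum0 : csum (fun _ : nat => 0) (0 : C).
Proof. by have := @csum_finite (fun=> 0) 0%N (fun _ _ => erefl); rewrite big_nil. Qed.

Lemma csum_bounded c S : csum c S -> exists M, forall k, normc (c k) <= M.
Proof.
move=> /csumP /(_ _ ltr01) [N hN].
exists (2 + \sum_(0 <= i < N) normc (c i)) => k.
have s0 m : 0 <= \sum_(0 <= i < m) normc (c i) by apply: sumr_ge0 => i _; exact: nm_ge0.
case: (leqP N k) => Nk.
  rewrite -[c k](_ : \sum_(0 <= i < k.+1) c i - S
      - (\sum_(0 <= i < k) c i - S) = _); last first.
    by rewrite big_nat_recr //=; ring.
  apply: le_trans (nmB _ _) _.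
  have h1 := ltW (hN _ Nk); have h2 := ltW (hN _ (leqW Nk)).
  by rewrite (_ : 2 = 1 + 1) // -addrA lerD // (le_trans h1) // lerDl.
have -> : \sum_(0 <= i < N) normc (c i) = normc (c k) +
    \sum_(0 <= i < N | i != k) normc (c i).
  by rewrite (bigD1_seq k) ?mem_index_iota ?iota_uniq.
rewrite addrCA lerDl addr_ge0 //; apply: sumr_ge0 => i _; exact: nm_ge0.
Qed.

(** The completeness of C enters only through this comparison with a
    geometric series. *)
Lemma csum_geometric_ex c (M q : R) : 0 <= q < 1 ->
  (forall k, normc (c k) <= M * q ^+ k) -> exists S, csum c S.
Proof.
move=> /andP[q0 q1] hc.
have cvg_part (f : C -> R) : (forall x, `|f x| <= normc x) ->
    cvgn (series (fun k => f (c k))).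
  move=> fle; apply: normed_cvg.
  apply: (@series_le_cvg _ _ (geometric M q)) => [n|n|n|].
  - exact: normr_ge0.
  - by apply: le_trans (hc n); exact: nm_ge0.
  - by apply: le_trans (hc n); exact: fle.
  - by apply: is_cvg_geometric_series; rewrite ger0_norm.
have /cvg_ex[a /cvgrPdist_lt ha] := cvg_part _ (@Re_le_nm R).
have /cvg_ex[b /cvgrPdist_lt hb] := cvg_part _ (@Im_le_nm R).
exists (a +i* b); apply/csumP => e e0.
have e20 : 0 < e / 2 by rewrite divr_gt0.
have [N1 _ h1] := ha _ e20; have [N2 _ h2] := hb _ e20.
exists (maxn N1 N2) => n; rewrite geq_max => /andP[/h1 + /h2].
rewrite /series /= => g1 g2; apply: le_lt_trans (nm_le_ReIm _) _.
rewrite [ltRHS]splitr re_add im_add re_opp im_opp /=.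
rewrite (big_morph _ (@re_add R) (erefl : complex.Re (0 : C) = 0)).
rewrite (big_morph _ (@im_add R) (erefl : complex.Im (0 : C) = 0)).
by rewrite ltrD // distrC.
Qed.

Lemma csum_geometric_le c S (M q : R) : 0 <= q < 1 ->
  (forall k, normc (c k) <= M * q ^+ k) -> csum c S -> normc S <= M / (1 - q).
Proof.
move=> /andP[q0 q1] hc /csumP h.
have M0 : 0 <= M by have := hc 0%N; rewrite mulr1; apply: le_trans; exact: nm_ge0.
apply/ler_addgt0Pr => e e0; have [N /(_ N (leqnn _)) hN] := h e e0.
have hp n : normc (\sum_(0 <= k < n) c k) <= M * (1 - q ^+ n) / (1 - q).
  elim: n => [|n IH]; first by rewrite big_nil nm0 expr0 subrr mulr0 mul0r.
  rewrite big_nat_recr //=; apply: le_trans (nmD _ _) _.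
  apply: le_trans (lerD IH (hc n)) _.
  rewrite le_eqVlt; apply/orP; left; apply/eqP; rewrite exprS; field.
  by rewrite subr_eq0 eq_sym lt_eqF.
rewrite -[S](subKr (\sum_(0 <= k < N) c k)).
apply: le_trans (nmB _ _) (lerD _ (ltW hN)).
apply: le_trans (hp N) _; rewrite ler_pM2r ?invr_gt0 ?subr_gt0 //.
by rewrite ler_piMr // gerBl exprn_ge0.
Qed.

End ComplexSeries.

(** * Local theory of power series *)

Lemma horner_recl (A : comNzRingType) (a : nat -> A) (x S : A) m :
  \sum_(0 <= i < m.+1) a i * x ^+ i + x ^+ m.+1 * S =
  a 0%N + x * (\sum_(0 <= i < m) a i.+1 * x ^+ i + x ^+ m * S).
Proof.
rewrite big_nat_recl //= expr0 mulr1 -addrA mulrDr mulr_sumr exprS mulrA.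
by under eq_bigr do rewrite exprS mulrCA.
Qed.

Section PowerSeries.
Variable R : realType.
Local Notation C := (Cplx R).
Implicit Types (a b : nat -> C) (x w d z S D : C) (f g : C -> C) (r M : R).

Definition psum a x S := csum (fun k => a k * x ^+ k) S.

(** The only consequence of convergence that is used: it makes the series
    comparable with a geometric one on every smaller disk. *)
Definition coef_bound a M r := forall k, normc (a k) * r ^+ k <= M.

Definition diff_coef a : nat -> C := fun k => k.+1%:R * a k.+1.

Lemma nm_nat k : normc (k%:R : C) = k%:R.
Proof. by rewrite -(rmorph_nat (real_complex R)) nm_real normr_nat. Qed.

Lemma coef_bound_ge0 a M r : coef_bound a M r -> 0 <= M.
Proof. by move/(_ 0%N); rewrite mulr1; apply: le_trans; exact: nm_ge0. Qed.

Lemma coef_bound_term a M r x : 0 < r -> coef_bound a M r ->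
  forall k, normc (a k * x ^+ k) <= M * (normc x / r) ^+ k.
Proof.
move=> r0 h k; rewrite nmM nmX expr_div_n mulrA ler_pdivlMr ?exprn_gt0 //.
by rewrite mulrAC ler_wpM2r // exprn_ge0 // nm_ge0.
Qed.

Lemma coef_bound_shift a M r : 0 < r -> coef_bound a M r ->
  coef_bound (fun k => a k.+1) (M / r) r.
Proof. by move=> r0 h k; rewrite ler_pdivlMr // -mulrA -exprSr. Qed.

Lemma coef_bound_diff a M r : 0 < r -> coef_bound a M r ->
  coef_bound (diff_coef a) (2 * M / r) (r / 2).
Proof.
move=> r0 h k; rewrite nmM nm_nat expr_div_n ler_pdivlMr //.
have -> : k.+1%:R * normc (a k.+1) * (r ^+ k / 2 ^+ k) * r =
  (k.+1%:R / 2 ^+ k) * (normc (a k.+1) * r ^+ k.+1).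
  by rewrite exprSr; ring.
have g0 j : 0 <= r ^+ j by rewrite exprn_ge0 // ltW.
apply: ler_pM => //; rewrite ?divr_ge0 ?mulr_ge0 ?exprn_ge0 ?nm_ge0 ?(ltW r0) //.
rewrite ler_pdivrMr ?exprn_gt0 // -exprS -natrX ler_nat.
by have := ltn_expl k.+1 (isT : 1 < 2)%N; apply: ltnW.
Qed.

Lemma psum_ex a M r x : 0 < r -> coef_bound a M r -> normc x < r ->
  exists S, psum a x S.
Proof.
move=> r0 h xr; apply: (csum_geometric_ex (M := M) (q := normc x / r)).
  by rewrite divr_ge0 ?nm_ge0 ?ltW //= ltr_pdivrMr // mul1r.
exact: coef_bound_term.
Qed.

Lemma half_lt1 : 0 <= (1 / 2 : R) < 1.
Proof. by apply/andP; split; lra. Qed.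

Lemma psum_le a M r x S : 0 < r -> coef_bound a M r -> normc x <= r / 2 ->
  psum a x S -> normc S <= 2 * M.
Proof.
move=> r0 h xr hS; have M0 := coef_bound_ge0 h.
have -> : 2 * M = M / (1 - 1 / 2) by field.
apply: csum_geometric_le half_lt1 _ hS => k.
apply: le_trans (coef_bound_term _ r0 h _) _; rewrite ler_wpM2l //.
have q0 : 0 <= normc x / r by rewrite divr_ge0 ?nm_ge0 // ltW.
have q1 : normc x / r <= 1 / 2 by rewrite ler_pdivrMr //; lra.
by apply: lerXn2r => //; rewrite nnegrE; lra.
Qed.

Lemma psum_cons a x S : psum (fun k => a k.+1) x S -> psum a x (a 0%N + x * S).
Proof.
move=> h; have := @csum_recl _ (fun k => a k * x ^+ k) (x * S).
rewrite expr0 mulr1; apply.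
by apply: eq_csum (csumZ (a := x) h) => k; rewrite exprS; ring.
Qed.

Lemma psum_at0 a S : psum a 0 S -> S = a 0%N.
Proof.
move=> h; have := @csum_finite _ (fun k => a k * 0 ^+ k) 1%N.
rewrite big_nat1 expr0 mulr1 => /(_ _)/(csum_uniq h); apply => -[//|k] _.
by rewrite exprS mul0r mulr0.
Qed.

(** Removing the leading coefficient divides the bound on the coefficients by
    [r], whence the power [r ^+ m]. *)
Lemma psum_taylor a M r x m : 0 < r -> coef_bound a M r -> normc x <= r / 2 ->
  exists S, psum a x (\sum_(0 <= i < m) a i * x ^+ i + x ^+ m * S) /\
            normc S <= 2 * M / r ^+ m.
Proof.
move=> r0; elim: m a M => [|m IH] a M h xr.
  have [S hS] : exists S, psum a x S.
    by apply: (psum_ex r0 h); apply: (le_lt_trans xr); lra.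
  exists S; rewrite big_nil add0r mul1r divr1; split => //.
  exact: (psum_le r0 h xr hS).
have [S [hS leS]] := IH _ _ (coef_bound_shift r0 h) xr.
exists S; split; first by rewrite horner_recl; exact: (psum_cons hS).
by rewrite exprS invfM; apply: le_trans leS _; rewrite !mulrA.
Qed.

(** The factor [2 ^+ k] swallows the quadratic growth in [k] of the second-order
    term of the binomial expansion, so that the bound stays geometric in [k]. *)
Lemma power_increment_error w d (rho : R) k : normc w <= rho -> normc (w + d) <= rho ->
  0 < rho ->
  normc ((w + d) ^+ k - w ^+ k - k%:R * d * w ^+ k.-1) * rho ^+ 2
    <= normc d ^+ 2 * (2 * rho) ^+ k.
Proof.
move=> hw hwd rho0; elim: k => [|k IH].
  by rewrite !expr0 subrr mul0r mul0r subr0 nm0 mul0r mulr1 exprn_ge0 // nm_ge0.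
set e := (X in normc X * _ <= _) in IH.
rewrite (_ : _ - _ - _ = (w + d) * e + k%:R * d ^+ 2 * w ^+ k.-1); last first.
  rewrite /e; case: k {IH e} => [|k] /=; first by rewrite !expr0 !expr1; ring.
  by rewrite -[k.+2%:R]natr1 !exprS; ring.
have n0 := nm_ge0.
have d0 : 0 <= normc d ^+ 2 by rewrite exprn_ge0.
rewrite mulrC; apply: le_trans (ler_wpM2l _ (nmD _ _)) _.
  by rewrite exprn_ge0 // ltW.
rewrite mulrDr [(2 * rho) ^+ k.+1]exprS.
have -> : normc d ^+ 2 * (2 * rho * (2 * rho) ^+ k) =
   rho * (normc d ^+ 2 * (2 * rho) ^+ k) + rho * (normc d ^+ 2 * (2 * rho) ^+ k).
  by ring.
apply: lerD.
  rewrite nmM mulrCA [_ ^+ 2 * normc e]mulrC.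
  apply: ler_pM; [exact: n0| |exact: hwd|exact: IH].
  by rewrite mulr_ge0 ?n0 // exprn_ge0 // ltW.
rewrite !nmM nm_nat !nmX; case: k {IH e} => [|k] /=.
  by rewrite !mul0r mulr0 !mulr_ge0 // ?exprn_ge0 // ltW // mulr_gt0.
have -> : rho ^+ 2 * (k.+1%:R * normc d ^+ 2 * normc w ^+ k) =
   rho ^+ 2 * normc d ^+ 2 * (k.+1%:R * normc w ^+ k) by ring.
have -> : rho * (normc d ^+ 2 * (2 * rho) ^+ k.+1) =
   rho ^+ 2 * normc d ^+ 2 * (2 ^+ k.+1 * rho ^+ k).
  by rewrite exprMn !exprS; ring.
apply: ler_wpM2l; first by rewrite mulr_ge0 // exprn_ge0 // ltW.
apply: ler_pM; rewrite ?exprn_ge0 ?n0 //.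
  by rewrite -natrX ler_nat ltnW // ltn_expl.
by apply: lerXn2r; rewrite ?nnegrE ?n0 // ltW.
Qed.

(** On the disk of radius [r / 4] the termwise errors are dominated by a geometric
    series of ratio [1 / 2]. *)
Lemma psum_increment_error a M r w d S S' D : 0 < r -> coef_bound a M r ->
  normc w <= r / 4 -> normc (w + d) <= r / 4 ->
  psum a w S -> psum a (w + d) S' -> psum (diff_coef a) w D ->
  normc (S' - S - d * D) <= 32 * M / r ^+ 2 * normc d ^+ 2.
Proof.
move=> r0 h hw hwd hS hS' hD.
have hD' : csum (fun k => k%:R * a k * d * w ^+ k.-1) (d * D).
  have := @csum_recl _ (fun k => k%:R * a k * d * w ^+ k.-1) (d * D).
  rewrite !mul0r add0r; apply.
  by apply: eq_csum (csumZ (a := d) hD) => k; rewrite /diff_coef /=; ring.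
have hE := csumB (csumB hS' hS) hD'.
have -> : 32 * M / r ^+ 2 * normc d ^+ 2 =
   (16 * M * normc d ^+ 2 / r ^+ 2) / (1 - 1 / 2).
  by field; rewrite gt_eqF.
apply: csum_geometric_le half_lt1 _ hE => k.
have r40 : 0 < r / 4 by rewrite divr_gt0.
have e := power_increment_error k hw hwd r40.
have -> : a k * (w + d) ^+ k - a k * w ^+ k - k%:R * a k * d * w ^+ k.-1 =
  a k * ((w + d) ^+ k - w ^+ k - k%:R * d * w ^+ k.-1) by ring.
rewrite nmM; set E := normc (_ - _ - _) in e *.
have {}e : E <= normc d ^+ 2 * (r / 2) ^+ k * (16 / r ^+ 2).
  have -> : r / 2 = 2 * (r / 4) by field.
  have -> : 16 / r ^+ 2 = ((r / 4) ^+ 2)^-1.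
    by field; rewrite gt_eqF.
  by rewrite ler_pdivlMr ?exprn_gt0.
apply: le_trans (ler_wpM2l (nm_ge0 _) e) _.
have -> : normc (a k) * (normc d ^+ 2 * (r / 2) ^+ k * (16 / r ^+ 2)) =
  (normc (a k) * r ^+ k) * (16 * normc d ^+ 2 / r ^+ 2 * (1 / 2) ^+ k).
  by rewrite !expr_div_n expr1n; ring.
have -> : 16 * M * normc d ^+ 2 / r ^+ 2 * (1 / 2) ^+ k =
  M * (16 * normc d ^+ 2 / r ^+ 2 * (1 / 2) ^+ k) by ring.
apply: ler_wpM2r => //; rewrite !mulr_ge0 ?invr_ge0 ?exprn_ge0 ?nm_ge0 ?ltW //.
Qed.

End PowerSeries.

Lemma exprD_binomial (A : comNzRingType) (x w : A) n :
  (x + w) ^+ n = \sum_(0 <= k < n.+1) (x ^+ (n - k) *+ 'C(n, k)) * w ^+ k.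
Proof. by rewrite exprDn big_mkord; apply: eq_bigr => i _; rewrite mulrnAl. Qed.

Section Expansions.
Variable R : realType.
Local Notation C := (Cplx R).
Implicit Types (a b : nat -> C) (x w d z S D : C) (f g h : C -> C) (r M : R).

(** The radius is existential: only the germ at [z0] matters, and the radius of
    convergence is never computed. *)
Definition pexp f z0 a :=
  exists r, 0 < r /\ forall w, normc w < r -> psum a w (f (z0 + w)).

Lemma normc_real_ge0 r : 0 <= r -> normc (r%:C : C) = r.
Proof. by move=> r0; rewrite nm_real ger0_norm. Qed.

Lemma pexp_bound f z0 a : pexp f z0 a -> exists r M,
  [/\ 0 < r, coef_bound a M r & forall w, normc w < r -> psum a w (f (z0 + w))].
Proof.
move=> [r [r0 h]]; have r20 : 0 < r / 2 by rewrite divr_gt0.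
have nr : normc ((r / 2)%:C : C) = r / 2 by rewrite normc_real_ge0 // ltW.
have /h/csum_bounded [M hM] : normc ((r / 2)%:C : C) < r by rewrite nr; lra.
exists (r / 2), M; split => // [k|w wr].
  by have := hM k; rewrite nmM nmX nr.
by apply: h; apply: lt_trans wr _; lra.
Qed.

Lemma disk_nbhs (z : C) : disk z ->
  exists r, 0 < r /\ forall w, normc w < r -> disk (z + w).
Proof.
move=> hz; exists (1 - normc z); rewrite subr_gt0; split => // w.
by rewrite ltrBrDl; apply: le_lt_trans; exact: nmD.
Qed.

Lemma analytic_pexp f : analytic_on_disk f <->
  forall z, disk z -> exists a, pexp f z a.
Proof.
split=> h z hz.
  have [r [a [r0 ha]]] := h z hz; have [r' [r'0 hr']] := disk_nbhs hz.
  exists a, (Num.min r r'); rewrite lt_min r0 r'0; split => // w.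
  rewrite lt_min => /andP[wr wr'].
  have := ha (z + w) (hr' _ wr'); rewrite addrAC subrr add0r; exact.
have [a [r [r0 ha]]] := h z hz; exists r, a; split => // w hw wr.
by have := ha _ wr; rewrite addrCA subrr addr0.
Qed.

Lemma pexp_value f z0 a : pexp f z0 a -> f z0 = a 0%N.
Proof.
move=> [r [r0 h]]; have := h 0; rewrite nm0 addr0 => /(_ r0); exact: psum_at0.
Qed.

Lemma eq_pexp f g z0 a r : 0 < r ->
  (forall w, normc w < r -> f (z0 + w) = g (z0 + w)) ->
  pexp f z0 a -> pexp g z0 a.
Proof.
move=> r0 fg [r' [r'0 h]]; exists (Num.min r r'); rewrite lt_min r0 r'0.
split=> [|w]; [by []|rewrite lt_min => /andP[wr wr']].
by rewrite -(fg _ wr); exact: (h _ wr').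
Qed.

Lemma pexpB f g z0 a b : pexp f z0 a -> pexp g z0 b ->
  pexp (fun z => f z - g z) z0 (fun k => a k - b k).
Proof.
move=> [r [r0 h]] [r' [r'0 h']]; exists (Num.min r r'); rewrite lt_min r0 r'0.
split=> [|w]; [by []|rewrite lt_min => /andP[/h hf /h' hg]].
by apply: eq_csum (csumB hf hg) => k; rewrite mulrBl.
Qed.

Lemma pexpZ f z0 a (c : C) : pexp f z0 a ->
  pexp (fun z => c * f z) z0 (fun k => c * a k).
Proof.
move=> [r [r0 h]]; exists r; split; [exact: r0|move=> w wr].
by apply: eq_csum (csumZ (a := c) (h w wr)) => k; ring.
Qed.

Lemma pexp_monomial n z0 : pexp (fun z => z ^+ n) z0
  (fun k => if (k <= n)%N then z0 ^+ (n - k) *+ 'C(n, k) else 0).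
Proof.
exists 1; split=> // w _.
rewrite exprD_binomial.
have := @csum_finite _ (fun k => (if (k <= n)%N then z0 ^+ (n - k) *+ 'C(n, k)
  else 0) * w ^+ k) n.+1.
rewrite (eq_big_nat _ _ (F2 := fun k => z0 ^+ (n - k) *+ 'C(n, k) * w ^+ k)).
  by apply => k nk; rewrite leqNgt nk /= mul0r.
by move=> i /andP[_]; rewrite ltnS => ->.
Qed.

Lemma pexp_monomial0 n :
  pexp (fun z => z ^+ n) 0 (fun k => (k == n)%:R : C).
Proof.
exists 1; split=> // w _; rewrite add0r.
have := @csum_finite _ (fun k => (k == n)%:R * w ^+ k) n.+1.
rewrite big_nat_recr //= eqxx mul1r big_nat big1 ?add0r.
  by apply => k nk; rewrite gtn_eqF // mul0r.
by move=> i /andP[_ ni]; rewrite ltn_eqF // mul0r.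
Qed.

(** Comparison of orders of vanishing: near [z0], the first non-zero term of
    the series dominates the remainder, so a bound by [|w|^k] along any
    sequence of points tending to [z0] kills all terms of degree below [k]. *)
Lemma pexp_order f z0 a (A : R) k : pexp f z0 a ->
  (forall e, 0 < e -> exists w, [/\ 0 < normc w, normc w < e &
     normc (f (z0 + w)) <= A * normc w ^+ k]) ->
  forall i, (i < k)%N -> a i = 0.
Proof.
move=> /pexp_bound[r [M [r0 hM hf]]] hsmall.
elim/ltn_ind => i IH ik; apply/eqP; rewrite -nm_eq0 eq_le nm_ge0 andbT.
have M0 := coef_bound_ge0 hM.
pose K := `|A| + 2 * M / r ^+ i.+1.
have K0 : 0 <= K.
  by rewrite addr_ge0 // divr_ge0 ?exprn_ge0 ?(ltW r0) // mulr_ge0.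
have K1 : 0 < K + 1 by rewrite ltr_wpDl.
apply/ler_addgt0Pr => e e0; rewrite add0r.
pose e1 := Num.min (Num.min (r / 2) 1) (e / (K + 1)).
have e10 : 0 < e1 by rewrite !lt_min ltr01 !divr_gt0.
have [w [w0 we wf]] := hsmall _ e10.
move: we; rewrite !lt_min => /andP[/andP[wr w1] we].
have [S [hS leS]] := psum_taylor i.+1 r0 hM (ltW wr).
have fE : f (z0 + w) = a i * w ^+ i + w ^+ i.+1 * S.
  rewrite (csum_uniq (hf w _) hS); last by apply: lt_trans wr _; lra.
  congr (_ + _); rewrite big_nat_recr //= big_nat big1 ?add0r // => j.
  by move=> /andP[_ ji]; rewrite IH ?mul0r // (ltn_trans ji).
have key : normc (a i) * normc w ^+ i <= K * normc w * normc w ^+ i.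
  have -> : normc (a i) * normc w ^+ i = normc (f (z0 + w) - w ^+ i.+1 * S).
    by rewrite -nmX -nmM fE addrK.
  apply: le_trans (nmB _ _) _.
  have -> : K * normc w * normc w ^+ i = `|A| * normc w ^+ i.+1 +
      2 * M / r ^+ i.+1 * normc w ^+ i.+1.
    by rewrite /K [normc w ^+ i.+1]exprS; ring.
  apply: lerD.
    apply: (le_trans wf); apply: (@le_trans _ _ (`|A| * normc w ^+ k)).
      by rewrite ler_wpM2r ?exprn_ge0 ?nm_ge0 // ler_norm.
    by rewrite ler_wpM2l // ler_wiXn2l // ?nm_ge0 // ltW.
  by rewrite nmM nmX mulrC ler_wpM2r // exprn_ge0 // nm_ge0.
rewrite ler_pM2r ?exprn_gt0 // in key; apply: (le_trans key).
apply: (@le_trans _ _ ((K + 1) * normc w)).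
  by rewrite ler_wpM2r ?nm_ge0 // lerDl.
by rewrite mulrC -ler_pdivlMr // ltW.
Qed.

Lemma pexp_bigO f z0 a k : pexp f z0 a -> (forall i, (i < k)%N -> a i = 0) ->
  exists A r, [/\ 0 <= A, 0 < r &
    forall w, normc w < r -> normc (f (z0 + w)) <= A * normc w ^+ k].
Proof.
move=> /pexp_bound[r [M [r0 hM hf]]] a0.
have M0 := coef_bound_ge0 hM.
exists (2 * M / r ^+ k), (r / 2); split; rewrite ?divr_gt0 //.
  by rewrite divr_ge0 ?exprn_ge0 ?(ltW r0) // mulr_ge0.
move=> w wr; have [S [hS leS]] := psum_taylor k r0 hM (ltW wr).
rewrite (csum_uniq (hf w _) hS); last by apply: lt_trans wr _; lra.
rewrite big_nat big1 ?add0r; last by move=> i /andP[_ /a0->]; rewrite mul0r.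
by rewrite nmM nmX mulrC ler_wpM2r // exprn_ge0 // nm_ge0.
Qed.

Lemma small_point e : 0 < e -> exists w : C, 0 < normc w /\ normc w < e.
Proof.
move=> e0; exists (e / 2)%:C; rewrite normc_real_ge0; last by lra.
by split; lra.
Qed.

Lemma pexp_order_ball f z0 a (A r : R) k : pexp f z0 a -> 0 < r ->
  (forall w, normc w < r -> normc (f (z0 + w)) <= A * normc w ^+ k) ->
  forall i, (i < k)%N -> a i = 0.
Proof.
move=> hf r0 hA; apply: (pexp_order (A := A) hf) => e e0.
have [w [w0 we]] : exists w : C, 0 < normc w /\ normc w < Num.min e r.
  by apply: small_point; rewrite lt_min e0.
move: we; rewrite lt_min => /andP[we wr]; exists w; split => //; exact: hA.
Qed.

Lemma pexp_isolated f z0 a : pexp f z0 a ->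
  (forall e, 0 < e -> exists w, [/\ 0 < normc w, normc w < e & f (z0 + w) = 0]) ->
  forall i, a i = 0.
Proof.
move=> hf hz i; apply: (pexp_order (A := 0) (k := i.+1) hf) => // e /hz.
by move=> [w [w0 we fw]]; exists w; rewrite fw nm0 mul0r.
Qed.

(** Second-order control of the increments near a point; [D] is the derivative,
    but only its size matters later. *)
Lemma pexp_increment f z0 a : pexp f z0 a ->
  exists K e, [/\ 0 < K, 0 < e & forall v, normc v < e ->
   exists D, [/\ psum (diff_coef a) v D,
     normc (f (z0 + v)) <= K, normc D <= K &
     forall d, normc d < e ->
       normc (f (z0 + v + d) - f (z0 + v) - d * D) <= K * normc d ^+ 2]].
Proof.
move=> /pexp_bound[r [M [r0 hM hf]]].
have M0 := coef_bound_ge0 hM.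
pose K := 2 * M + 2 * (2 * M / r) + 32 * M / r ^+ 2 + 1.
have K1 : 0 <= 2 * M by rewrite mulr_ge0.
have K2 : 0 <= 2 * (2 * M / r) by rewrite mulr_ge0 // divr_ge0 // ltW.
have K3 : 0 <= 32 * M / r ^+ 2.
  by rewrite divr_ge0 ?exprn_ge0 ?(ltW r0) // mulr_ge0.
exists K, (r / 8); split; rewrite ?divr_gt0 //; first by rewrite /K; lra.
move=> v vr; have hM' := coef_bound_diff r0 hM.
have r20 : 0 < r / 2 by rewrite divr_gt0.
have [D hD] : exists D, psum (diff_coef a) v D.
  by apply: (psum_ex r20 hM'); lra.
have hv : psum a v (f (z0 + v)) by apply: hf; lra.
exists D; split => //.
- by apply: le_trans (psum_le r0 hM _ hv) _; rewrite /K; lra.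
- by apply: le_trans (psum_le r20 hM' _ hD) _; rewrite /K; lra.
- move=> d dr; have vd : normc (v + d) <= r / 4.
    by apply: le_trans (nmD _ _) _; lra.
  have hvd : psum a (v + d) (f (z0 + v + d)) by rewrite -addrA; apply: hf; lra.
  apply: (@le_trans _ _ (32 * M / r ^+ 2 * normc d ^+ 2)).
    by apply: (psum_increment_error r0 hM _ vd hv hvd hD); lra.
  by apply: ler_wpM2r; rewrite ?exprn_ge0 ?nm_ge0 // /K; lra.
Qed.

End Expansions.

Section GlobalAnalytic.
Variable R : realType.
Local Notation C := (Cplx R).
Implicit Types (a b : nat -> C) (x w d z S D : C) (f g h : C -> C) (r M : R).

Lemma psum_eq0 a w S : (forall k, a k = 0) -> psum a w S -> S = 0.
Proof.
move=> a0 h; have h0 : csum (fun k => a k * w ^+ k) 0.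
  by apply: eq_csum (@csum0 R) => k; rewrite a0 mul0r.
exact: csum_uniq h h0.
Qed.

Lemma cvg_at_C (T : C -> C) (l : C) :
  (forall e : R, 0 < e -> exists r : R, 0 < r /\
    forall v, v != 0 -> normc v < r -> normc (T v - l) < e) ->
  T v @[v --> 0^'] --> l.
Proof.
move=> h; apply/cvgrPdist_lt => e e0.
have e_real : e = (complex.Re e)%:C by rewrite RRe_real // gtr0_real.
have e0' : 0 < complex.Re e by move: e0; rewrite e_real ltcR.
have [r [r0 hr]] := h _ e0'.
rewrite /dnbhs /= /within /=; apply/nbhs_ballP; exists (r%:C) => /=.
  by rewrite ltcR.
move=> v; rewrite /ball /= normCE sub0r nmN ltcR => vr v0.
by rewrite normCE e_real ltcR nm_subC; exact: hr.
Qed.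

Lemma pexp_derive1 f z0 a : pexp f z0 a -> pexp (derive1 f) z0 (diff_coef a).
Proof.
move=> /pexp_increment[K [e [K0 e0 h]]]; exists e; split; first exact: e0.
move=> v ve; have [D [hD _ _ hd]] := h v ve.
suff -> : derive1 f (z0 + v) = D by exact: hD.
apply/cvg_lim => //; apply: cvg_at_C => r r0.
exists (Num.min e (r / K)); rewrite lt_min e0 divr_gt0 //; split=> // x x0.
rewrite lt_min => /andP[xe xr].
have nx0 : 0 < normc x by rewrite nm_gt0.
have -> : x^-1 *: (f (x + (z0 + v)) - f (z0 + v)) - D =
    x^-1 * (f (z0 + v + x) - f (z0 + v) - x * D).
  by rewrite [x + _]addrC [RHS]mulrBr mulKf.
rewrite nmM nmV mulrC ltr_pdivrMr //; apply: le_lt_trans (hd _ xe) _.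
by rewrite expr2 mulrA ltr_pM2r // mulrC -ltr_pdivlMr.
Qed.

(** Differentiation acts on germs by [diff_coef], and [n] steps bring the [n]-th
    coefficient, times [n!], to the front. *)
Lemma derive1n_pexp f z0 a n : pexp f z0 a ->
  derive1n n f z0 = n`!%:R * a n.
Proof.
move=> h; suff hn : pexp (derive1n n f) z0
    (fun k => ((k + n) ^_ n)%:R * a (k + n)%N).
  by rewrite (pexp_value hn) add0n ffactnn.
elim: n => [|n IH].
  by congr (pexp _ _ _): h; apply/funext => k; rewrite addn0 ffactn0 mul1r.
have -> : (fun k => ((k + n.+1) ^_ n.+1)%:R * a (k + n.+1)%N) =
    diff_coef (fun k => ((k + n) ^_ n)%:R * a (k + n)%N).
  apply/funext => k; rewrite /diff_coef addSnnS ffactnSr addnS subSn ?leq_addl //.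
  by rewrite addnK natrM; ring.
exact: pexp_derive1.
Qed.

(** Along the segment from [0] to [z], the set of points around which [f]
    vanishes is open, and closed because zeros of a power series that is not
    identically zero are isolated. *)
Theorem analytic_identity f : analytic_on_disk f -> pexp f 0 (fun=> 0) ->
  forall z, disk z -> f z = 0.
Proof.
move=> /analytic_pexp hf [r0 [r00 h0]] z hz.
pose V := [set t : R | exists r, 0 < r /\
  forall w, normc w < r -> f (t%:C * z + w) = 0].
pose B := `[0, 1]%classic `&` V.
have z1 : 0 < normc z + 1 by rewrite ltr_wpDl ?nm_ge0.
have segdisk t : 0 <= t <= 1 -> disk (t%:C * z).
  move=> /andP[t0 t1]; rewrite /disk /= nmM nm_real ger0_norm //.
  by apply: le_lt_trans hz; rewrite ler_piMl // nm_ge0.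
have shift_nm (s t : R) : normc (s%:C * z - t%:C * z) <= `|t - s| * (normc z + 1).
  rewrite -mulrBl -rmorphB nmM nm_real distrC ler_wpM2l //.
  by rewrite lerDl.
have BT : B = `[0, 1]%classic; last first.
  have : B 1 by rewrite BT /= in_itv /= ler01 lexx.
  by move=> [_ [r [r_gt0 hr]]]; have := hr 0; rewrite nm0 mul1r addr0; apply.
apply: segment_connected.
- exists 0; split; first by rewrite /= in_itv /= ler01 lexx.
  exists r0; split; first by []. move=> w wr; rewrite mul0r.
  exact: psum_eq0 (h0 _ wr).
- exists V => //; rewrite openE => t [r [r_gt0 hr]].
  apply/nbhs_ballP; exists (r / 2 / (normc z + 1)) => /=.
    by rewrite !divr_gt0.
  move=> s /=; rewrite /ball /= ltr_pdivlMr // => st.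
  exists (r / 2); rewrite divr_gt0 //; split => // w wr.
  have := hr (s%:C * z - t%:C * z + w); rewrite addrA [t%:C * z + _]addrC subrK.
  apply; apply: le_lt_trans (nmD _ _) _.
  by apply: (@lt_trans _ _ (r / 2 + normc w)); [rewrite ltrD2r; exact: le_lt_trans (shift_nm _ _) st|lra].
- exists (closure B); first exact: closed_closure.
  rewrite eqEsubset; split=> t; first by move=> Bt; split; [case: Bt|exact: subset_closure].
  move=> [t01 tB]; split => //; apply: contrapT => nVt.
  have [a ha] := hf _ (segdisk t t01).
  have a0 : forall i, a i = 0.
    apply: (pexp_isolated ha) => e e0.
    have [|s [[s01 Vs]]] := tB (ball t (e / (normc z + 1))).
      by apply: nbhsx_ballx; rewrite divr_gt0.
    rewrite /ball /= ltr_pdivlMr // => st.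
    have [r [r_gt0 hr]] := Vs.
    exists (s%:C * z - t%:C * z); split.
    + rewrite nm_gt0; apply/eqP => /eqP; rewrite subr_eq0 => /eqP E.
      by apply: nVt; exists r; split => //; rewrite -E.
    + exact: le_lt_trans (shift_nm _ _) st.
    + by rewrite [t%:C * z + _]addrC subrK -[s%:C * z]addr0 hr // nm0.
  apply: nVt; have [r [r_gt0 hr]] := ha; exists r; split; first by [].
  by move=> w wr; exact: psum_eq0 a0 (hr _ wr).
Qed.

Lemma compact_closed_disk (rho : R) :
  compact [set p : R * R | p.1 ^+ 2 + p.2 ^+ 2 <= rho ^+ 2].
Proof.
apply: (@subclosed_compact _ _ (`[- `|rho|, `|rho|]%classic `*` `[- `|rho|, `|rho|]%classic)).
- apply: (@preimage_closed _ _ (fun p : R * R => p.1 ^+ 2 + p.2 ^+ 2)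
    [set x | x <= rho ^+ 2]); last exact: closed_le.
  move=> p _; apply: cvgD; apply: (@continuous_comp _ _ _ _ (fun x : R => x ^+ 2)).
  + exact: cvg_fst.
  + exact: exprn_continuous.
  + exact: cvg_snd.
  + exact: exprn_continuous.
- by apply: compact_setX; exact: segment_compact.
- move=> [x y] /= h; split; rewrite /= in_itv /= -ler_norml.
  + rewrite -(@ler_pXn2r _ 2) ?nnegrE // !real_normK ?num_real //.
    by apply: le_trans h; rewrite lerDl sqr_ge0.
  + rewrite -(@ler_pXn2r _ 2) ?nnegrE // !real_normK ?num_real //.
    by apply: le_trans h; rewrite lerDr sqr_ge0.
Qed.

(** The local estimates of [pexp_increment] become uniform by compactness. A single
    small parameter [i] serves as the admissible size of the increments and, through
    its inverse, as the bound. *)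
Lemma analytic_increment f (rho : R) : analytic_on_disk f -> 0 <= rho < 1 ->
  exists K e, [/\ 0 < K, 0 < e & forall w, normc w <= rho ->
    normc (f w) <= K /\ exists D, normc D <= K /\
     forall d, normc d < e ->
       normc (f (w + d) - f w - d * D) <= K * normc d ^+ 2].
Proof.
move=> /analytic_pexp hf /andP[rho0 rho1].
pose P (i : R) (p : R * R) := let w := p.1 +i* p.2 : C in
  normc (f w) <= i^-1 /\ exists D, normc D <= i^-1 /\
     forall d, normc d < i ->
       normc (f (w + d) - f w - d * D) <= i^-1 * normc d ^+ 2.
have /compact_near_coveringP cov := @compact_closed_disk rho.
suff [i [i0 hi]] : exists i : R, 0 < i /\
    [set p : R * R | p.1 ^+ 2 + p.2 ^+ 2 <= rho ^+ 2] `<=` P i.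
  exists i^-1, i; rewrite invr_gt0; split => // w wr.
  have := hi (complex.Re w, complex.Im w).
  rewrite /P /=; have -> : complex.Re w +i* complex.Im w = w by case: (w).
  apply; rewrite -nm_sqr; apply: lerXn2r => //; rewrite ?nnegrE //; exact: nm_ge0.
have near0 : \forall i \near (0 : R)^'+,
    [set p : R * R | p.1 ^+ 2 + p.2 ^+ 2 <= rho ^+ 2] `<=` P i.
  apply: (cov R ((0 : R)^'+) P) => -[x y] /= hxy.
  have zd : disk (x +i* y : C).
    rewrite /disk /= -(@ltr_pXn2r _ 2) ?nnegrE ?sqrtr_ge0 // expr1n.
    rewrite sqr_sqrtr ?addr_ge0 ?sqr_ge0 //; apply: le_lt_trans hxy _.
    by rewrite expr_lt1.
  have [a /pexp_increment[K [e [K0 e0 h]]]] := hf _ zd.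
  have e20 : 0 < e / 2 by rewrite divr_gt0.
  exists (ball (x, y) (e / 2), [set i : R | 0 < i /\ i < Num.min e K^-1]).
    split; first exact: nbhsx_ballx.
    have m0 : 0 < Num.min e K^-1 by rewrite lt_min e0 invr_gt0.
    near=> i; split; near: i; [exact: nbhs_right_gt|exact: nbhs_right_lt].
  move=> [[x' y'] i] /= [[hx hy] [i0]]; rewrite lt_min => /andP[ie iK].
  have Ki : K <= i^-1 by rewrite -[K]invrK lef_pV2 ?posrE ?invr_gt0 // ltW.
  pose v := (x' - x) +i* (y' - y) : C.
  have ve : normc v < e.
    apply: le_lt_trans (nm_le_ReIm _) _; rewrite /v /=.
    by rewrite distrC [`|y' - y|]distrC [ltRHS]splitr ltrD.
  have vE : (x' +i* y' : C) = (x +i* y) + v.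
    by apply: eq_ReIm; rewrite /v ?re_add ?im_add /=; ring.
  have [D [_ hf1 hD hd]] := h v ve.
  rewrite /P /= vE; split; first exact: le_trans Ki.
  exists D; split; first exact: le_trans Ki.
  move=> d di; apply: (le_trans (hd _ (lt_trans di ie))).
  by apply: ler_wpM2r => //; rewrite exprn_ge0 // nm_ge0.
near (0 : R)^'+ => i; exists i; split; near: i => //; exact: nbhs_right_gt.
Unshelve. all: by end_near. Qed.

Lemma pexp_cst c z0 : pexp (fun=> c) z0 (fun k => if k is 0%N then c else 0).
Proof.
exists 1; split=> [|w _]; first by [].
have := @csum_finite _ (fun k => (if k is 0%N then c else 0) * w ^+ k) 1.
by rewrite big_nat1 expr0 mulr1; apply => -[//|k] _; rewrite mul0r.
Qed.

Lemma analytic_continuous f z0 : analytic_on_disk f -> disk z0 ->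
  forall e, 0 < e -> exists r, 0 < r /\
    forall w, normc w < r -> normc (f (z0 + w) - f z0) < e.
Proof.
move=> /analytic_pexp hf /hf [a ha] e e0.
have [|A [r [A0 r0 hr]]] := pexp_bigO (k := 1) (pexpB ha (pexp_cst (f z0) z0)).
  by case=> // _; rewrite -(pexp_value ha) subrr.
exists (Num.min r (e / (A + 1))).
have A1 : 0 < A + 1 by rewrite ltr_wpDl.
rewrite lt_min r0 divr_gt0 //; split => // w; rewrite lt_min => /andP[wr we].
apply: le_lt_trans (hr _ wr) _; rewrite expr1.
apply: (@le_lt_trans _ _ ((A + 1) * normc w)).
  by rewrite ler_wpM2r ?nm_ge0 // lerDl.
by rewrite mulrC -ltr_pdivlMr.
Qed.

End GlobalAnalytic.

(** * Planar Lebesgue measure *)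

Section Plane.
Variable R : realType.
Local Notation plane := (measurableTypeR R * measurableTypeR R)%type.
Local Notation leb := (@lebesgue_measure R).
Local Notation area := (leb \x leb)%E.
Implicit Types (A U : set plane) (p q : plane).

Lemma lebesgue_translation (c : R) (A : set (measurableTypeR R)) : measurable A ->
  leb ((fun x : measurableTypeR R => x + c : measurableTypeR R) @^-1` A) = leb A.
Proof.
move=> mA; have mf : measurable_fun setT
    (fun x : measurableTypeR R => x + c : measurableTypeR R).
  exact: measurable_funD.
rewrite -[LHS]/(pushforward leb
  (fun x : measurableTypeR R => x + c : measurableTypeR R) A).
apply/esym/lebesgue_measure_unique => //= _ [[a b]] _ <-.
rewrite /pushforward.
have -> : (fun x : measurableTypeR R => x + c : measurableTypeR R)
    @^-1` `]a, b]%classic = `]a - c, b - c]%classic.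
  apply/seteqP; split => x /=; rewrite !in_itv /= ltrBlDr lerBrDr //.
rewrite !lebesgue_measure_itv /= !lte_fin ltrD2r.
by case: ifP => // _; rewrite -!EFinD; congr (_%:E); ring.
Qed.

Lemma lebesgue_dilation (c : R) (A : set (measurableTypeR R)) : 0 < c ->
  measurable A ->
  (c%:E * leb ((fun x : measurableTypeR R => (c * x)%R : measurableTypeR R) @^-1` A))%E
    = leb A.
Proof.
move=> c0 mA; have mf : measurable_fun setT
    (fun x : measurableTypeR R => c * x : measurableTypeR R).
  exact: measurable_funM.
have cge0 := ltW c0.
pose f := fun x : measurableTypeR R => c * x : measurableTypeR R.
pose nu : {measure set (measurableTypeR R) -> \bar R} :=
  measure_function_pushforward__canonical__measure_function_Measure leb (f := f) mf.
transitivity (mscale (NngNum cge0) nu A); first by [].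
apply/esym/lebesgue_measure_unique => //= _ [[a b]] _ <-.
rewrite /mscale /nu /= /pushforward.
have -> : f @^-1` `]a, b]%classic = `]a / c, b / c]%classic.
  apply/seteqP; split => x /=; rewrite !in_itv /= ltr_pdivrMr // ler_pdivlMr //;
  by rewrite ![x * c]mulrC.
rewrite !lebesgue_measure_itv /= !lte_fin ltr_pM2r ?invr_gt0 //.
case: ifP => // _; last by rewrite mule0.
by rewrite -!EFinD -EFinM; congr (_%:E); field; rewrite gt_eqF.
Qed.

(** Openness for the product topology, phrased with coordinates so that it can be
    compared with the product sigma-algebra directly. *)
Definition box_open U := forall p, U p -> exists e : R, 0 < e /\
  forall q, `|q.1 - p.1| < e -> `|q.2 - p.2| < e -> U q.

(** A box-open set is the union of the countably many cells of the grids of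
    mesh [1 / (n + 1)] that it contains. *)
Lemma box_open_measurable U : box_open U -> measurable U.
Proof.
move=> hU.
pose cell (n : nat) (i j : int) : set plane :=
  `[i%:~R / n.+1%:R, (i + 1)%:~R / n.+1%:R[%classic `*`
  `[j%:~R / n.+1%:R, (j + 1)%:~R / n.+1%:R[%classic.
pose F (k : nat) : set plane :=
  if @unpickle (nat * (int * int))%type k is Some (n, (i, j))
  then (if `[< cell n i j `<=` U >] then cell n i j else set0) else set0.
have -> : U = \bigcup_k F k.
  apply/seteqP; split => [p Up|p [k _]]; last first.
    rewrite /F; case: unpickle => [[n [i j]]|//].
    by case: asboolP => // + h; apply.
  have [e [e0 he]] := hU p Up.
  have [n hn] : exists n : nat, n.+1%:R^-1 < e.
    by have [n] := ltr_add_invr e0; rewrite add0r; exists n.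
  pose i := Num.floor (p.1 * n.+1%:R); pose j := Num.floor (p.2 * n.+1%:R).
  have celli (x : R) : (Num.floor (x * n.+1%:R))%:~R / n.+1%:R <= x
      < (Num.floor (x * n.+1%:R) + 1)%:~R / n.+1%:R.
    by rewrite ler_pdivrMr // ltr_pdivlMr // floor_le floorD1_gt.
  exists (pickle (n, (i, j))) => //; rewrite /F pickleK; case: asboolP => h.
    by split; rewrite /= in_itv /=; exact: celli.
  exfalso; apply: h => q [] /=; rewrite !in_itv /= => /andP[q1 q2] /andP[q3 q4].
  have dist (x y : R) : (Num.floor (x * n.+1%:R))%:~R / n.+1%:R <= y ->
      y < (Num.floor (x * n.+1%:R) + 1)%:~R / n.+1%:R -> `|y - x| < e.
    move=> h1 h2; have /andP[h3 h4] := celli x; apply: lt_trans hn.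
    move: h2 h4; rewrite intrD mulrDl mul1r => h2 h4.
    rewrite ltr_norml; set c0 := _ / _ in h1 h2 h3 h4.
    by set d0 := _^-1 in h2 h4 *; clearbody c0 d0; apply/andP; split; lra.
  by apply: he; apply: dist.
apply: bigcup_measurable => k _; rewrite /F; case: unpickle => [[n [i j]]|//].
case: asboolP => _ //; apply: measurableX; exact: measurable_itv.
Qed.

Lemma box_continuous_measurable U (f : plane -> R) : box_open U ->
  (forall p, U p -> forall e : R, 0 < e -> exists r : R, 0 < r /\
    forall q, `|q.1 - p.1| < r -> `|q.2 - p.2| < r -> `|f q - f p| < e) ->
  measurable_fun U f.
Proof.
move=> hU hf mU; apply: (measurability _ (RGenOInfty.measurableE R)) => //.
move=> /= _ [_ [a ->] <-]; apply: box_open_measurable => p [Up].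
rewrite /= in_itv /= andbT => ap.
have [e [e0 he]] := hU p Up.
have fpa : 0 < f p - a by rewrite subr_gt0.
have [r [r0 hr]] := hf p Up _ fpa.
exists (Num.min e r); rewrite lt_min e0 r0; split => // q.
rewrite !lt_min => /andP[q1 q2] /andP[q3 q4]; split; first exact: he.
rewrite /= in_itv /= andbT.
have := hr q q2 q4; rewrite ltr_norml => /andP[+ _]; lra.
Qed.

Lemma measurable_linear (a b : R) :
  measurable_fun setT (fun p : plane => a * p.1 + b * p.2 : measurableTypeR R).
Proof. by apply: measurable_funD; apply: measurable_funM. Qed.

Lemma measurable_preimage (f : plane -> plane) A : measurable_fun setT f ->
  measurable A -> measurable (f @^-1` A).
Proof. by move=> mf mA; rewrite -[X in measurable X]setTI; exact: mf. Qed.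

Definition linmap (a b c d : R) (p : plane) : plane :=
  (a * p.1 + b * p.2, c * p.1 + d * p.2).

Lemma linmap_measurable a b c d : measurable_fun setT (linmap a b c d).
Proof. by apply/measurable_fun_pairP; split; exact: measurable_linear. Qed.

(** A shear translates each section, so the shears preserve area by Fubini, taken in
    one order or the other. *)
Lemma area_shear2 (t : R) A : measurable A ->
  area (linmap 1 0 t 1 @^-1` A) = area A.
Proof.
move=> mA; apply: eq_integral => x _ /=.
rewrite -(lebesgue_translation (t * x) (measurable_xsection x mA)).
congr (leb _); apply/seteqP; split => y; rewrite /xsection /= !inE /linmap /=;
by rewrite !mul1r mul0r addr0 addrC.
Qed.

Lemma area_swapE A : measurable A -> area A = (leb \x^ leb)%E A.
Proof.
move=> mA; apply: product_measure_unique => // B D mB mD.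
exact: product_measure2E.
Qed.

Lemma area_shear1 (t : R) A : measurable A ->
  area (linmap 1 t 0 1 @^-1` A) = area A.
Proof.
move=> mA; rewrite !area_swapE //; last first.
  by apply: measurable_preimage => //; exact: linmap_measurable.
apply: eq_integral => y _ /=.
rewrite -(lebesgue_translation (t * y) (measurable_ysection y mA)).
congr (leb _); apply/seteqP; split => x; rewrite /ysection /= !inE /linmap /=;
by rewrite !mul1r mul0r add0r.
Qed.

(** A rotation is a product of three shears. *)
Lemma area_rotation (a b : R) A : a ^+ 2 + b ^+ 2 = 1 -> -1 < a -> measurable A ->
  area (linmap a (- b) b a @^-1` A) = area A.
Proof.
move=> ab a1 mA; pose t := b / (1 + a).
have a10 : 1 + a != 0 by rewrite gt_eqF //; lra.
have -> : linmap a (- b) b a @^-1` A =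
    linmap 1 (- t) 0 1 @^-1` (linmap 1 0 b 1 @^-1` (linmap 1 (- t) 0 1 @^-1` A)).
  have E p : linmap a (- b) b a p =
      linmap 1 (- t) 0 1 (linmap 1 0 b 1 (linmap 1 (- t) 0 1 p)).
    have tb : t * b = 1 - a.
      rewrite /t mulrAC -expr2; apply: (mulIf a10); rewrite mulfVK //.
      have -> : b ^+ 2 = 1 - a ^+ 2 by rewrite -ab; ring.
      by ring.
    have ta : t * (1 + a) = b by rewrite /t mulfVK.
    rewrite /linmap /=; congr (_, _).
      have -> : - b = - (t * (1 + a)) by rewrite ta.
      have -> : a = 1 - t * b by rewrite tb; ring.
      by ring.
    have -> : a = 1 - t * b by rewrite tb; ring.
    by ring.
  by apply/seteqP; split => p /=; rewrite E.
have m1 := linmap_measurable 1 (- t) 0 1.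
have m2 := linmap_measurable 1 0 b 1.
rewrite area_shear1 ?area_shear2 ?area_shear1 //;
  do ?[apply: measurable_preimage => //].
Qed.

Lemma area_dilation (c : R) A : 0 < c -> measurable A ->
  ((c ^+ 2)%:E * area (linmap c 0 0 c @^-1` A))%E = area A.
Proof.
move=> c0 mA; have c20 : 0 <= c ^+ 2 by rewrite exprn_ge0 // ltW.
pose nu : {measure set plane -> \bar R} :=
  measure_function_pushforward__canonical__measure_function_Measure area
    (f := linmap c 0 0 c) (linmap_measurable c 0 0 c).
transitivity (mscale (NngNum c20) nu A); first by [].
apply/esym; apply: product_measure_unique => // B D mB mD.
rewrite /nu.
change ((c ^+ 2)%:E * area (linmap c 0 0 c @^-1` (B `*` D)) = leb B * leb D)%E.
have -> : linmap c 0 0 c @^-1` (B `*` D) =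
    ((fun x : measurableTypeR R => c * x : measurableTypeR R) @^-1` B) `*`
    ((fun x : measurableTypeR R => c * x : measurableTypeR R) @^-1` D).
  by apply/seteqP; split => p; rewrite /linmap /= !mul0r addr0 add0r.
have mpre (E : set (measurableTypeR R)) : measurable E -> measurable
    ((fun x : measurableTypeR R => c * x : measurableTypeR R) @^-1` E).
  move=> mE; rewrite -[X in measurable X]setTI.
  suff : measurable_fun setT (fun x : measurableTypeR R => c * x : measurableTypeR R).
    exact.
  exact: measurable_funM.
rewrite product_measure1E //; try exact: mpre.
rewrite -(lebesgue_dilation c0 mB) -(lebesgue_dilation c0 mD).
by rewrite expr2 EFinM muleACA.
Qed.

Lemma pushforward_integral (phi : plane -> plane) U (f : plane -> \bar R) :
  measurable_fun setT phi -> measurable U ->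
  (forall A, measurable A -> area (phi @^-1` A) = area A) ->
  measurable_fun U f ->
  (\int[area]_(p in phi @^-1` U) f (phi p) = \int[area]_(p in U) f p)%E.
Proof.
move=> mphi mU hphi mf.
have pos (g : plane -> \bar R) : measurable_fun U g -> (forall p, 0 <= g p)%E ->
   (\int[area]_(p in phi @^-1` U) g (phi p) = \int[area]_(p in U) g p)%E.
  move=> mg g0.
  have E := @ge0_integral_pushforward _ _ _ _ R phi mphi area U g mU mg
    (fun y _ => g0 y).
  apply: (etrans (esym E)).
  by apply: eq_measure_integral => A mA _; exact: hphi.
rewrite [LHS]integralE [RHS]integralE; congr (_ - _)%E.
- apply: etrans (pos _ (measurable_funepos mf) _); last by [].
  have E : ((f \o phi)^\+ = f^\+ \o phi)%E by exact: funepos_comp.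
  by apply: eq_integral => p _; exact: (congr1 (fun g => g p) E).
- apply: etrans (pos _ (measurable_funeneg mf) _); last by [].
  have E : ((f \o phi)^\- = f^\- \o phi)%E by exact: funeneg_comp.
  by apply: eq_integral => p _; exact: (congr1 (fun g => g p) E).
Qed.

End Plane.

Section Density.
Variable R : realType.
Local Notation plane := (measurableTypeR R * measurableTypeR R)%type.
Local Notation leb := (@lebesgue_measure R).
Local Notation area := (leb \x leb)%E.
Local Notation C := (Cplx R).

Definition sqdisk (s : R) : set plane := [set p : plane | p.1 ^+ 2 + p.2 ^+ 2 < s].

Lemma sqdisk_measurable s : measurable (sqdisk s).
Proof.
have mf : measurable_fun setT (fun p : plane => p.1 ^+ 2 + p.2 ^+ 2 : R).
  by apply: measurable_funD; apply: measurable_funX.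
have := mf measurableT `]-oo, s[%classic (measurable_itv _).
by rewrite setTI.
Qed.

Lemma area_sqdisk s : 0 <= s -> area (sqdisk s) = (s%:E * area (sqdisk 1))%E.
Proof.
rewrite le_eqVlt => /predU1P[<-|s0].
  rewrite mul0e (_ : sqdisk 0 = set0) ?measure0 //.
  apply/seteqP; split => p //; rewrite /sqdisk /= => /lt_geF.
  by rewrite addr_ge0 // sqr_ge0.
have c0 : 0 < Num.sqrt s by rewrite sqrtr_gt0.
have := area_dilation c0 (sqdisk_measurable s); rewrite sqr_sqrtr ?ltW // => <-.
congr (_ * area _)%E; apply/seteqP; split => p;
  rewrite /sqdisk /linmap /= !mul0r addr0 add0r !exprMn sqr_sqrtr ?(ltW s0) //;
  by rewrite -mulrDr gtr_pMr.
Qed.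

Lemma area_sqdisk1_fin : (area (sqdisk 1) < +oo)%E.
Proof.
apply: (@le_lt_trans _ _ (area (`[-1, 1]%classic `*` `[-1, 1]%classic))).
  apply: le_measure; rewrite ?inE.
  - exact: sqdisk_measurable.
  - by apply: measurableX; exact: measurable_itv.
  - move=> p; rewrite /sqdisk /= => h; rewrite !in_itv /= -!ler_norml.
    have a := sqr_ge0 p.1; have b := sqr_ge0 p.2.
    by split; rewrite -(@ler_pXn2r _ 2) ?nnegrE // expr1n real_normK ?num_real //; lra.
pose I : set (measurableTypeR R) := `[-1, 1]%classic.
have L : leb I = (1 - -1)%:E.
  by rewrite lebesgue_measure_itv /= lte_fin ifT //; lra.
have -> : area (I `*` I) = (leb I * leb I)%E.
  by apply: product_measure1E; exact: measurable_itv.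
by rewrite L -EFinM ltry.
Qed.

Definition annulus (j : nat) : set plane :=
  sqdisk (1 - (1 / 2) ^+ j.+1) `\` sqdisk (1 - (1 / 2) ^+ j).

Lemma half_pow_gt0 j : 0 < (1 / 2 : R) ^+ j.
Proof. by rewrite exprn_gt0. Qed.

Lemma half_pow_le1 j : (1 / 2 : R) ^+ j <= 1.
Proof. by rewrite exprn_ile1 //; lra. Qed.

Lemma area_annulus j : area (annulus j) = (((1 / 2) ^+ j.+1)%:E * area (sqdisk 1))%E.
Proof.
have V0 := area_sqdisk1_fin.
have h1 := half_pow_gt0 j; have h2 := half_pow_le1 j.
have h3 := half_pow_gt0 j.+1; have h4 := half_pow_le1 j.+1.
have E : (1 / 2 : R) ^+ j.+1 = (1 / 2) ^+ j / 2 by rewrite exprS; ring.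
have Vfin : area (sqdisk 1) \is a fin_num by rewrite ge0_fin_numE.
set X := sqdisk (1 - (1 / 2) ^+ j.+1); set Y := sqdisk (1 - (1 / 2) ^+ j).
have EX : area X = (((1 - (1 / 2) ^+ j.+1) * fine (area (sqdisk 1)))%:E)%E.
  by rewrite EFinM (fineK Vfin); apply: area_sqdisk; rewrite subr_ge0.
have EY : area Y = (((1 - (1 / 2) ^+ j) * fine (area (sqdisk 1)))%:E)%E.
  by rewrite EFinM (fineK Vfin); apply: area_sqdisk; rewrite subr_ge0.
have YX : X `&` Y = Y.
  apply: setIidr => p; rewrite /X /Y /sqdisk /= => h; apply: (lt_trans h); lra.
have -> : area (annulus j) = (area X - area (X `&` Y))%E.
  apply: measureD; [exact: sqdisk_measurable|exact: sqdisk_measurable|].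
  by apply: (@le_lt_trans _ _ (area X)); [exact: lexx|rewrite EX ltry].
rewrite YX EX EY -[in RHS](fineK Vfin) -!EFinM -EFinB; congr (_%:E).
by rewrite E; field.
Qed.

Lemma annulusP j p : annulus j p <->
  (1 / 2) ^+ j.+1 < 1 - (p.1 ^+ 2 + p.2 ^+ 2) <= (1 / 2) ^+ j.
Proof.
rewrite /annulus /sqdisk /=; split.
  by move=> [h1 /negP]; rewrite -leNgt => h2; apply/andP; split; lra.
by move=> /andP[h1 h2]; split; [|apply/negP; rewrite -leNgt]; lra.
Qed.

Lemma half_pow_anti i j : (1 / 2 : R) ^+ i < (1 / 2) ^+ j -> (j < i)%N.
Proof.
rewrite ltNge => /negP h; rewrite ltnNge; apply/negP => ij; apply: h.
by apply: ler_wiXn2l => //; lra.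
Qed.

Lemma annulus_trivIset : trivIset setT annulus.
Proof.
apply/trivIsetP => i j _ _ /eqP ij; rewrite -subset0 => p.
move=> [/annulusP /andP[h1 h2] /annulusP /andP[h3 h4]]; apply: ij.
have := half_pow_anti (lt_le_trans h1 h4); have := half_pow_anti (lt_le_trans h3 h2).
by rewrite !ltnS => a b; apply/eqP; rewrite eqn_leq a b.
Qed.

Lemma annulus_cover : sqdisk 1 = \bigcup_j annulus j.
Proof.
apply/seteqP; split => p; last first.
  move=> [j _] /annulusP/andP[h _]; rewrite /sqdisk /=.
  by have := half_pow_gt0 j.+1; lra.
rewrite /sqdisk /= => p1; pose s := 1 - (p.1 ^+ 2 + p.2 ^+ 2).
have s0 : 0 < s by rewrite subr_gt0.
have ex : exists j, (1 / 2) ^+ j.+1 < s.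
  exists (Num.Def.archi_bound s^-1).
  have : s^-1 < 2 ^+ (Num.Def.archi_bound s^-1).+1.
    by apply: upper_nthrootP; exact: leqnSn.
  rewrite expr_div_n expr1n div1r -ltf_pV2 ?posrE ?invr_gt0 ?exprn_gt0 //.
  by rewrite invrK.
case: (ex_minnP ex) => j hj hmin; exists j => //; apply/annulusP.
rewrite -/s hj /=; case: j hj hmin => [|j] _ hmin.
  by rewrite expr0 /s gerBl addr_ge0 // sqr_ge0.
by rewrite leNgt; apply/negP => /hmin; rewrite ltnn.
Qed.

Lemma density_measurable beta : measurable_fun [set: plane] (bergman_density beta : plane -> R).
Proof.
have -> : bergman_density beta = fun p : plane =>
    (beta + 1) / pi * (1 - (p.1 ^+ 2 + p.2 ^+ 2)) `^ beta.
  by apply/funext => p; rewrite /bergman_density nm_sqr.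
apply: measurable_funM; first by [].
apply: (measurableT_comp (f := (fun x : R => x `^ beta))); first exact: measurable_powR.
apply: measurable_funB => //.
by apply: measurable_funD; apply: measurable_funX.
Qed.

Lemma density_ge0 beta p : -1 < beta -> 0 <= bergman_density beta p :> R.
Proof.
move=> hb; rewrite mulr_ge0 ?powR_ge0 // divr_ge0 ?pi_ge0 //; lra.
Qed.

Lemma planar_diskE : @planar_disk R = sqdisk 1.
Proof.
apply/seteqP; split => p; rewrite /sqdisk /planar_disk /disk /= => h.
  rewrite -(@ltr_pXn2r _ 2) ?nnegrE ?nm_ge0 // expr1n in h.
  by move: h; rewrite sqr_sqrtr // addr_ge0 ?sqr_ge0.
rewrite -(@ltr_pXn2r _ 2) ?nnegrE ?nm_ge0 // expr1n.
by rewrite sqr_sqrtr // addr_ge0 ?sqr_ge0.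
Qed.

Lemma planar_disk_measurable : measurable (@planar_disk R : set plane).
Proof. by rewrite planar_diskE; exact: sqdisk_measurable. Qed.

(** On the annulus where [2^-(j+1) < 1 - |z|^2 <= 2^-j], of area proportional to
    [2^-(j+1)], the density is at most a multiple of [2^-(j+1)] to the power
    [min(beta, 0)]; the sum over [j] is geometric because [beta > -1]. *)
Lemma density_integrable beta : -1 < beta ->
  area.-integrable (@planar_disk R) (EFin \o @bergman_density R beta).
Proof.
move=> hb; have md := density_measurable beta.
have mdE : measurable_fun (@planar_disk R : set plane)
    (EFin \o @bergman_density R beta).
  by apply/measurable_EFinP; exact: measurable_funTS.
apply/integrableP; split => //.
have -> : (\int[area]_(p in @planar_disk R) `|(EFin \o bergman_density beta) p|
   = \int[area]_(p in @planar_disk R) (bergman_density beta p)%:E)%E.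
  by apply: eq_integral => p _ /=; rewrite ger0_norm // density_ge0.
rewrite planar_diskE annulus_cover ge0_integral_bigcup; first last.
- exact: annulus_trivIset.
- by move=> p _; rewrite lee_fin density_ge0.
- by rewrite -annulus_cover -planar_diskE.
- by move=> j; apply: measurableD; exact: sqdisk_measurable.
pose K := (beta + 1) / pi : R.
have K0 : 0 <= K by rewrite divr_ge0 ?pi_ge0 //; lra.
pose b := Num.min beta 0.
have b1 : -1 < b by rewrite lt_min hb; lra.
have b0 : b <= 0 by rewrite ge_min lexx orbT.
have bb : b <= beta by rewrite ge_min lexx.
have Vfin : area (sqdisk 1) \is a fin_num.
  by rewrite ge0_fin_numE ?area_sqdisk1_fin.
pose V := fine (area (sqdisk 1)).
have V0 : 0 <= V by apply: fine_ge0.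
pose q := (1 / 2 : R) `^ (b + 1).
have q0 : 0 < q by rewrite powR_gt0 //; lra.
have q1 : q < 1.
  rewrite /q /powR gt_eqF; last by lra.
  by rewrite expR_lt1 pmulr_rlt0 ?ln_lt0 //; lra.
have step j : (\int[area]_(p in annulus j) (bergman_density beta p)%:E
     <= (K * V * q * q ^+ j)%:E)%E.
  apply: (@le_trans _ _
    (\int[area]_(p in annulus j) cst (K * ((1 / 2) ^+ j.+1) `^ b)%:E p)%E).
    apply: ge0_le_integral => //.
    - by apply: measurableD; exact: sqdisk_measurable.
    - by move=> p _; rewrite lee_fin density_ge0.
    - by apply/measurable_EFinP; exact: measurable_funTS.
    - move=> p /annulusP /andP[h1 h2]; rewrite lee_fin /bergman_density nm_sqr.
      apply: ler_wpM2l => //=; set s := 1 - _ in h1 h2 *.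
      have h0 := half_pow_gt0 j.+1.
      have s0 : 0 < s by exact: lt_trans h1.
      have s1 : s <= 1 by apply: le_trans h2 (half_pow_le1 j).
      apply: (@le_trans _ _ (s `^ b)); first by apply: ger_powR => //; rewrite s0.
      rewrite /powR !gt_eqF // ler_expR ler_wnM2l // ler_ln ?posrE //.
      exact: ltW.
  rewrite integral_cst; last by apply: measurableD; exact: sqdisk_measurable.
  rewrite [X in (_ * X)%E](_ : _ = ((1 / 2) ^+ j.+1 * V)%:E); last first.
    by apply: (etrans (area_annulus j)); rewrite EFinM fineK.
  rewrite -EFinM lee_fin.
  rewrite le_eqVlt; apply/orP; left; apply/eqP.
  have -> : ((1 / 2 : R) ^+ j.+1) `^ b = ((1 / 2) `^ b) ^+ j.+1.
    rewrite -[RHS]powR_mulrn ?powR_ge0 // -powRrM [b * _]mulrC powRrM powR_mulrn //.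
  have -> : q = (1 / 2) `^ b * (1 / 2).
    rewrite /q powRD; first by rewrite powRr1.
    by apply/implyP => _; rewrite gt_eqF.
  by rewrite [in RHS]exprMn !exprS; ring.
apply: (@le_lt_trans _ _ ((K * V * q) / (1 - q))%:E); last by rewrite ltry.
apply: lime_le.
  by apply: is_cvg_nneseries => j _ _; apply: integral_ge0 => p _; rewrite lee_fin density_ge0.
apply: nearW => n; apply: (@le_trans _ _ (\sum_(0 <= j < n) (K * V * q * q ^+ j)%:E)%E).
  by apply: lee_sum => j _; exact: step.
rewrite sumEFin lee_fin.
apply: geometric_le_lim => //; last by rewrite ger0_norm // ltW.
by apply: mulr_ge0; [exact: mulr_ge0|exact: ltW].
Qed.

End Density.

(** * Weighted integrals of complex functions *)

Section WeightedIntegral.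
Variable R : realType.
Local Notation plane := (measurableTypeR R * measurableTypeR R)%type.
Local Notation area := (@lebesgue_measure R \x @lebesgue_measure R)%E.
Local Notation C := (Cplx R).
Variable beta : R.
Hypothesis hbeta : -1 < beta.
Local Notation dens := (bergman_density beta).
Implicit Types (phi psi : plane -> R) (F G : C -> C) (rho B : R) (z w : C).

Definition cdisk rho : set plane := [set p : plane | normc (p.1 +i* p.2 : C) < rho].

Lemma complex_diff (p q : plane) :
  (q.1 +i* q.2 : C) = (p.1 +i* p.2 : C) + ((q.1 - p.1) +i* (q.2 - p.2) : C).
Proof. by apply: eq_ReIm; rewrite ?re_add ?im_add /=; ring. Qed.

Lemma complex_diff_small (p q : plane) (e : R) :
  `|q.1 - p.1| < e / 2 -> `|q.2 - p.2| < e / 2 ->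
  normc ((q.1 - p.1) +i* (q.2 - p.2) : C) < e.
Proof.
move=> h1 h2; apply: le_lt_trans (nm_le_ReIm _) _.
by rewrite [ltRHS]splitr ltrD.
Qed.

Lemma cdisk_box_open rho : box_open (cdisk rho).
Proof.
move=> p hp; exists ((rho - normc (p.1 +i* p.2 : C)) / 2).
rewrite divr_gt0 ?subr_gt0 //; split=> // q h1 h2; change (normc (q.1 +i* q.2 : C) < rho).
rewrite (complex_diff p).
apply: le_lt_trans (nmD _ _) _; rewrite -ltrBrDl.
exact: complex_diff_small.
Qed.

Lemma cdisk_measurable rho : measurable (cdisk rho).
Proof. by apply: box_open_measurable; exact: cdisk_box_open. Qed.

Lemma cdisk_sub rho : rho <= 1 -> cdisk rho `<=` @planar_disk R.
Proof. by move=> r1 p; rewrite /cdisk /planar_disk /disk /=; move/lt_le_trans; apply. Qed.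

Lemma dens_measurable D : measurable_fun (D : set plane) (dens : plane -> R).
Proof. by apply: measurable_funTS; exact: density_measurable. Qed.

Lemma dens_integrable rho : rho <= 1 ->
  area.-integrable (cdisk rho) (EFin \o (dens : plane -> R)).
Proof.
move=> r1; apply: (integrableS _ _ (cdisk_sub r1) (density_integrable hbeta)).
- exact: planar_disk_measurable.
- exact: cdisk_measurable.
Qed.

(** ** Real-valued integrands *)

(** The radius is a parameter because the functions of the Bergman space are only
    known to be bounded on smaller disks. *)
Definition rint rho phi : R := \int[area]_(p in cdisk rho) (phi p * dens p).
Definition rintegrable rho phi :=
  area.-integrable (cdisk rho) (EFin \o (fun p : plane => phi p * dens p)).

Lemma rintegrable_le rho phi psi : measurable_fun (cdisk rho) phi ->
  (forall p, cdisk rho p -> `|phi p| <= psi p) ->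
  rintegrable rho psi -> rintegrable rho phi.
Proof.
move=> mphi hle; apply: le_integrable; first exact: cdisk_measurable.
  by apply/measurable_EFinP; apply: measurable_funM => //; exact: dens_measurable.
move=> p hp; have d0 := density_ge0 p hbeta.
have h := hle p hp; rewrite /= lee_fin !normrM ler_wpM2r //.
by apply: (le_trans h); exact: ler_norm.
Qed.

Lemma rintegrable_cst rho B : rho <= 1 -> rintegrable rho (fun=> B).
Proof.
move=> r1; have := integrableZl (cdisk_measurable rho) B (dens_integrable r1).
by apply: eq_integrable => //; exact: cdisk_measurable.
Qed.

Lemma rintegrable_bounded rho phi B : rho <= 1 -> measurable_fun (cdisk rho) phi ->
  (forall p, cdisk rho p -> `|phi p| <= B) -> rintegrable rho phi.
Proof.
by move=> r1 mphi hB; apply: rintegrable_le mphi hB (rintegrable_cst B r1).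
Qed.

Lemma eq_rintegrable rho phi psi : (forall p, cdisk rho p -> phi p = psi p) ->
  rintegrable rho phi -> rintegrable rho psi.
Proof.
move=> E; apply: eq_integrable; first exact: cdisk_measurable.
by move=> p; rewrite inE => hp /=; rewrite E.
Qed.

Lemma eq_rint rho phi psi : (forall p, cdisk rho p -> phi p = psi p) ->
  rint rho phi = rint rho psi.
Proof. by move=> E; apply: eq_Rintegral => p; rewrite inE => hp; rewrite E. Qed.

Lemma rintegrableD rho phi psi : rintegrable rho phi -> rintegrable rho psi ->
  rintegrable rho (fun p => phi p + psi p).
Proof.
move=> h1 h2; have := integrableD (cdisk_measurable rho) h1 h2.
apply: eq_integrable; first exact: cdisk_measurable.
by move=> p _; rewrite /= -EFinD -mulrDl.
Qed.

Lemma rintegrableZ rho (a : R) phi : rintegrable rho phi ->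
  rintegrable rho (fun p => a * phi p).
Proof.
move=> h; have := integrableZl (cdisk_measurable rho) a h.
apply: eq_integrable; first exact: cdisk_measurable.
by move=> p _; rewrite /= -EFinM mulrA.
Qed.

Lemma rintD rho phi psi : rintegrable rho phi -> rintegrable rho psi ->
  rint rho (fun p => phi p + psi p) = rint rho phi + rint rho psi.
Proof.
move=> h1 h2; rewrite /rint -RintegralD //; last exact: cdisk_measurable.
by apply: eq_Rintegral => p _; rewrite mulrDl.
Qed.

Lemma rintZ rho (a : R) phi : rintegrable rho phi ->
  rint rho (fun p => a * phi p) = a * rint rho phi.
Proof.
move=> h; rewrite /rint -RintegralZl //; last exact: cdisk_measurable.
by apply: eq_Rintegral => p _; rewrite mulrA.
Qed.

Lemma rintegrableB rho phi psi : rintegrable rho phi -> rintegrable rho psi ->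
  rintegrable rho (fun p => phi p - psi p).
Proof.
move=> h1 h2; have := rintegrableD h1 (rintegrableZ (-1) h2).
by apply: eq_rintegrable => p _; rewrite mulN1r.
Qed.

Lemma rintB rho phi psi : rintegrable rho phi -> rintegrable rho psi ->
  rint rho (fun p => phi p - psi p) = rint rho phi - rint rho psi.
Proof.
move=> h1 h2; rewrite -[- _]mulN1r -rintZ // -rintD //; last exact: rintegrableZ.
by apply: eq_rint => p _; rewrite mulN1r.
Qed.

Definition mass : R := rint 1 (fun=> 1).

Lemma rint_le rho phi B : rho <= 1 -> rintegrable rho phi -> 0 <= B ->
  (forall p, cdisk rho p -> `|phi p| <= B) -> `|rint rho phi| <= B * mass.
Proof.
move=> r1 iphi B0 hB.
apply: le_trans (le_normr_Rintegral (cdisk_measurable rho) iphi) _.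
rewrite /mass -rintZ; last exact: rintegrable_cst.
have iB : rintegrable 1 (fun=> B) by exact: rintegrable_cst.
have iBr : rintegrable rho (fun=> B) by exact: rintegrable_cst.
have iabs : area.-integrable (cdisk rho) (EFin \o (fun p => `|phi p * dens p|)).
  have := integrable_norm iphi; apply: eq_integrable => //.
  exact: cdisk_measurable.
have -> : rint 1 (fun=> B * 1) = rint 1 (fun=> B).
  by apply: eq_rint => p _; rewrite mulr1.
apply: (@le_trans _ _ (rint rho (fun=> B))).
  apply: le_Rintegral => //; first exact: cdisk_measurable.
  move=> p hp; rewrite normrM [`|dens p|]ger0_norm ?density_ge0 //.
  by rewrite ler_wpM2r ?density_ge0 // hB.
have fin r (ir : rintegrable r (fun=> B)) :
    (\int[area]_(p in cdisk r) (B * dens p)%:E)%E \is a fin_num.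
  by apply: (integrable_fin_num (cdisk_measurable r) ir).
rewrite /rint /Rintegral fine_le ?fin //.
apply: ge0_subset_integral.
- exact: cdisk_measurable.
- exact: cdisk_measurable.
- apply/measurable_EFinP; apply: measurable_funM => //; exact: dens_measurable.
- by move=> p _; rewrite lee_fin mulr_ge0 // density_ge0.
- by move=> p; rewrite /cdisk /= => /lt_le_trans; apply.
Qed.

End WeightedIntegral.

Section ComplexIntegral.
Variable R : realType.
Local Notation plane := (measurableTypeR R * measurableTypeR R)%type.
Local Notation area := (@lebesgue_measure R \x @lebesgue_measure R)%E.
Local Notation C := (Cplx R).
Variable beta : R.
Hypothesis hbeta : -1 < beta.
Local Notation dens := (bergman_density beta).
Implicit Types (phi psi : plane -> R) (F G f g h : C -> C) (rho B : R) (z w : C).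

Definition re_on F : plane -> R := fun p => complex.Re (F (p.1 +i* p.2)).
Definition im_on F : plane -> R := fun p => complex.Im (F (p.1 +i* p.2)).

Definition cint rho F : C :=
  rint beta rho (re_on F) +i* rint beta rho (im_on F).
Definition cintegrable rho F :=
  rintegrable beta rho (re_on F) /\ rintegrable beta rho (im_on F).
Definition cmeasurable rho F :=
  measurable_fun (cdisk rho) (re_on F) /\ measurable_fun (cdisk rho) (im_on F).

Lemma bergman_innerE f g : bergman_inner beta f g =
  cint 1 (fun z => f z * conjc (g z)).
Proof. by []. Qed.

Lemma eq_cint rho F G : (forall z, normc z < rho -> F z = G z) ->
  cint rho F = cint rho G.
Proof.
by move=> E; congr (_ +i* _); apply: eq_rint => p hp; rewrite /re_on /im_on E.
Qed.

Lemma eq_cintegrable rho F G : (forall z, normc z < rho -> F z = G z) ->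
  cintegrable rho F -> cintegrable rho G.
Proof.
move=> E [h1 h2]; split; [apply: eq_rintegrable h1|apply: eq_rintegrable h2];
by move=> p hp; rewrite /re_on /im_on E.
Qed.

Lemma cintegrableD rho F G : cintegrable rho F -> cintegrable rho G ->
  cintegrable rho (fun z => F z + G z).
Proof.
move=> [h1 h2] [h3 h4]; split.
  apply: eq_rintegrable (rintegrableD h1 h3) => p _.
  by rewrite /re_on re_add.
apply: eq_rintegrable (rintegrableD h2 h4) => p _.
by rewrite /im_on im_add.
Qed.

Lemma cintegrableZ rho (c : C) F : cintegrable rho F ->
  cintegrable rho (fun z => c * F z).
Proof.
move=> [h1 h2]; split.
  apply: eq_rintegrable (rintegrableB (rintegrableZ (complex.Re c) h1)
    (rintegrableZ (complex.Im c) h2)) => p _.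
  by rewrite /re_on /im_on re_mul.
apply: eq_rintegrable (rintegrableD (rintegrableZ (complex.Re c) h2)
  (rintegrableZ (complex.Im c) h1)) => p _.
by rewrite /re_on /im_on im_mul.
Qed.

Lemma cintD rho F G : cintegrable rho F -> cintegrable rho G ->
  cint rho (fun z => F z + G z) = cint rho F + cint rho G.
Proof.
move=> [h1 h2] [h3 h4]; apply: eq_ReIm; rewrite ?re_add ?im_add /= -rintD //;
by apply: eq_rint => p _; rewrite /re_on /im_on ?re_add ?im_add.
Qed.

Lemma cintZ rho (c : C) F : cintegrable rho F ->
  cint rho (fun z => c * F z) = c * cint rho F.
Proof.
move=> [h1 h2]; apply: eq_ReIm; rewrite ?re_mul ?im_mul /=.
  rewrite -(rintZ _ h1) -(rintZ _ h2) -rintB; try exact: rintegrableZ.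
  by apply: eq_rint => p _; rewrite /re_on re_mul.
rewrite -(rintZ _ h1) -(rintZ _ h2) -rintD; try exact: rintegrableZ.
by apply: eq_rint => p _; rewrite /im_on im_mul.
Qed.

Lemma cintegrableB rho F G : cintegrable rho F -> cintegrable rho G ->
  cintegrable rho (fun z => F z - G z).
Proof.
move=> h1 h2; have := cintegrableD h1 (cintegrableZ (-1) h2).
by apply: eq_cintegrable => z _; rewrite mulN1r.
Qed.

Lemma cintB rho F G : cintegrable rho F -> cintegrable rho G ->
  cint rho (fun z => F z - G z) = cint rho F - cint rho G.
Proof.
move=> h1 h2; rewrite -[X in _ + X]mulN1r -cintZ //.
rewrite -cintD //; last exact: cintegrableZ.
by apply: eq_cint => z _; rewrite mulN1r.
Qed.

Lemma cintJ rho F : cintegrable rho F ->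
  cint rho (fun z => conjc (F z)) = conjc (cint rho F).
Proof.
move=> [h1 h2]; apply: eq_ReIm => /=.
  by apply: eq_rint => p _; rewrite /re_on; case: (F _).
rewrite -mulN1r -rintZ //; apply: eq_rint => p _.
by rewrite /im_on mulN1r; case: (F _).
Qed.

Lemma cintegrable_bounded rho F B : rho <= 1 -> cmeasurable rho F ->
  (forall z, normc z < rho -> normc (F z) <= B) -> cintegrable rho F.
Proof.
move=> r1 [m1 m2] hB; split; apply: (rintegrable_bounded hbeta (B := B)) => // p hp.
  exact: le_trans (Re_le_nm _) (hB _ hp).
exact: le_trans (Im_le_nm _) (hB _ hp).
Qed.

Lemma cint_le rho F B : rho <= 1 -> cintegrable rho F -> 0 <= B ->
  (forall z, normc z < rho -> normc (F z) <= B) ->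
  normc (cint rho F) <= 2 * B * mass beta.
Proof.
move=> r1 [i1 i2] B0 hB; apply: le_trans (nm_le_ReIm _) _ => /=.
have -> : 2 * B * mass beta = B * mass beta + B * mass beta by ring.
apply: lerD; apply: rint_le => // p hp.
  exact: le_trans (Re_le_nm _) (hB _ hp).
exact: le_trans (Im_le_nm _) (hB _ hp).
Qed.

Lemma cmeasurableM rho F G : cmeasurable rho F -> cmeasurable rho G ->
  cmeasurable rho (fun z => F z * G z).
Proof.
move=> [h1 h2] [h3 h4]; split.
  have := measurable_funB (measurable_funM h1 h3) (measurable_funM h2 h4).
  by apply: eq_measurable_fun => p _; rewrite /re_on re_mul.
have := measurable_funD (measurable_funM h1 h4) (measurable_funM h2 h3).
by apply: eq_measurable_fun => p _; rewrite /im_on im_mul.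
Qed.

Lemma cmeasurableJ rho F : cmeasurable rho F -> cmeasurable rho (fun z => conjc (F z)).
Proof.
move=> [h1 h2]; split.
  by apply: eq_measurable_fun h1 => p _; rewrite /re_on; case: (F _).
have := measurable_funN h2.
by apply: eq_measurable_fun => p _; rewrite /im_on /=; case: (F _).
Qed.

Lemma cmeasurable_continuous rho F : (forall z, normc z < rho ->
    forall e, 0 < e -> exists r : R, 0 < r /\
    forall w, normc w < r -> normc (F (z + w) - F z) < e) ->
  cmeasurable rho F.
Proof.
move=> h; split; (apply: box_continuous_measurable; first exact: cdisk_box_open);
  move=> p hp e e0; have [r [r0 hr]] := h _ hp e e0;
  exists (r / 2); rewrite divr_gt0 //; split => // q h1 h2;
  have hpq := hr _ (complex_diff_small h1 h2);
  apply: le_lt_trans hpq; rewrite -complex_diff /re_on /im_on.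
  by apply: le_trans (Re_le_nm _); rewrite re_add re_opp.
by apply: le_trans (Im_le_nm _); rewrite im_add im_opp.
Qed.

Lemma analytic_cmeasurable rho f (s : C) : analytic_on_disk f ->
  (forall z, normc z < rho -> normc (s * z) < 1) ->
  cmeasurable rho (fun z => f (s * z)).
Proof.
move=> hf hs; apply: cmeasurable_continuous => z zr e e0.
have [r [r0 hr]] := analytic_continuous hf (hs z zr) e0.
have s1 : 0 < normc s + 1 by rewrite ltr_wpDl ?nm_ge0.
exists (r / (normc s + 1)); rewrite divr_gt0 //; split => // w.
rewrite ltr_pdivlMr // => wr; rewrite mulrDr; apply: hr.
rewrite nmM; apply: le_lt_trans wr; rewrite mulrC.
by apply: ler_wpM2l; rewrite ?nm_ge0 // lerDl.
Qed.

Lemma analytic_cmeasurable1 rho f : rho <= 1 -> analytic_on_disk f -> cmeasurable rho f.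
Proof.
move=> r1 hf; apply: cmeasurable_continuous => z zr e e0.
by apply: analytic_continuous => //; exact: lt_le_trans zr r1.
Qed.

Lemma analytic_monomial k : analytic_on_disk (fun z : C => z ^+ k).
Proof.
by apply/analytic_pexp => z _; eexists; exact: pexp_monomial.
Qed.

(** The disk and the density depend only on the modulus; [-1 < Re mu] is what the
    factorization into shears requires. *)
Lemma cint_rotation rho F (mu : C) : rho <= 1 -> normc mu = 1 -> -1 < complex.Re mu ->
  cmeasurable rho F ->
  cint rho (fun z => F (mu * z)) = cint rho F.
Proof.
move=> r1 mu1 mure [m1 m2].
pose rot := linmap (complex.Re mu) (- complex.Im mu) (complex.Im mu) (complex.Re mu).
have rotE (p : plane) : mu * (p.1 +i* p.2) = ((rot p).1 +i* (rot p).2 : C).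
  by apply: eq_ReIm; rewrite ?re_mul ?im_mul /=; ring.
have real_case (phi : plane -> R) : measurable_fun (cdisk rho) phi ->
    rint beta rho (fun p => phi (rot p)) = rint beta rho phi.
  move=> mphi; rewrite /rint /Rintegral; congr fine.
  have dE : cdisk rho = rot @^-1` cdisk rho.
    apply/seteqP; split => p; rewrite /preimage /cdisk /mkset -rotE;
    by rewrite nmM mu1 mul1r.
  have nmE (p : plane) : dens p = dens (rot p).
    by rewrite /bergman_density -rotE nmM mu1 mul1r.
  have := @pushforward_integral R rot (cdisk rho)
    (fun p => (phi p * dens p)%:E).
  rewrite -dE => <-.
  - by apply: eq_integral => p _; rewrite nmE.
  - exact: linmap_measurable.
  - exact: cdisk_measurable.
  - move=> A mA; apply: area_rotation => //.
    by rewrite -nm_sqr mu1 expr1n.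
  - apply/measurable_EFinP; apply: measurable_funM => //.
    exact: dens_measurable.
congr (_ +i* _).
  rewrite -[RHS]real_case //; apply: eq_rint => p _.
  by rewrite /re_on rotE.
rewrite -[RHS]real_case //; apply: eq_rint => p _.
by rewrite /im_on rotE.
Qed.

(** Dominated convergence along an increasing sequence of concentric disks. *)
Lemma rint_exhaustion phi : rintegrable beta 1 phi ->
  (forall rho, 0 <= rho < 1 -> rint beta rho phi = 0) -> rint beta 1 phi = 0.
Proof.
move=> iphi h0; pose f := EFin \o (fun p : plane => phi p * dens p).
pose rho n : R := 1 - n.+1%:R^-1.
have rho01 n : 0 <= rho n < 1.
  apply/andP; split; first by rewrite subr_ge0 invf_le1 ?ltr0n // ler1n.
  by rewrite ltrBlDr ltrDl invr_gt0 ltr0n.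
have sub n : cdisk (rho n) `<=` cdisk (1 : R).
  by move=> p; rewrite /cdisk /mkset => /lt_trans; apply; case/andP: (rho01 n).
pose f_ n := f \_ (cdisk (rho n)).
have mf : measurable_fun (cdisk 1) f by case/integrableP: iphi.
have f_le n p : (`|f_ n p| <= `|f p|)%E.
  by rewrite /f_ /patch; case: ifP => // _; rewrite abse0 abse_ge0.
have [||||_ _ hlim] := @dominated_convergence _ _ R area (cdisk 1)
  (cdisk_measurable 1) f_ f (fun p => `|f p|%E) _ mf.
- move=> n; apply: (measurable_restrict f (cdisk_measurable _) (cdisk_measurable _)).1.
  by apply: measurable_funS mf; [exact: cdisk_measurable|exact: subIsetl].
- apply: aeW => p p1; apply: cvg_near_cst.
  have p0 : 0 < 1 - normc (p.1 +i* p.2 : C) by rewrite subr_gt0.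
  have := near_infty_natSinv_lt (PosNum p0).
  apply: filterS => n /= hn; rewrite /f_ patchT // inE /cdisk /mkset /rho.
  by rewrite ltrBrDl -ltrBrDr.
- exact: integrable_abse.
- by apply: aeW => p n _; exact: f_le.
have E n : (\int[area]_(x in cdisk 1) f_ n x)%E = 0%E.
  rewrite /f_ -integral_mkcondr setIidr //.
  have fin : (\int[area]_(x in cdisk (rho n)) f x)%E \is a fin_num.
    apply: integrable_fin_num; first exact: cdisk_measurable.
    by apply: integrableS iphi => //; exact: cdisk_measurable.
  by rewrite -(fineK fin); congr (_%:E); exact: h0 (rho01 n).
have := cvg_lim (@ereal_hausdorff R) hlim.
rewrite (_ : [sequence _]_n = fun=> 0%E); last by apply/funext => n; exact: E.
by rewrite lim_cst // /rint /Rintegral -[X in fine X]/(integral _ _ _) => <-.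
Qed.

Lemma cint_exhaustion F : cintegrable 1 F ->
  (forall rho, 0 <= rho < 1 -> cint rho F = 0) -> cint 1 F = 0.
Proof.
move=> [h1 h2] h; apply: eq_ReIm; apply: rint_exhaustion => // rho hr.
  by have /(f_equal (@complex.Re R)) := h rho hr.
by have /(f_equal (@complex.Im R)) := h rho hr.
Qed.

(** ** The Bergman space *)

Lemma bergman_integrable f : bergman beta f ->
  rintegrable beta 1 (fun p => normc (f (p.1 +i* p.2)) ^+ 2).
Proof.
move=> [hf hlt]; have [m1 m2] := analytic_cmeasurable1 (lexx 1) hf.
apply/integrableP; split.
  apply/measurable_EFinP; apply: measurable_funM; last exact: dens_measurable.
  have := measurable_funD (measurable_funX 2 m1) (measurable_funX 2 m2).
  by apply: eq_measurable_fun => p _; rewrite nm_sqr.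
apply: le_lt_trans hlt; rewrite le_eqVlt; apply/orP; left; apply/eqP.
apply: eq_integral => p _ /=; rewrite ger0_norm // mulr_ge0 ?density_ge0 //.
by rewrite exprn_ge0 ?nm_ge0.
Qed.

Lemma bergman_intro f : analytic_on_disk f ->
  rintegrable beta 1 (fun p => normc (f (p.1 +i* p.2)) ^+ 2) -> bergman beta f.
Proof.
move=> hf /integrableP[_ hlt]; split => //.
apply: le_lt_trans hlt; rewrite le_eqVlt; apply/orP; left; apply/eqP.
apply: eq_integral => p _ /=; rewrite ger0_norm // mulr_ge0 ?density_ge0 //.
by rewrite exprn_ge0 ?nm_ge0.
Qed.

Lemma nm_measurable rho F : cmeasurable rho F ->
  measurable_fun (cdisk rho) (fun p : plane => normc (F (p.1 +i* p.2)) ^+ 2).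
Proof.
move=> [m1 m2]; have := measurable_funD (measurable_funX 2 m1) (measurable_funX 2 m2).
by apply: eq_measurable_fun => p _; rewrite nm_sqr.
Qed.

Lemma bergman_bounded f B : analytic_on_disk f ->
  (forall z, disk z -> normc (f z) <= B) -> bergman beta f.
Proof.
move=> hf hB; apply: bergman_intro => //.
apply: (rintegrable_bounded hbeta (B := B ^+ 2)) => //.
  by apply: nm_measurable; exact: analytic_cmeasurable1.
move=> p hp; rewrite ger0_norm ?exprn_ge0 ?nm_ge0 //.
by apply: lerXn2r; rewrite ?nnegrE ?nm_ge0 ?hB // (le_trans (nm_ge0 _) (hB _ hp)).
Qed.

Lemma bergman_monomial k : bergman beta (fun z : C => z ^+ k).
Proof.
apply: (bergman_bounded (B := 1)); first exact: analytic_monomial.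
by move=> z hz; rewrite nmX exprn_ile1 ?nm_ge0 // ltW.
Qed.

Lemma eq_bergman f g : eq_on_disk f g -> bergman beta f -> bergman beta g.
Proof.
move=> E hf; apply: bergman_intro.
  apply/analytic_pexp => z hz; have [/analytic_pexp/(_ z hz)[a ha] _] := hf.
  have [r [r0 hr]] := disk_nbhs hz; exists a.
  by apply: (eq_pexp r0 _ ha) => w /hr /E.
by apply: eq_rintegrable (bergman_integrable hf) => p hp; rewrite E.
Qed.

Lemma bergmanB f g : bergman beta f -> bergman beta g ->
  bergman beta (fun z => f z - g z).
Proof.
move=> hf hg; have [af _] := hf; have [ag _] := hg.
have afg : analytic_on_disk (fun z => f z - g z).
  apply/analytic_pexp => z hz.
  have [a ha] := (analytic_pexp f).1 af z hz.
  have [b hb] := (analytic_pexp g).1 ag z hz.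
  by exists (fun k => a k - b k); exact: pexpB.
apply: bergman_intro => //.
have h := rintegrableD (rintegrableZ 2 (bergman_integrable hf))
  (rintegrableZ 2 (bergman_integrable hg)).
apply: (rintegrable_le hbeta _ _ h).
  by apply: (nm_measurable (F := fun z => f z - g z)); exact: analytic_cmeasurable1.
move=> p _; rewrite ger0_norm ?exprn_ge0 ?nm_ge0 //.
set x := f _; set y := g _; apply: (@le_trans _ _ ((normc x + normc y) ^+ 2)).
  by apply: lerXn2r; rewrite ?nnegrE ?addr_ge0 ?nm_ge0 // nmB.
have := sqr_ge0 (normc x - normc y); rewrite sqrrB sqrrD; lra.
Qed.

Lemma bergmanZ (c : C) f : bergman beta f -> bergman beta (fun z => c * f z).
Proof.
move=> hf; have [af _] := hf; apply: bergman_intro.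
  apply/analytic_pexp => z hz; have [a ha] := (analytic_pexp f).1 af z hz.
  by exists (fun k => c * a k); exact: pexpZ.
apply: eq_rintegrable (rintegrableZ (normc c ^+ 2) (bergman_integrable hf)) => p _.
by rewrite nmM exprMn.
Qed.

Lemma inner_integrable f g : bergman beta f -> bergman beta g ->
  cintegrable 1 (fun z => f z * conjc (g z)).
Proof.
move=> hf hg; have [af _] := hf; have [ag _] := hg.
have h := rintegrableD (bergman_integrable hf) (bergman_integrable hg).
have [m1 m2] : cmeasurable 1 (fun z => f z * conjc (g z)).
  apply: cmeasurableM; first exact: analytic_cmeasurable1.
  by apply: cmeasurableJ; exact: analytic_cmeasurable1.
have bound p : normc (f (p.1 +i* p.2) * conjc (g (p.1 +i* p.2))) <=
   normc (f (p.1 +i* p.2)) ^+ 2 + normc (g (p.1 +i* p.2)) ^+ 2.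
  rewrite nmM nmJ; set x := normc _; set y := normc _.
  have := sqr_ge0 (x - y); have := sqr_ge0 (x + y); rewrite sqrrB sqrrD; lra.
split; apply: (rintegrable_le hbeta _ _ h) => // p _.
  exact: le_trans (Re_le_nm _) (bound p).
exact: le_trans (Im_le_nm _) (bound p).
Qed.

Lemma innerB f g h : bergman beta f -> bergman beta g -> bergman beta h ->
  bergman_inner beta (fun z => f z - g z) h =
  bergman_inner beta f h - bergman_inner beta g h.
Proof.
move=> hf hg hh; rewrite !bergman_innerE -cintB; try exact: inner_integrable.
by apply: eq_cint => z _; rewrite mulrBl.
Qed.

Lemma innerZ (c : C) f h : bergman beta f -> bergman beta h ->
  bergman_inner beta (fun z => c * f z) h = c * bergman_inner beta f h.
Proof.
move=> hf hh; rewrite !bergman_innerE -cintZ; try exact: inner_integrable.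
by apply: eq_cint => z _; rewrite mulrA.
Qed.

Lemma inner_conj f g : bergman beta f -> bergman beta g ->
  bergman_inner beta g f = conjc (bergman_inner beta f g).
Proof.
move=> hf hg; rewrite !bergman_innerE -cintJ; last exact: inner_integrable.
by apply: eq_cint => z _; rewrite rmorphM /= conjcK mulrC.
Qed.

Lemma eq_inner f f' g g' : eq_on_disk f f' -> eq_on_disk g g' ->
  bergman_inner beta f g = bergman_inner beta f' g'.
Proof.
move=> Ef Eg; rewrite !bergman_innerE; apply: eq_cint => z hz.
by rewrite Ef // Eg.
Qed.

End ComplexIntegral.

(** * Taylor coefficients as inner products *)

Section Constancy.
Variable R : realType.
Local Notation C := (Cplx R).

Lemma is_derive_quadratic (g : R -> R) (s v K d : R) : 0 < d ->
  (forall x, `|x| < d -> `|g (s + x) - g s - x * v| <= K * x ^+ 2) ->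
  is_derive s 1 g v.
Proof.
move=> d0 h.
have lim : (fun x => x^-1 *: (g (x *: 1 + s) - g s)) @ 0^' --> v.
  apply/cvgrPdist_lt => e e0.
  have K1 : 0 < `|K| + 1 by rewrite ltr_wpDl.
  rewrite /dnbhs /= /within /=; apply/nbhs_ballP.
  exists (Num.min d (e / (`|K| + 1))) => /=; first by rewrite lt_min d0 divr_gt0.
  move=> x; rewrite /ball /= sub0r normrN lt_min => /andP[xd xe] x0.
  have nx : 0 < `|x| by rewrite normr_gt0.
  rewrite distrC /GRing.scale /= mulr1 [x + s]addrC.
  have -> : x^-1 * (g (s + x) - g s) - v = x^-1 * (g (s + x) - g s - x * v).
    by rewrite [RHS]mulrBr mulKf.
  rewrite normrM normfV mulrC ltr_pdivrMr //; apply: le_lt_trans (h _ xd) _.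
  rewrite -real_normK ?num_real // expr2 mulrA ltr_pM2r //.
  apply: (@le_lt_trans _ _ (`|K| * `|x|)); first by rewrite ler_wpM2r // ler_norm.
  apply: (@le_lt_trans _ _ ((`|K| + 1) * `|x|)); first by rewrite ler_wpM2r // lerDl.
  by rewrite mulrC -ltr_pdivlMr.
apply: DeriveDef; first by apply/cvg_ex; exists v.
by apply/cvg_lim.
Qed.

Lemma derive0_constant (g : R -> R) (a b : R) :
  (forall s, a < s < b -> is_derive s 1 g 0) ->
  forall x y, a < x < b -> a < y < b -> g x = g y.
Proof.
move=> h x y; wlog xy : x y / x <= y.
  move=> W hx hy; have [|/ltW] := leP x y; first by move/W; apply.
  by move/W => /(_ hy hx) ->.
move: xy; rewrite le_eqVlt => /predU1P[-> //|xy] /andP[ax xb] /andP[ay yb].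
have hd t : t \in `]x, y[ -> is_derive t 1 g ((fun=> 0) t).
  by rewrite in_itv /= => /andP[xt ty]; apply: h; rewrite (lt_trans ax xt) (lt_trans ty yb).
have [|c _] := MVT xy hd.
  apply: derivable_within_continuous => t; rewrite in_itv /= => /andP[xt ty].
  have /h[] // : a < t < b by rewrite (lt_le_trans ax xt) (le_lt_trans ty yb).
by rewrite mul0r => /eqP; rewrite subr_eq0 => /eqP ->.
Qed.

(** Increments of second order force the derivative to vanish. *)
Lemma quadratic_constant (G : R -> C) (a b : R) :
  (forall s, a < s < b -> exists K d, 0 < d /\
     forall x, `|x| < d -> normc (G (s + x) - G s) <= K * x ^+ 2) ->
  forall x y, a < x < b -> a < y < b -> G x = G y.
Proof.
move=> h x y hx hy; apply: eq_ReIm.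
  apply: (@derive0_constant (fun t => complex.Re (G t)) a b) => // s /h[K [d [d0 hd]]].
  apply: (is_derive_quadratic (K := K) d0) => t /hd; rewrite mulr0 subr0.
  by apply: le_trans; apply: le_trans (Re_le_nm _); rewrite re_add re_opp.
apply: (@derive0_constant (fun t => complex.Im (G t)) a b) => // s /h[K [d [d0 hd]]].
apply: (is_derive_quadratic (K := K) d0) => t /hd; rewrite mulr0 subr0.
by apply: le_trans; apply: le_trans (Im_le_nm _); rewrite im_add im_opp.
Qed.

(** A rational parametrization of the circle near 1, whose expansion
    [1 + 2 i t + O(t^2)] is elementary. *)
Definition cayley (t : R) : C := (1 + 'i * t%:C) / (1 - 'i * t%:C).

Lemma cayley_den_ge1 (t : R) : 1 <= normc (1 - 'i * t%:C : C).
Proof.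
have -> : (1 - 'i * t%:C : C) = 1 +i* (- t) by apply: eq_ReIm => /=; ring.
by apply: le_trans (Re_le_nm _); rewrite /= normr1.
Qed.

Lemma cayley_den_neq0 (t : R) : (1 - 'i * t%:C : C) != 0.
Proof. by rewrite -nm_gt0; apply: lt_le_trans (cayley_den_ge1 t). Qed.

Lemma nm_cayley (t : R) : normc (cayley t) = 1.
Proof.
rewrite /cayley nmM nmV.
have <- : normc (1 - 'i * t%:C : C) = normc (1 + 'i * t%:C : C).
  have -> : (1 - 'i * t%:C : C) = conjc (1 + 'i * t%:C : C).
    by apply: eq_ReIm => /=; ring.
  exact: nmJ.
by rewrite divff // gt_eqF // nm_gt0 cayley_den_neq0.
Qed.

Lemma complex_i2 : ('i : C) * 'i = -1.
Proof. by apply: eq_ReIm => /=; ring. Qed.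

Lemma cayley_sub1 (t : R) : cayley t - 1 = 2 * 'i * t%:C / (1 - 'i * t%:C).
Proof. by rewrite /cayley; field; exact: cayley_den_neq0. Qed.

Lemma cayley_quadratic (t : R) :
  cayley t - 1 - 2 * 'i * t%:C = - (2 * t%:C ^+ 2) / (1 - 'i * t%:C).
Proof.
have h := cayley_den_neq0 t; rewrite cayley_sub1; apply: (mulIf h).
rewrite mulrBl !mulfVK // mulrBr mulr1 opprB addrC subrK.
have -> : 2 * 'i * t%:C * ('i * t%:C) = 2 * ('i * 'i) * t%:C ^+ 2 :> C by ring.
by rewrite complex_i2; ring.
Qed.

Lemma nm_div_cayley_den (x : C) (t : R) : normc (x / (1 - 'i * t%:C)) <= normc x.
Proof.
rewrite nmM nmV ler_pdivrMr ?(lt_le_trans ltr01 (cayley_den_ge1 t)) //.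
by rewrite ler_peMr ?nm_ge0 // cayley_den_ge1.
Qed.

Lemma nm_two : normc (2 : C) = 2.
Proof. exact: nm_nat. Qed.

Lemma nm_cayley_sub1 (t : R) : normc (cayley t - 1) <= 2 * `|t|.
Proof.
rewrite cayley_sub1; apply: le_trans (nm_div_cayley_den _ _) _.
by rewrite !nmM nm_two nmi nm_real mulr1.
Qed.

Lemma nm_cayley_quadratic (t : R) :
  normc (cayley t - 1 - 2 * 'i * t%:C) <= 2 * t ^+ 2.
Proof.
rewrite cayley_quadratic; apply: le_trans (nm_div_cayley_den _ _) _.
by rewrite nmN nmM nm_two nmX nm_real real_normK ?num_real.
Qed.

Lemma Re_cayley (t : R) : -1 < complex.Re (cayley t).
Proof.
have := Re_le_nm (cayley t); rewrite nm_cayley ler_norml => /andP[h _].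
rewrite lt_neqAle h andbT; apply/eqP => E.
have I0 : complex.Im (cayley t) = 0.
  have := nm_sqr (cayley t); rewrite nm_cayley -E sqrrN expr1n => /eqP.
  by rewrite -subr_eq0 opprD addrA subrr sub0r oppr_eq0 sqrf_eq0 => /eqP.
have : cayley t = -1 by apply: eq_ReIm; rewrite -?E ?I0 /= ?oppr0.
rewrite /cayley => /(congr1 (fun x => x * (1 - 'i * t%:C))).
rewrite mulfVK ?cayley_den_neq0 // => /eqP.
rewrite -subr_eq0; have -> : 1 + 'i * t%:C - -1 * (1 - 'i * t%:C) = 2 :> C by ring.
by rewrite -nm_eq0 nm_two; lra.
Qed.

(** Multiplying the tangential increment of [mu^k] by [- i] gives, to first order,
    the radial increment of [r^k] at [r = 1 + 2 t]. *)
Lemma cayley_power (t : R) k : `|t| <= 1 / 2 ->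
  normc (1 - 'i * (cayley t ^+ k - 1) - (1 + (2 * t)%:C) ^+ k)
    <= (2 * 4 ^+ k + 2 * k%:R) * t ^+ 2.
Proof.
move=> t1.
have hpow (d : C) : normc d <= 2 * `|t| -> normc (1 + d) <= 2 ->
    normc ((1 + d) ^+ k - 1 - k%:R * d) <= 4 ^+ k * t ^+ 2.
  move=> d1 d2; have := @power_increment_error R 1 d 2 k.
  rewrite nm1 !expr1n mulr1 => /(_ _ d2 _).
  have -> : 2 * 2 = 4 :> R by ring.
  move=> h; have {}h := h ltac:(lra) ltac:(lra).
  have d3 : normc d ^+ 2 <= 4 * t ^+ 2.
    have -> : 4 * t ^+ 2 = (2 * `|t|) ^+ 2 by rewrite exprMn real_normK ?num_real //; ring.
    by apply: lerXn2r; rewrite ?nnegrE ?nm_ge0 // mulr_ge0.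
  have p4 : 0 <= 4 ^+ k :> R by rewrite exprn_ge0.
  have := le_trans h (ler_wpM2r p4 d3); set X := normc _; set P := 4 ^+ k.
  move=> h'; rewrite -(@ler_pM2r _ 4) //.
  have -> : P * t ^+ 2 * 4 = 4 * t ^+ 2 * P by ring.
  by have -> : X * 4 = X * 2 ^+ 2 by ring.
have h1 := hpow (cayley t - 1) (nm_cayley_sub1 t).
rewrite addrCA subrr addr0 nm_cayley in h1.
have h2 := hpow (2 * t)%:C.
have n2t : normc ((2 * t)%:C : C) = 2 * `|t| by rewrite nm_real normrM ger0_norm.
rewrite n2t in h2.
have {}h2 := h2 (lexx _) _.
have b2 : normc (1 + (2 * t)%:C : C) <= 2.
  by apply: le_trans (nmD _ _) _; rewrite nm1 n2t; lra.
have {}h2 := h2 b2; have {}h1 := h1 ltac:(lra).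
set P := (1 + _) ^+ k in h2 *; set M := cayley t ^+ k in h1 *.
have h3 := nm_cayley_quadratic t; set d := cayley t - 1 in h1 h3.
have -> : 1 - 'i * (M - 1) - P = - ('i * (M - 1 - k%:R * d))
    - (P - 1 - k%:R * (2 * t)%:C) - 'i * k%:R * (d - 2 * 'i * t%:C).
  have -> : (2 * t)%:C = - 'i * (2 * 'i * t%:C) :> C.
    rewrite rmorphM /= rmorph_nat.
    have -> : - 'i * (2 * 'i * t%:C) = - ('i * 'i) * (2 * t%:C) :> C by ring.
    by rewrite complex_i2 opprK mul1r.
  by ring.
apply: le_trans (nmB _ _) _; apply: le_trans (lerD (nmB _ _) (lexx _)) _.
rewrite nmN !nmM nmi nm_nat !mul1r.
have -> : (2 * 4 ^+ k + 2 * k%:R) * t ^+ 2 =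
  4 ^+ k * t ^+ 2 + 4 ^+ k * t ^+ 2 + k%:R * (2 * t ^+ 2) :> R by ring.
by apply: lerD; [exact: lerD|exact: ler_wpM2l].
Qed.

End Constancy.

Section Coefficients.
Variable R : realType.
Local Notation C := (Cplx R).
Variable beta : R.
Hypothesis hbeta : -1 < beta.
Implicit Types (F G f g h : C -> C) (rho B : R) (z w : C).

Lemma mass_ge0 : 0 <= mass beta.
Proof.
by apply: Rintegral_ge0 => p _; rewrite mul1r density_ge0.
Qed.

Section Moment.
Variables (h : C -> C) (k : nat) (rho : R).
Hypothesis hh : analytic_on_disk h.
Hypothesis rho01 : 0 <= rho < 1.

Let integrand (s : C) : C -> C := fun z => h (s * z) * conjc (z ^+ k).
Let moment (s : C) : C := cint beta rho (integrand s).

Let rho0 : 0 <= rho. Proof. by case/andP: rho01. Qed.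
Let rho1 : rho <= 1. Proof. by case/andP: rho01 => _ /ltW. Qed.

Let zk_le1 z : normc z < rho -> normc (conjc (z ^+ k)) <= 1.
Proof.
move=> zr; rewrite nmJ nmX exprn_ile1 ?nm_ge0 //.
by rewrite ltW // (lt_le_trans zr).
Qed.

Let integrand_measurable (s : C) : normc s * rho < 1 ->
  cmeasurable rho (integrand s).
Proof.
move=> sr; apply: cmeasurableM.
  apply: analytic_cmeasurable => // z zr; rewrite nmM; apply: le_lt_trans sr.
  by rewrite ler_wpM2l ?nm_ge0 // ltW.
apply: (cmeasurableJ (F := fun z => z ^+ k)).
exact: (analytic_cmeasurable1 rho1 (@analytic_monomial R k)).
Qed.

Let integrand_integrable (s : C) : normc s * rho < 1 ->
  cintegrable beta rho (integrand s).
Proof.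
move=> sr; have sr0 : 0 <= normc s * rho < 1 by rewrite sr mulr_ge0 ?nm_ge0.
have [K [e [K0 e0 hK]]] := analytic_increment hh sr0.
apply: (cintegrable_bounded hbeta (B := K)) => //; first exact: integrand_measurable.
move=> z zr; rewrite nmM -[leRHS]mulr1; apply: ler_pM; rewrite ?nm_ge0 ?zk_le1 //.
by apply: (hK _ _).1; rewrite nmM ler_wpM2l ?nm_ge0 // ltW.
Qed.

(** Substitute [mu z] for [z] in the integral. *)
Let moment_rotation (s mu : C) : normc mu = 1 -> -1 < complex.Re mu ->
  normc s * rho < 1 -> moment (s * mu) = mu ^+ k * moment s.
Proof.
move=> mu1 mure sr.
have muk : mu ^+ k * conjc (mu ^+ k) = 1 by rewrite mulJ_nm nmX mu1 !expr1n.
have kmu : conjc (mu ^+ k) * mu ^+ k = 1 by rewrite mulrC.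
have pt z : integrand (s * mu) z = mu ^+ k * integrand s (mu * z).
  have E : conjc ((mu * z) ^+ k) = conjc (mu ^+ k) * conjc (z ^+ k).
    by rewrite exprMn rmorphM.
  rewrite /integrand E mulrA.
  transitivity (mu ^+ k * conjc (mu ^+ k) * (h (s * mu * z) * conjc (z ^+ k))).
    by rewrite muk mul1r.
  by rewrite mulrA; ring.
have srmu : normc (s * mu) * rho < 1 by rewrite nmM mu1 mulr1.
have int : cintegrable beta rho (fun z => integrand s (mu * z)).
  apply: eq_cintegrable (cintegrableZ (conjc (mu ^+ k)) (integrand_integrable srmu)).
  by move=> z _; rewrite pt mulrA kmu mul1r.
rewrite /moment -(cint_rotation beta rho1 mu1 mure (integrand_measurable sr)).
by rewrite -cintZ //; apply: eq_cint => z _; exact: pt.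
Qed.

(** Comparing the increments of [h (s z)] in the tangential and in the radial
    direction: they differ by the factor [i] up to second order, and the
    tangential increment of the moment is known by rotation invariance. *)
Let moment_increment (s : R) : 0 < s -> s * rho < 1 ->
  exists K d, 0 < d /\ forall t, `|t| < d ->
    normc (moment (s%:C * (1 + (2 * t)%:C)) -
           (1 + (2 * t)%:C) ^+ k * moment s%:C) <= K * t ^+ 2.
Proof.
move=> s0 sr.
have ns : normc (s%:C : C) = s by rewrite nm_real ger0_norm // ltW.
have sr01 : 0 <= s * rho < 1 by rewrite sr mulr_ge0 // ltW.
have [K [e [K0 e0 hK]]] := analytic_increment hh sr01.
have gap : 0 < (1 - s * rho) / (2 * s).
  by rewrite divr_gt0 ?subr_gt0 // mulr_gt0.
pose d := Num.min (Num.min (1 / 2) (e / 2)) ((1 - s * rho) / (2 * s)).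
have d0 : 0 < d by rewrite !lt_min gap !divr_gt0.
exists (2 * (10 * K) * mass beta + (2 * 4 ^+ k + 2 * k%:R) * normc (moment s%:C)), d.
split => // t; rewrite !lt_min => /andP[/andP[t1 t2] t3].
pose mu := cayley t; pose r := 1 + (2 * t)%:C : C.
have n2t : normc ((2 * t)%:C : C) = 2 * `|t| by rewrite nm_real normrM ger0_norm.
have nr : normc r <= 1 + 2 * `|t| by apply: le_trans (nmD _ _) _; rewrite nm1 n2t.
have sr' : normc (s%:C * r) * rho < 1.
  rewrite nmM ns; apply: (@le_lt_trans _ _ (s * (1 + 2 * `|t|) * rho)).
    by rewrite ler_wpM2r // ler_wpM2l // ltW.
  have h3 : 2 * s * `|t| < 1 - s * rho by rewrite mulrC -ltr_pdivlMr // mulr_gt0.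
  have h4 : s * `|t| * rho <= s * `|t| * 1 by rewrite ler_wpM2l // mulr_ge0 // ltW.
  have -> : s * (1 + 2 * `|t|) * rho = s * rho + 2 * (s * `|t| * rho) by ring.
  have : 2 * s * `|t| = 2 * (s * `|t| * 1) by ring.
  lra.
have srs : normc (s%:C : C) * rho < 1 by rewrite ns.
have srmu : normc (s%:C * mu) * rho < 1 by rewrite nmM nm_cayley mulr1 ns.
have rotE := moment_rotation (nm_cayley t) (Re_cayley t) srs.
pose E z := integrand (s%:C * mu) z - integrand s%:C z
  - 'i * (integrand (s%:C * r) z - integrand s%:C z).
have iE1 := cintegrableB (integrand_integrable srmu) (integrand_integrable srs).
have iE2 := cintegrableB (integrand_integrable sr') (integrand_integrable srs).
have iE : cintegrable beta rho E by exact: cintegrableB iE1 (cintegrableZ _ iE2).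
have cE : cint beta rho E = moment (s%:C * mu) - moment s%:C
    - 'i * (moment (s%:C * r) - moment s%:C).
  rewrite /E (cintB iE1 (cintegrableZ _ iE2)) cintZ // !cintB //;
  exact: integrand_integrable.
have Eb z : normc z < rho -> normc (E z) <= 10 * K * t ^+ 2.
  move=> zr; pose w := s%:C * z.
  have wr : normc w <= s * rho by rewrite nmM ns ler_wpM2l // ltW.
  have w1 : normc w <= 1 by apply: (le_trans wr); case/andP: sr01 => _ /ltW.
  have [_ [D [DK hD]]] := hK w wr.
  pose d1 := w * (mu - 1); pose d2 := w * (2 * t)%:C.
  have d1t : normc d1 <= 2 * `|t|.
    rewrite nmM -[leRHS]mul1r; apply: ler_pM; rewrite ?nm_ge0 //.
    exact: nm_cayley_sub1.
  have d2t : normc d2 <= 2 * `|t| by rewrite nmM n2t -[leRHS]mul1r ler_wpM2r // mulr_ge0.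
  have te : 2 * `|t| < e by rewrite mulrC -ltr_pdivlMr.
  have h1 := hD d1 (le_lt_trans d1t te).
  have h2 := hD d2 (le_lt_trans d2t te).
  have sq x : normc x <= 2 * `|t| -> K * normc x ^+ 2 <= 4 * K * t ^+ 2.
    move=> hx; have -> : 4 * K * t ^+ 2 = K * (2 * `|t|) ^+ 2.
      by rewrite exprMn real_normK ?num_real //; ring.
    by rewrite ler_pM2l // lerXn2r // nnegrE ?nm_ge0 // mulr_ge0.
  have {}h1 := le_trans h1 (sq _ d1t); have {}h2 := le_trans h2 (sq _ d2t).
  have h3 : normc (D * w * (mu - 1 - 2 * 'i * t%:C)) <= 2 * K * t ^+ 2.
    have -> : 2 * K * t ^+ 2 = K * 1 * (2 * t ^+ 2) by ring.
    rewrite (nmM (D * w)) (nmM D); apply: ler_pM; rewrite ?mulr_ge0 ?nm_ge0 //.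
      by apply: ler_pM; rewrite ?nm_ge0.
    exact: nm_cayley_quadratic.
  have -> : E z = ((h (w + d1) - h w - d1 * D) - 'i * (h (w + d2) - h w - d2 * D)
      + D * w * (mu - 1 - 2 * 'i * t%:C)) * conjc (z ^+ k).
    rewrite /E /integrand.
    have gen1 (a x m : C) : a * m * x = a * x + a * x * (m - 1) by ring.
    have gen2 (a x m : C) : a * (1 + m) * x = a * x + a * x * m by ring.
    have -> : s%:C * mu * z = w + d1 by exact: gen1.
    have -> : s%:C * r * z = w + d2 by exact: gen2.
    have -> : s%:C * z = w by [].
    have -> : d2 = w * (2 * t%:C) by rewrite /d2 rmorphM /= rmorph_nat.
    by rewrite /d1; ring.
  rewrite nmM -[leRHS]mulr1; apply: ler_pM; rewrite ?nm_ge0 ?zk_le1 //.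
  apply: le_trans (nmD _ _) _.
  have -> : 10 * K * t ^+ 2 = (4 * K * t ^+ 2 + 4 * K * t ^+ 2) + 2 * K * t ^+ 2 by ring.
  apply: lerD h3; apply: le_trans (nmB _ _) _; apply: lerD h1 _.
  by rewrite nmM nmi mul1r.
have E0 : 0 <= 10 * K * t ^+ 2.
  by apply: mulr_ge0; [apply: mulr_ge0; [|exact: ltW]|exact: sqr_ge0].
have h1 := cint_le hbeta rho1 iE E0 Eb.
have h2 := @cayley_power R t k (ltW t1).
have -> : moment (s%:C * r) - r ^+ k * moment s%:C =
    'i * cint beta rho E + (1 - 'i * (mu ^+ k - 1) - r ^+ k) * moment s%:C.
  rewrite cE rotE.
  have gen (i q b M N : C) : i * i = -1 -> M - b * N =
      i * (q * N - N - i * (M - N)) + (1 - i * (q - 1) - b) * N.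
    move=> i2; have -> : i * (q * N - N - i * (M - N)) =
      i * (q * N - N) - (i * i) * (M - N) by ring.
    by rewrite i2; ring.
  by apply: gen; exact: complex_i2.
apply: le_trans (nmD _ _) _; rewrite !nmM nmi mul1r mulrDl.
apply: lerD.
  by apply: (le_trans h1); rewrite le_eqVlt; apply/orP; left; apply/eqP; ring.
by rewrite mulrAC ler_wpM2r ?nm_ge0.
Qed.

(** By [moment_increment] the quotient of the moment by [s^k] has zero derivative. *)
Let moment_constant (s1 s2 : R) : 0 < s1 -> 0 < s2 -> s1 * rho < 1 -> s2 * rho < 1 ->
  moment s1%:C / s1%:C ^+ k = moment s2%:C / s2%:C ^+ k.
Proof.
move=> s10 s20 s11 s21; pose m := Num.max s1 s2.
have m1 : m * rho < 1 by rewrite /m maxEle; case: ifP.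
have lem s : s <= m -> s < m + (1 - m * rho).
  by move/le_lt_trans; apply; rewrite ltrDl subr_gt0.
have brho : (m + (1 - m * rho)) * rho <= 1.
  have : m * rho * (1 - rho) <= 1 * (1 - rho).
    by apply: ler_wpM2r; [rewrite subr_ge0 | exact: ltW].
  by rewrite mulrBr mul1r mulr1 mulrDl mulrBl mul1r; lra.
apply: (@quadratic_constant R (fun s => moment s%:C / s%:C ^+ k) 0 (m + (1 - m * rho))).
- move=> s /andP[s0 sb].
  have sr : s * rho < 1.
    have [r0|r0] := eqVneq rho 0; first by rewrite r0 mulr0.
    by apply: lt_le_trans brho; rewrite ltr_pM2r // lt_def r0.
  have [K [d [d0 hd]]] := moment_increment s0 sr.
  have sh : 0 < s / 2 by rewrite divr_gt0.
  exists (`|K| / (4 * s ^+ 2) / (s / 2) ^+ k), (Num.min (2 * s * d) (s / 2)).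
  rewrite lt_min sh !mulr_gt0 //; split=> // x; rewrite lt_min => /andP[xd xs].
  pose t := x / (2 * s).
  have s2n : 2 * s != 0 by rewrite gt_eqF // mulr_gt0.
  have td : `|t| < d.
    by rewrite /t normrM normfV (gtr0_norm (_ : 0 < 2 * s)) ?mulr_gt0 //
      ltr_pdivrMr ?mulr_gt0 // mulrC.
  have sx : s + x = s * (1 + 2 * t).
    by rewrite /t; field; rewrite gt_eqF.
  have sx2 : s / 2 <= s + x.
    by move: xs; rewrite ltr_norml => /andP[h1 _]; lra.
  have sx0 : 0 < s + x by exact: lt_le_trans sx2.
  have t0 : 0 < 1 + 2 * t by rewrite -(pmulr_rgt0 _ s0) -sx.
  have cn0 (y : R) : 0 < y -> (y%:C : C) != 0.
    by move=> y0; rewrite -nm_gt0 nm_real gtr0_norm.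
  have E : moment (s + x)%:C / (s + x)%:C ^+ k - moment s%:C / s%:C ^+ k =
     (moment (s%:C * (1 + (2 * t)%:C)) - (1 + (2 * t)%:C) ^+ k * moment s%:C)
       / (s + x)%:C ^+ k.
    have h1 : (s + x)%:C = s%:C * (1 + (2 * t)%:C) :> C.
      by rewrite sx rmorphM /= rmorphD /= rmorph1.
    have h2 : (1 + (2 * t)%:C : C) != 0.
      by have := cn0 _ t0; rewrite rmorphD rmorph1.
    rewrite h1 exprMn; move: (cn0 _ s0) h2.
    set a := s%:C; set b := 1 + _; set M := moment _; set N := moment _ => a0 b0.
    have gen (p q u v : C) : p != 0 -> q != 0 ->
       u / (p * q) - v / p = (u - q * v) / (p * q).
      by move=> p0 q0; field; rewrite p0 q0.
    by apply: gen; rewrite expf_neq0.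
  rewrite E nmM nmV nmX nm_real gtr0_norm //.
  rewrite mulrAC; apply: ler_pM; rewrite ?nm_ge0 ?invr_ge0 ?exprn_ge0 ?(ltW sx0) //.
    apply: le_trans (hd _ td) _.
    have -> : `|K| / (4 * s ^+ 2) * x ^+ 2 = `|K| * t ^+ 2.
      by rewrite /t; field; rewrite gt_eqF.
    by rewrite ler_wpM2r ?sqr_ge0 // ler_norm.
  rewrite lef_pV2 ?posrE ?exprn_gt0 //.
  by apply: lerXn2r; rewrite ?nnegrE // ltW.
- by rewrite s10 lem // /m le_max lexx.
- by rewrite s20 lem // /m le_max lexx orbT.
Qed.

(** The constant value of the quotient of the moment by [s^k] is [O(s)] as [s]
    tends to 0. *)
Lemma moment_vanish (A r0 : R) : 0 <= A -> 0 < r0 ->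
  (forall w, normc w < r0 -> normc (h w) <= A * normc w ^+ k.+1) ->
  cint beta rho (fun z => h z * conjc (z ^+ k)) = 0.
Proof.
move=> A0 r00 hA; apply/eqP; rewrite -nm_eq0 eq_le nm_ge0 andbT.
have -> : cint beta rho (fun z => h z * conjc (z ^+ k)) = moment 1%:C / 1%:C ^+ k.
  rewrite expr1n divr1; apply: eq_cint => z _.
  by rewrite /integrand mul1r.
pose K := 2 * A * mass beta + 1.
have K0 : 0 < K by rewrite ltr_wpDl // !mulr_ge0 // mass_ge0.
apply/ler_addgt0Pr => e e0; rewrite add0r.
pose s := Num.min (Num.min (r0 / 2) (1 / 2)) (e / K).
have s0 : 0 < s by rewrite !lt_min !divr_gt0.
have sr : s <= r0 / 2 by rewrite /s !ge_min lexx.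
have s1 : s <= 1 / 2 by rewrite /s !ge_min lexx orbT.
have se : s <= e / K by rewrite /s ge_min lexx orbT.
have srho : s * rho < 1.
  apply: (@le_lt_trans _ _ (s * 1)); first by rewrite ler_wpM2l // ltW.
  by lra.
have r1' : 1 * rho < 1 by rewrite mul1r; case/andP: rho01.
rewrite (moment_constant ltr01 s0 r1' srho) nmM nmV nmX nm_real gtr0_norm //.
rewrite ler_pdivrMr ?exprn_gt0 //.
have As0 : 0 <= A * s ^+ k.+1 by rewrite mulr_ge0 // exprn_ge0 // ltW.
have ssrho : normc (s%:C : C) * rho < 1 by rewrite nm_real gtr0_norm.
have := cint_le hbeta rho1 (integrand_integrable ssrho) As0.
have b z : normc z < rho -> normc (integrand s%:C z) <= A * s ^+ k.+1.
  move=> zr; rewrite nmM -[leRHS]mulr1; apply: ler_pM; rewrite ?nm_ge0 ?zk_le1 //.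
  have z1 : normc z <= 1 by rewrite ltW // (lt_le_trans zr).
  have sz : normc (s%:C * z) <= s.
    by rewrite nmM nm_real gtr0_norm // -[leRHS]mulr1 ler_wpM2l // ltW.
  apply: le_trans (hA _ _) _; first by apply: (le_lt_trans sz); lra.
  by rewrite ler_wpM2l // lerXn2r // ?nnegrE ?nm_ge0 // ltW.
move=> /(_ b) h1; apply: (le_trans h1).
have -> : 2 * (A * s ^+ k.+1) * mass beta = (2 * A * mass beta) * s * s ^+ k.
  by rewrite exprS; ring.
apply: ler_wpM2r; first by rewrite exprn_ge0 // ltW.
apply: (@le_trans _ _ (K * s)); first by rewrite ler_wpM2r ?(ltW s0) // /K lerDl.
by rewrite mulrC -ler_pdivlMr.
Qed.

End Moment.

Definition gamma k : C := bergman_inner beta (fun z => z ^+ k) (fun z => z ^+ k).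

Lemma inner_monomial_vanish h k a : bergman beta h -> pexp h 0 a ->
  (forall i, (i <= k)%N -> a i = 0) ->
  bergman_inner beta h (fun z => z ^+ k) = 0.
Proof.
move=> hh ha a0; have [ah _] := hh.
have [|A [r [A0 r0 hA]]] := pexp_bigO (k := k.+1) ha; first by move=> i; exact: a0.
apply: (cint_exhaustion (F := fun z => h z * conjc (z ^+ k))).
  exact: (inner_integrable hbeta hh (bergman_monomial hbeta k)).
move=> rho hrho; apply: (moment_vanish ah hrho A0 r0) => w wr.
by have := hA w wr; rewrite add0r.
Qed.

Lemma inner_monomial_orthogonal j k : j != k ->
  bergman_inner beta (fun z => z ^+ j) (fun z => z ^+ k) = 0.
Proof.
move=> jk; have mj := bergman_monomial hbeta j; have mk := bergman_monomial hbeta k.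
have gt (i l : nat) : (l < i)%N ->
    bergman_inner beta (fun z => z ^+ i) (fun z => z ^+ l) = 0.
  move=> li; apply: (inner_monomial_vanish (bergman_monomial hbeta i) (pexp_monomial0 R i)).
  by move=> m ml; rewrite ltn_eqF // (leq_ltn_trans ml).
case: (ltngtP j k) jk => // [jk|kj] _; last exact: gt.
by rewrite (inner_conj hbeta mk mj) gt // conjc0.
Qed.

(** A function whose Taylor coefficients up to degree [k] vanish is orthogonal to
    [z^k] by [moment_vanish]. Subtracting the Taylor polynomial of degree [k] of [h]
    reduces to this case; by orthogonality of the monomials only the
    [k]-th coefficient contributes. *)
Theorem inner_monomial h k a : bergman beta h -> pexp h 0 a ->
  bergman_inner beta h (fun z => z ^+ k) = a k * gamma k.
Proof.
have mk := bergman_monomial hbeta k.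
suff H m : (m <= k.+1)%N -> forall h a, bergman beta h -> pexp h 0 a ->
    (forall i, (i < k.+1 - m)%N -> a i = 0) ->
    bergman_inner beta h (fun z => z ^+ k) = a k * gamma k.
  by move=> hh ha; apply: (H k.+1) => // i; rewrite subnn.
elim: m => [_ {}h {}a hh ha a0|m IH mk1 {}h {}a hh ha a0].
  rewrite subn0 in a0; rewrite (inner_monomial_vanish hh ha) => [|i ik].
    by rewrite a0 // mul0r.
  by rewrite a0.
pose j := (k - m)%N.
have mj := bergman_monomial hbeta j.
have mjZ := bergmanZ hbeta (a j) mj.
have hE := innerB hbeta hh mjZ mk.
have hp := pexpB ha (pexpZ (a j) (pexp_monomial0 R j)).
have := IH (ltnW mk1) _ _ (bergmanB hbeta hh mjZ) hp.
rewrite hE (innerZ hbeta _ mj mk) => IH'.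
have {}IH' := IH' _; have cond : forall i, (i < k.+1 - m)%N ->
    a i - a j * (i == j)%:R = 0.
  move=> i ik; have [->|ij] := eqVneq i j; first by rewrite mulr1 subrr.
  rewrite mulr0 subr0; apply: a0; rewrite subSS ltn_neqAle ij -ltnS.
  by rewrite /j -subSn // -ltnS.
have {}IH' := IH' cond.
have [jk|jk] := eqVneq j k.
  move: IH'; rewrite jk eqxx mulr1 subrr mul0r -/(gamma k) => /eqP.
  by rewrite subr_eq0 => /eqP.
move: IH'; rewrite (inner_monomial_orthogonal jk) mulr0 subr0.
by rewrite eq_sym (negbTE jk) mulr0 subr0.
Qed.

End Coefficients.

Section Completeness.
Variable R : realType.
Local Notation plane := (measurableTypeR R * measurableTypeR R)%type.
Local Notation leb := (@lebesgue_measure R).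
Local Notation area := (leb \x leb)%E.
Local Notation C := (Cplx R).

Lemma box_open_area_gt0 (U : set plane) (p : plane) : box_open U -> U p ->
  (0 < area U)%E.
Proof.
move=> hU /hU [e [e0 he]].
have e20 : 0 < e / 2 by rewrite divr_gt0.
pose I (x : R) : set (measurableTypeR R) := `[x, x + e / 2]%classic.
have mI x : measurable (I x) by exact: measurable_itv.
have LI x : leb (I x) = (e / 2)%:E.
  rewrite lebesgue_measure_itv /= lte_fin ltrDl e20 -EFinB; congr (_%:E).
  by ring.
have sub : I p.1 `*` I p.2 `<=` U.
  have small (x y : R) : x <= y <= x + e / 2 -> `|y - x| < e.
    by move=> /andP[h1 h2]; rewrite ger0_norm ?subr_ge0 //; lra.
  by move=> q [] /=; rewrite /I /= !in_itv /= => /small h1 /small h2; exact: he.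
apply: (@lt_le_trans _ _ (area (I p.1 `*` I p.2))).
  have -> : area (I p.1 `*` I p.2) = (leb (I p.1) * leb (I p.2))%E.
    exact: product_measure1E.
  by rewrite !LI -EFinM lte_fin mulr_gt0.
apply: le_measure => //; rewrite inE; first exact: measurableX.
exact: box_open_measurable.
Qed.

Variable beta : R.
Hypothesis hbeta : -1 < beta.

Lemma density_gt0 (z : C) : disk z ->
  0 < bergman_density beta (complex.Re z, complex.Im z).
Proof.
move=> hz; rewrite mulr_gt0 //.
  by rewrite divr_gt0 ?pi_gt0 // -ltrBlDr sub0r.
apply: powR_gt0; rewrite subr_gt0 expr_lt1 ?nm_ge0 //.
by case: z hz.
Qed.

(** A continuous function that vanishes almost everywhere vanishes, since a non-empty
    open set has positive area. *)
Lemma inner_positive_definite (h : C -> C) : bergman beta h ->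
  bergman_inner beta h h = 0 -> forall z, disk z -> h z = 0.
Proof.
move=> hh h0 z hz; apply/eqP; apply: contraT => hz0; exfalso.
have [ah _] := hh.
have ih := bergman_integrable hbeta hh.
have rint0 : rint beta 1 (fun p => normc (h (p.1 +i* p.2)) ^+ 2) = 0.
  have := congr1 (@complex.Re R) h0; rewrite bergman_innerE /= => <-.
  by apply: eq_rint => p _; rewrite /re_on mulJ_nm.
pose U : set plane := [set p : plane | disk (p.1 +i* p.2 : C) /\ h (p.1 +i* p.2) != 0].
have oU : box_open U.
  move=> p [dp hp].
  have hp0 : 0 < normc (h (p.1 +i* p.2)) by rewrite nm_gt0.
  have [r [r0 hr]] := analytic_continuous ah dp hp0.
  have [r' [r'0 hr']] := disk_nbhs dp.
  exists (Num.min r r' / 2); rewrite divr_gt0 ?lt_min ?r0 //; split => // q h1 h2.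
  have := complex_diff_small h1 h2; rewrite lt_min => /andP[d1 d2].
  split; rewrite (complex_diff p); first exact: hr'.
  have := hr _ d1; rewrite -nm_gt0; set x := h _; set y := h _ => hxy.
  have : normc y <= normc (x - y) + normc x.
    by have := nmB x (x - y); rewrite opprB addrC subrK addrC.
  by lra.
have Uz : U (complex.Re z, complex.Im z).
  by rewrite /U /mkset /=; have -> : complex.Re z +i* complex.Im z = z by case: (z).
have := box_open_area_gt0 oU Uz; apply/negP; rewrite -leNgt.
have iabs : (\int[area]_(p in cdisk 1)
    `|(normc (h (p.1 +i* p.2)) ^+ 2 * bergman_density beta p)%:E| = 0)%E.
  have fin : (\int[area]_(p in cdisk 1)
    (normc (h (p.1 +i* p.2)) ^+ 2 * bergman_density beta p)%:E)%E \is a fin_num.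
    by apply: integrable_fin_num ih; exact: cdisk_measurable.
  transitivity (\int[area]_(p in cdisk 1)
    (normc (h (p.1 +i* p.2)) ^+ 2 * bergman_density beta p)%:E)%E.
    apply: eq_integral => p _; rewrite gee0_abs // lee_fin mulr_ge0 ?density_ge0 //.
    by rewrite exprn_ge0 ?nm_ge0.
  by rewrite -(fineK fin); congr (_%:E).
have mf : measurable_fun (cdisk 1) (fun p : plane =>
    (normc (h (p.1 +i* p.2)) ^+ 2 * bergman_density beta p)%:E).
  by case/integrableP: ih.
have /(ae_eq_integral_abs area (cdisk_measurable 1) mf) := iabs.
move=> [N [mN N0 hN]].
rewrite -N0; apply: le_measure; rewrite ?inE //; first exact: box_open_measurable.
move=> p [dp hp]; apply: hN => /= /(_ dp) /eqP.
rewrite eqe mulf_eq0 sqrf_eq0 nm_eq0 (negbTE hp) /=.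
by have := density_gt0 dp; rewrite /= => /gt_eqF; case: p {dp hp} => x y /= ->.
Qed.

Lemma gamma_neq0 k : gamma beta k != 0.
Proof.
apply/eqP => g0; have hd : disk ((1 / 2)%:C : C).
  by rewrite /disk /mkset nm_real gtr0_norm //; lra.
have /eqP := inner_positive_definite (bergman_monomial hbeta k) g0 hd.
by rewrite expf_eq0 -nm_eq0 nm_real gtr0_norm // gt_eqF ?andbF.
Qed.

Lemma pexp_coef_eq0 h k a : bergman beta h -> pexp h 0 a ->
  bergman_inner beta h (fun z => z ^+ k) = 0 <-> a k = 0.
Proof.
move=> hh ha; rewrite (inner_monomial hbeta k hh ha); split => [/eqP|->].
  by rewrite mulf_eq0 (negbTE (gamma_neq0 k)) orbF => /eqP.
by rewrite mul0r.
Qed.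

Lemma disk0 : disk (0 : C).
Proof. by rewrite /disk /mkset nm0 ltr01. Qed.

Lemma pexp_zero_fun (f : C -> C) a : (forall k, a k = 0) -> pexp f 0 a ->
  pexp f 0 (fun=> 0).
Proof. by move=> a0; have -> : a = (fun=> 0) by apply/funext. Qed.

(** Orthogonality to all monomials kills all Taylor coefficients at 0, and the
    identity theorem propagates this to the whole disk. *)
Theorem monomial_complete (h : C -> C) : bergman beta h ->
  (forall k, bergman_inner beta h (fun z => z ^+ k) = 0) ->
  forall z, disk z -> h z = 0.
Proof.
move=> hh h0; have [ah _] := hh.
have [a ha] := (analytic_pexp h).1 ah 0 disk0.
apply: analytic_identity => //; apply: (pexp_zero_fun _ ha) => k.
exact/(pexp_coef_eq0 k hh ha).
Qed.

Lemma eq_of_inner_monomials (f g : C -> C) : bergman beta f -> bergman beta g ->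
  (forall k, bergman_inner beta f (fun z => z ^+ k) =
             bergman_inner beta g (fun z => z ^+ k)) -> eq_on_disk f g.
Proof.
move=> hf hg E z hz; apply/eqP; rewrite -subr_eq0; apply/eqP.
apply: (monomial_complete (bergmanB hbeta hf hg)) => // k.
by rewrite (innerB hbeta hf hg (bergman_monomial hbeta k)) E subrr.
Qed.

End Completeness.

(** * Powers of [1 - alpha z] *)

Section PrincipalPower.
Variable R : realType.
Local Notation C := (Cplx R).
Implicit Types (z w : C) (s t : R).

(** In the right half-plane the principal argument is an arctangent, whose
    derivative is rational. *)
Lemma carg_atan w : 0 < complex.Re w ->
  carg w = atan (complex.Im w / complex.Re w).
Proof.
case: w => x y /= x0; rewrite /carg /=.
have r0 : 0 < Num.sqrt (x ^+ 2 + y ^+ 2).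
  by rewrite sqrtr_gt0 ltr_wpDr ?sqr_ge0 // exprn_gt0.
have ct : cos (atan (y / x)) = x / Num.sqrt (x ^+ 2 + y ^+ 2).
  have -> : x ^+ 2 + y ^+ 2 = x ^+ 2 * (1 + (y / x) ^+ 2).
    by field; rewrite gt_eqF.
  rewrite sqrtrM ?sqr_ge0 // sqrtr_sqr gtr0_norm // cos_atan invfM mulrA.
  by rewrite divff ?mul1r // gt_eqF.
have p0 : 0 < pi :> R by exact: pi_gt0.
have h1 := atan_gtNpi2 (y / x); have h2 := atan_ltpi2 (y / x).
case: ifPn => [y0|]; rewrite -?ct.
  have a0 : 0 <= atan (y / x) by rewrite -atan0 le_atan // divr_ge0 // ltW.
  by rewrite cosK // in_itv /= a0; lra.
rewrite -ltNge => y0.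
have a0 : atan (y / x) <= 0.
  by rewrite -(atan0 R) le_atan // ltW // pmulr_llt0 ?invr_gt0.
by rewrite cosKN ?opprK // a0 andbT; lra.
Qed.

(** Polar form of the principal power in the right half-plane, by functions
    whose derivatives are elementary. *)
Definition hpow w s : C :=
  let m := expR (s / 2 * ln (complex.Re w ^+ 2 + complex.Im w ^+ 2)) in
  let t := s * atan (complex.Im w / complex.Re w) in
  (m * cos t) +i* (m * sin t).

Lemma cpow_hpow w s : 0 < complex.Re w -> cpow w s = hpow w s.
Proof.
move=> w0; rewrite /cpow /hpow carg_atan //.
have u0 : 0 < complex.Re w ^+ 2 + complex.Im w ^+ 2.
  by rewrite ltr_wpDr ?sqr_ge0 // exprn_gt0.
suff -> : normc w `^ s = expR (s / 2 * ln (complex.Re w ^+ 2 + complex.Im w ^+ 2)).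
  by [].
have n0 : 0 < normc w by rewrite -(@ltr_pXn2r _ 2) ?nnegrE ?nm_ge0 // expr0n nm_sqr.
rewrite /powR gt_eqF // -nm_sqr; congr expR.
by rewrite lnXn // -mulr_natr; field.
Qed.

Lemma hpow_conj w s : hpow (conjc w) s = conjc (hpow w s).
Proof.
case: w => x y; rewrite /hpow /= sqrrN mulNr atanN mulrN cosN sinN mulrN.
by [].
Qed.

Lemma nm_hpow w s :
  normc (hpow w s) = expR (s / 2 * ln (complex.Re w ^+ 2 + complex.Im w ^+ 2)).
Proof.
rewrite /hpow /= !exprMn -mulrDr cos2Dsin2 mulr1 sqrtr_sqr ger0_norm //.
Qed.

Lemma hpow_neq0 w s : hpow w s != 0.
Proof. by rewrite -nm_gt0 nm_hpow expR_gt0. Qed.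

Definition rderive (f : R -> C) t (v : C) :=
  is_derive t 1 (fun x => complex.Re (f x)) (complex.Re v) /\
  is_derive t 1 (fun x => complex.Im (f x)) (complex.Im v).

Lemma rderiveM (f g : R -> C) t (v w : C) : rderive f t v -> rderive g t w ->
  rderive (fun x => f x * g x) t (f t * w + v * g t).
Proof.
move=> [f1 f2] [g1 g2]; split.
  have := is_deriveB (is_deriveM f1 g1) (is_deriveM f2 g2).
  set D := (X in is_derive _ _ _ X -> _) => h.
  have -> : (fun x => complex.Re (f x * g x)) =
    (fun x => complex.Re (f x)) * (fun x => complex.Re (g x)) -
    (fun x => complex.Im (f x)) * (fun x => complex.Im (g x)) :> (R -> R).
    by apply/funext => x; rewrite re_mul.
  by apply: is_derive_eq h _; rewrite /D re_add !re_mul /GRing.scale /=; ring.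
have := is_deriveD (is_deriveM f1 g2) (is_deriveM f2 g1).
set D := (X in is_derive _ _ _ X -> _) => h.
have -> : (fun x => complex.Im (f x * g x)) =
  (fun x => complex.Re (f x)) * (fun x => complex.Im (g x)) +
  (fun x => complex.Im (f x)) * (fun x => complex.Re (g x)) :> (R -> R).
  by apply/funext => x; rewrite im_mul.
by apply: is_derive_eq h _; rewrite /D im_add !im_mul /GRing.scale /=; ring.
Qed.

Lemma rderive0_constant (f : R -> C) (a b : R) :
  (forall t, a < t < b -> rderive f t 0) ->
  forall x y, a < x < b -> a < y < b -> f x = f y.
Proof.
move=> h x y hx hy; apply: eq_ReIm.
  by apply: (@derive0_constant R (fun t => complex.Re (f t)) a b) => // t /h[].
by apply: (@derive0_constant R (fun t => complex.Im (f t)) a b) => // t /h[].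
Qed.

Lemma rderive_quadratic (f : R -> C) t (v : C) (K d : R) : 0 < d ->
  (forall x, `|x| < d -> normc (f (t + x) - f t - x%:C * v) <= K * x ^+ 2) ->
  rderive f t v.
Proof.
move=> d0 h; split; apply: (is_derive_quadratic (K := K) d0) => x /h.
  apply: le_trans; apply: le_trans (Re_le_nm _).
  by rewrite !re_add !re_opp re_mul /= mul0r subr0.
apply: le_trans; apply: le_trans (Im_le_nm _).
by rewrite !im_add !im_opp im_mul /= mul0r addr0.
Qed.

(** Half the derivative of [ln |w|^2] and the derivative of the argument are the real
    and imaginary parts of [w' / w]. *)
Lemma hpow_rderive (w0 d : C) s t : 0 < complex.Re (w0 + t%:C * d) ->
  rderive (fun x => hpow (w0 + x%:C * d) s) t
    (s%:C * d / (w0 + t%:C * d) * hpow (w0 + t%:C * d) s).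
Proof.
pose X x := complex.Re w0 + x * complex.Re d.
pose Y x := complex.Im w0 + x * complex.Im d.
have XE x : complex.Re (w0 + x%:C * d) = X x.
  by rewrite re_add re_mul /= mul0r subr0.
have YE x : complex.Im (w0 + x%:C * d) = Y x.
  by rewrite im_add im_mul /= mul0r addr0.
rewrite XE => X0.
have dX : is_derive t 1 X (complex.Re d).
  apply: (is_derive_quadratic (K := 0) ltr01) => x _.
  by rewrite /X mul0r (_ : _ - _ = 0) ?normr0 //; ring.
have dY : is_derive t 1 Y (complex.Im d).
  apply: (is_derive_quadratic (K := 0) ltr01) => x _.
  by rewrite /Y mul0r (_ : _ - _ = 0) ?normr0 //; ring.
pose U x := X x ^+ 2 + Y x ^+ 2.
have U0 : 0 < U t by rewrite ltr_wpDr ?sqr_ge0 // exprn_gt0.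
have dU : is_derive t 1 U (2 * (X t * complex.Re d + Y t * complex.Im d)).
  apply: (is_derive_quadratic (K := complex.Re d ^+ 2 + complex.Im d ^+ 2) ltr01) => x _.
  rewrite /U /X /Y (_ : _ - _ = (complex.Re d ^+ 2 + complex.Im d ^+ 2) * x ^+ 2).
    by rewrite ger0_norm // mulr_ge0 ?sqr_ge0 // addr_ge0 ?sqr_ge0.
  by ring.
have dL : is_derive t 1 (fun x => ln (U x))
    ((U t)^-1 * (2 * (X t * complex.Re d + Y t * complex.Im d))).
  exact: (is_derive1_comp (is_derive1_ln U0) dU).
have dM : is_derive t 1 (fun x => expR (s / 2 * ln (U x)))
    (expR (s / 2 * ln (U t)) * (s * (X t * complex.Re d + Y t * complex.Im d) / U t)).
  apply: is_derive_eq (is_derive1_comp (is_derive_expR _) (is_deriveZ (s / 2) dL)) _.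
  rewrite /GRing.scale /=; congr (_ * _); field; by rewrite gt_eqF.
have dV : is_derive t 1 (fun x => Y x / X x)
   ((complex.Im d * X t - Y t * complex.Re d) / X t ^+ 2).
  have dI := is_deriveV (lt0r_neq0 X0) dX.
  apply: is_derive_eq (is_deriveM dY dI) _.
  by rewrite /GRing.scale /=; field; rewrite gt_eqF.
have dA : is_derive t 1 (fun x => s * atan (Y x / X x))
   (s * ((complex.Im d * X t - Y t * complex.Re d) / U t)).
  apply: is_derive_eq (is_deriveZ s (is_derive1_comp (is_derive1_atan _) dV)) _.
  rewrite /GRing.scale /=; congr (_ * _); rewrite /U; field.
  by rewrite !gt_eqF.
have dC := is_derive1_comp (is_derive_cos _) dA.
have dS := is_derive1_comp (is_derive_sin _) dA.
set m := expR _ in dM.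
set th := s * atan (Y t / X t) in dC dS.
have wE : w0 + t%:C * d = (X t +i* Y t) by apply: eq_ReIm; rewrite ?XE ?YE.
have qE : d / (w0 + t%:C * d) = ((X t * complex.Re d + Y t * complex.Im d) / U t)
    +i* ((complex.Im d * X t - Y t * complex.Re d) / U t).
  have w0n : w0 + t%:C * d != 0.
    by apply/eqP => E; move: X0; rewrite -XE E /= ltxx.
  apply: (mulIf w0n); rewrite mulfVK // wE.
  apply: eq_ReIm; rewrite ?re_mul ?im_mul /=; rewrite /U; field; by rewrite gt_eqF.
have hE : hpow (w0 + t%:C * d) s = (m * cos th) +i* (m * sin th).
  by rewrite /hpow XE YE.
rewrite -[s%:C * d / _]mulrA qE hE.
split.
  have -> : (fun x => complex.Re (hpow (w0 + x%:C * d) s)) = fun x =>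
     expR (s / 2 * ln (U x)) * cos (s * atan (Y x / X x)).
    by apply/funext => x; rewrite /hpow XE YE.
  apply: is_derive_eq (is_deriveM dM dC) _.
  by rewrite /GRing.scale /= -/th -/m; ring.
have -> : (fun x => complex.Im (hpow (w0 + x%:C * d) s)) = fun x =>
   expR (s / 2 * ln (U x)) * sin (s * atan (Y x / X x)).
  by apply/funext => x; rewrite /hpow XE YE.
apply: is_derive_eq (is_deriveM dM dS) _.
by rewrite /GRing.scale /= -/th -/m; ring.
Qed.

End PrincipalPower.

Section BinomialSeries.
Variable R : realType.
Local Notation C := (Cplx R).
Implicit Types (z w x y d : C) (t : R).
Variable s : R.
Hypothesis s1 : 1 <= s.

(** The coefficients of [(1 - y)^-s]. *)
Fixpoint bincoef (k : nat) : R :=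
  if k is j.+1 then bincoef j * (s + j%:R) / j.+1%:R else 1.

Let s0 : 0 < s. Proof. exact: lt_le_trans ltr01 s1. Qed.

Lemma bincoef_gt0 k : 0 < bincoef k.
Proof.
elim: k => [|k IH] //=; rewrite divr_gt0 // mulr_gt0 // ltr_wpDr //.
Qed.

Lemma bincoef_le k : bincoef k <= s ^+ k.
Proof.
elim: k => [|k IH] //=; rewrite exprSr -mulrA; apply: ler_pM => //.
- exact/ltW/bincoef_gt0.
- by rewrite divr_ge0 // addr_ge0 // ltW.
- rewrite ler_pdivrMr // -natr1 mulrDr mulr1 addrC lerD2r.
  by rewrite ler_peMl.
Qed.

Definition cbin k : C := (bincoef k)%:C.

Lemma cbin_bound : coef_bound cbin 1 s^-1.
Proof.
move=> k; rewrite nm_real ger0_norm ?(ltW (bincoef_gt0 k)) // exprVn.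
by rewrite ler_pdivrMr ?exprn_gt0 // mul1r bincoef_le.
Qed.

Lemma cbin_diff k : diff_coef cbin k = s%:C * cbin k + k%:R * cbin k.
Proof.
rewrite /diff_coef /cbin /= -!(rmorph_nat (real_complex R)) -!rmorphM -rmorphD.
by congr (_%:C); field.
Qed.

(** The recursion of the coefficients is the differential equation of [(1 - y)^-s]. *)
Lemma cbin_ode y S D : psum cbin y S -> psum (diff_coef cbin) y D ->
  (1 - y) * D = s%:C * S.
Proof.
move=> hS hD.
have h1 : csum (fun k => k%:R * cbin k * y ^+ k) (y * D).
  have := @csum_recl R (fun k => k%:R * cbin k * y ^+ k) (y * D).
  rewrite !mul0r add0r; apply.
  apply: eq_csum (csumZ (a := y) hD) => k.
  by rewrite /diff_coef exprS; ring.
have h2 := csumD (csumZ (a := s%:C) hS) h1.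
have h3 : csum (fun k => diff_coef cbin k * y ^+ k) (s%:C * S + y * D).
  by apply: eq_csum h2 => k; rewrite cbin_diff; ring.
by have E := csum_uniq hD h3; rewrite mulrBl mul1r {1}E addrK.
Qed.

Definition binsum y : C := limn (series (fun k => cbin k * y ^+ k)).

Lemma psum_binsum y : normc y < s^-1 -> psum cbin y (binsum y).
Proof.
move=> ys; have s'0 : 0 < s^-1 by rewrite invr_gt0.
have [S hS] := psum_ex s'0 cbin_bound ys.
by rewrite /binsum (cvg_lim _ hS).
Qed.

Lemma binsum_rderive x t : normc x <= s^-1 / 16 -> -1 < t < 2 ->
  exists D, psum (diff_coef cbin) (t%:C * x) D /\
    rderive (fun t => binsum (t%:C * x)) t (x * D).
Proof.
move=> xs /andP[t1 t2]; have s'0 : 0 < s^-1 by rewrite invr_gt0.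
have nt : `|t| <= 2 by rewrite ler_norml; apply/andP; split; lra.
have tx : normc (t%:C * x) <= s^-1 / 8.
  have -> : s^-1 / 8 = 2 * (s^-1 / 16) by field; rewrite gt_eqF.
  by rewrite nmM nm_real; apply: ler_pM => //; exact: nm_ge0.
have small c : normc (t%:C * x + c) <= s^-1 / 4 -> normc (t%:C * x + c) < s^-1.
  by move/le_lt_trans; apply; lra.
have s'20 : 0 < s^-1 / 2 by rewrite divr_gt0.
have [D hD] : exists D, psum (diff_coef cbin) (t%:C * x) D.
  by apply: (psum_ex s'20 (coef_bound_diff s'0 cbin_bound)); lra.
exists D; split => //.
apply: (rderive_quadratic (K := 32 * 1 / s^-1 ^+ 2 * normc x ^+ 2) ltr01) => u u1.
have ux : normc (u%:C * x) <= s^-1 / 16.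
  rewrite nmM nm_real -[leRHS]mul1r; apply: ler_pM => //; first exact: nm_ge0.
  exact: ltW.
have tux : normc (t%:C * x + u%:C * x) <= s^-1 / 4.
  by apply: le_trans (nmD _ _) _; lra.
have tx4 : normc (t%:C * x) <= s^-1 / 4 by lra.
have h1 : psum cbin (t%:C * x) (binsum (t%:C * x)) by apply: psum_binsum; lra.
have h2 : psum cbin (t%:C * x + u%:C * x) (binsum ((t + u)%:C * x)).
  by rewrite rmorphD mulrDl; apply: psum_binsum; exact: small.
have := psum_increment_error s'0 cbin_bound tx4 tux h1 h2 hD.
have -> : u%:C * x * D = u%:C * (x * D) by rewrite mulrA.
have -> : 32 * 1 / s^-1 ^+ 2 * normc (u%:C * x) ^+ 2 =
    32 * 1 / s^-1 ^+ 2 * normc x ^+ 2 * u ^+ 2.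
  by rewrite nmM nm_real exprMn real_normK ?num_real //; ring.
exact.
Qed.

(** Along the segment from [w0] to [w0 + d], the product of the binomial series with
    the power of the moving point has zero derivative. The open interval from -1 to 2
    leaves room around the endpoints 0 and 1, and the factor 16 keeps the argument of
    the series, up to twice as far and with its increments, in the disk where
    [psum_increment_error] applies. *)
Lemma hpow_binomial (w0 d : C) : w0 != 0 -> normc (d / w0) <= s^-1 / 16 ->
  (forall t, -1 < t < 2 -> 0 < complex.Re (w0 + t%:C * d)) ->
  psum cbin (- d / w0) (hpow w0 s / hpow (w0 + d) s).
Proof.
move=> w00 dw hRe; pose x := - d / w0.
have xs : normc x <= s^-1 / 16 by rewrite /x mulNr nmN.
have s'0 : 0 < s^-1 by rewrite invr_gt0.
pose P t := binsum (t%:C * x) * hpow (w0 + t%:C * d) s.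
have dP t : -1 < t < 2 -> rderive P t 0.
  move=> ht; have [D [hD dB]] := binsum_rderive xs ht.
  have Re0 := hRe t ht.
  have wt0 : w0 + t%:C * d != 0.
    by apply/eqP => E; move: Re0; rewrite E /= ltxx.
  have := rderiveM dB (hpow_rderive s Re0).
  suff -> : binsum (t%:C * x) * (s%:C * d / (w0 + t%:C * d) * hpow (w0 + t%:C * d) s)
     + x * D * hpow (w0 + t%:C * d) s = 0 by [].
  have tx : normc (t%:C * x) < s^-1.
    have /andP[t1 t2] := ht.
    have nt : `|t| <= 2 by rewrite ler_norml; apply/andP; split; lra.
    apply: (@le_lt_trans _ _ (2 * (s^-1 / 16))); last by lra.
    by rewrite nmM nm_real; apply: ler_pM => //; exact: nm_ge0.
  have ode := cbin_ode (psum_binsum tx) hD.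
  have wE : w0 + t%:C * d = w0 * (1 - t%:C * x).
    by rewrite /x; field.
  have tx0 : 1 - t%:C * x != 0.
    by apply/eqP => E; move: wt0; rewrite wE E mulr0 eqxx.
  have DE : D = s%:C * binsum (t%:C * x) / (1 - t%:C * x).
    by rewrite -ode mulrAC divff ?mul1r.
  have dE : d = - w0 * x by rewrite /x; field.
  have gen (S a W X Y Q : C) : W != 0 -> Y != 0 ->
     S * (a * (- W * X) / (W * Y) * Q) + X * (a * S / Y) * Q = 0.
    by move=> W0 Y0; field; rewrite W0 Y0.
  by rewrite DE wE {1}dE; exact: gen.
have c01 : P 1 = P 0.
  by apply: (rderive0_constant dP); apply/andP; split; lra.
have b0 : binsum 0 = 1.
  have := psum_at0 (psum_binsum (y := 0) _); rewrite nm0 => /(_ s'0) ->.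
  by rewrite /cbin /= rmorph1.
have x1 : normc x < s^-1 by lra.
have := psum_binsum x1; suff -> : binsum x = hpow w0 s / hpow (w0 + d) s by [].
move: c01; rewrite /P rmorph1 rmorph0 !mul1r !mul0r addr0 b0 mul1r => <-.
by rewrite mulfK // hpow_neq0.
Qed.

End BinomialSeries.

Section Kernel.
Variable R : realType.
Local Notation C := (Cplx R).
Implicit Types (z w x y d : C) (t : R).

Lemma Re_one_sub (x : C) : normc x < 1 -> 0 < complex.Re (1 - x).
Proof.
move=> x1; rewrite re_add re_opp /= subr_gt0.
by apply: le_lt_trans x1; apply: le_trans (Re_le_nm _); exact: ler_norm.
Qed.

Lemma disk_mul (x y : C) : disk x -> disk y -> disk (x * y).
Proof.
rewrite /disk /mkset nmM => x1 y1; apply: le_lt_trans y1.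
by rewrite ler_piMl ?nm_ge0 // ltW.
Qed.

(** Around [z0], factor [1 - alpha z] as [w0 (1 - alpha (z - z0) / w0)] with
    [w0 = 1 - alpha z0]. *)
Lemma kernel_pexp (s : R) (alpha z0 : C) : 1 <= s -> disk alpha -> disk z0 ->
  pexp (fun z => (hpow (1 - alpha * z) s)^-1) z0
    (fun k => (hpow (1 - alpha * z0) s)^-1 *
              (cbin s k * (alpha / (1 - alpha * z0)) ^+ k)).
Proof.
move=> s1 ha hz; pose w0 := 1 - alpha * z0.
have s0 : 0 < s by exact: lt_le_trans s1.
have w0Re : 0 < complex.Re w0 by apply: Re_one_sub; exact: disk_mul.
have w00 : w0 != 0 by apply/eqP => E; move: w0Re; rewrite E /= ltxx.
have nw0 : 0 < normc w0 by rewrite nm_gt0.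
exists (Num.min (normc w0 * (s^-1 / 16)) ((1 - normc z0) / 2)).
rewrite lt_min mulr_gt0 ?divr_gt0 ?invr_gt0 ?subr_gt0 //; split; first by [].
move=> w; rewrite lt_min => /andP[w1 w2].
have hb := @hpow_binomial R s s1 w0 (- (alpha * w)) w00.
have aw : normc (alpha * w) <= normc w.
  by rewrite nmM ler_piMl ?nm_ge0 // ltW.
have h1 : normc (- (alpha * w) / w0) <= s^-1 / 16.
  rewrite nmM nmN nmV ler_pdivrMr // [leRHS]mulrC.
  by apply: (le_trans aw); exact: ltW.
have h2 t : -1 < t < 2 -> 0 < complex.Re (w0 + t%:C * - (alpha * w)).
  move=> /andP[t1 t2].
  have -> : w0 + t%:C * - (alpha * w) = 1 - alpha * (z0 + t%:C * w).
    by rewrite /w0; ring.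
  apply: Re_one_sub; apply: disk_mul => //.
  rewrite /disk /mkset; apply: le_lt_trans (nmD _ _) _.
  have nt : `|t| <= 2 by rewrite ler_norml; apply/andP; split; lra.
  have : normc (t%:C * w) <= 2 * normc w.
    by rewrite nmM nm_real ler_wpM2r // nm_ge0.
  by lra.
have h3 := csumZ (a := (hpow w0 s)^-1) (hb h1 h2).
have E1 : (hpow w0 s)^-1 * (hpow w0 s / hpow (w0 - alpha * w) s) =
    (hpow (1 - alpha * (z0 + w)) s)^-1.
  have -> : w0 - alpha * w = 1 - alpha * (z0 + w) by rewrite /w0; ring.
  by rewrite mulKf // hpow_neq0.
rewrite E1 in h3; apply: eq_csum h3 => k.
have gen (H b a W v : C) : H * (b * (- - (a * v) / W) ^+ k) =
    H * (b * (a / W) ^+ k) * v ^+ k.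
  by rewrite opprK mulrAC exprMn; ring.
exact: gen.
Qed.

Lemma nm_hpow_ge (s : R) (alpha z : C) : 0 <= s -> disk alpha -> disk z ->
  expR (s / 2 * ln ((1 - normc alpha) ^+ 2)) <= normc (hpow (1 - alpha * z) s).
Proof.
move=> s0 ha hz; have a1 : 0 < 1 - normc alpha by rewrite subr_gt0.
have h : 1 - normc alpha <= normc (1 - alpha * z).
  have : normc 1 <= normc (1 - alpha * z) + normc (alpha * z).
    by rewrite -{1}[1](subrK (alpha * z)) nmD.
  have : normc (alpha * z) <= normc alpha.
    by rewrite nmM ler_piMr ?nm_ge0 // ltW.
  by rewrite nm1; lra.
rewrite nm_hpow ler_expR; apply: ler_wpM2l; first by rewrite divr_ge0.
have h2 : (1 - normc alpha) ^+ 2 <= normc (1 - alpha * z) ^+ 2.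
  by apply: lerXn2r; rewrite ?nnegrE ?nm_ge0 // ltW.
rewrite -nm_sqr ler_ln ?posrE ?exprn_gt0 //.
exact: lt_le_trans h.
Qed.

Variables (beta : R) (kappa alpha : C).
Hypothesis hbeta : -1 < beta.
Hypothesis halpha : disk alpha.

Lemma conj_disk (z : C) : disk z -> disk (conjc z).
Proof. by rewrite /disk /mkset nmJ. Qed.

Lemma beta2_ge1 : 1 <= beta + 2.
Proof. by have := hbeta; lra. Qed.

Lemma conjc_div (a b : C) : conjc (a / b) = conjc a / conjc b.
Proof.
have [->|b0] := eqVneq b 0; first by rewrite conjc0 !invr0 !mulr0 conjc0.
have cb : conjc b != 0 by rewrite -nm_eq0 nmJ nm_eq0.
by apply: (mulIf cb); rewrite mulfVK // -rmorphM mulfVK.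
Qed.

Definition kernel_scale : R := (1 - normc alpha ^+ 2) `^ ((beta + 2) / 2).

Lemma kernel_scale_gt0 : 0 < kernel_scale.
Proof.
by apply: powR_gt0; rewrite subr_gt0 expr_lt1 ?nm_ge0.
Qed.

(** The conjugation maps 1 to a multiple of the kernel function at the conjugate of
    [alpha]. *)
Lemma JW_one z : disk z -> JW beta kappa alpha (fun=> 1) z =
  kernel_scale%:C * (hpow (1 - alpha * z) (beta + 2))^-1.
Proof.
move=> hz; rewrite /JW /conjJ /wcomp /u_alpha mulr1 -/kernel_scale.
have E : 1 - conjc alpha * conjc z = conjc (1 - alpha * z) :> C.
  by rewrite rmorphB rmorph1 rmorphM.
have Re0 : 0 < complex.Re (1 - conjc alpha * conjc z).
  by apply: Re_one_sub; apply: disk_mul; exact: conj_disk.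
by rewrite cpow_hpow // E hpow_conj conjc_div conjcK conjc_real.
Qed.

Lemma kernel_analytic : analytic_on_disk
  (fun z => kernel_scale%:C * (hpow (1 - alpha * z) (beta + 2))^-1).
Proof.
apply/analytic_pexp => z hz; eexists.
exact: (pexpZ _ (kernel_pexp beta2_ge1 halpha hz)).
Qed.

Lemma kernel_bounded : exists B, forall z, disk z ->
  normc (kernel_scale%:C * (hpow (1 - alpha * z) (beta + 2))^-1) <= B.
Proof.
have b0 : 0 <= beta + 2 by apply: le_trans ler01 beta2_ge1.
exists (kernel_scale / expR ((beta + 2) / 2 * ln ((1 - normc alpha) ^+ 2))).
move=> z hz; rewrite nmM nmV nm_real (gtr0_norm kernel_scale_gt0).
apply: ler_wpM2l; first exact: ltW kernel_scale_gt0.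
have h := nm_hpow_ge b0 halpha hz.
by rewrite lef_pV2 ?posrE ?expR_gt0 // (lt_le_trans (expR_gt0 _) h).
Qed.

(** Every coefficient of the expansion at [z] is non-zero. *)
Lemma kernel_derive_neq0 n z : alpha != 0 -> disk z ->
  derive1n n (JW beta kappa alpha (fun=> 1)) z != 0.
Proof.
move=> a0 hz; have [r [r0 hr]] := disk_nbhs hz.
have h := pexpZ (kernel_scale%:C) (kernel_pexp beta2_ge1 halpha hz).
have E w : normc w < r ->
    kernel_scale%:C * (hpow (1 - alpha * (z + w)) (beta + 2))^-1 =
    JW beta kappa alpha (fun=> 1) (z + w).
  by move=> wr; rewrite JW_one //; exact: hr.
have h' := eq_pexp r0 E h.
have w0 : 1 - alpha * z != 0.
  have : 0 < complex.Re (1 - alpha * z) by apply: Re_one_sub; exact: disk_mul.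
  by move=> p; apply/eqP => E0; move: p; rewrite E0 /= ltxx.
have cn0 (y : R) : 0 < y -> (y%:C : C) != 0.
  by move=> y0; rewrite -nm_gt0 nm_real gtr0_norm.
have b0 : (cbin (beta + 2) n : C) != 0 by apply/cn0/bincoef_gt0/beta2_ge1.
rewrite (derive1n_pexp n h'); apply: mulf_neq0.
  by rewrite -nm_eq0 nm_nat pnatr_eq0 -lt0n fact_gt0.
apply: mulf_neq0; first exact/cn0/kernel_scale_gt0.
apply: mulf_neq0; first by rewrite invr_eq0 hpow_neq0.
apply: mulf_neq0; first exact: b0.
by apply: expf_neq0; apply: mulf_neq0; rewrite ?invr_eq0.
Qed.

(** ** The disk automorphism *)

Definition mobius (v : C) : C := (alpha - v) / (1 - conjc alpha * v).

Lemma mobius_den_neq0 v : disk v -> 1 - conjc alpha * v != 0.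
Proof.
move=> hv; apply/eqP => E.
have : 0 < complex.Re (1 - conjc alpha * v).
  by apply: Re_one_sub; apply: disk_mul => //; exact: conj_disk.
by rewrite E /= ltxx.
Qed.

Lemma mobius_disk v : disk v -> disk (mobius v).
Proof.
move=> hv; have d0 := mobius_den_neq0 hv.
rewrite /disk /mkset /mobius nmM nmV ltr_pdivrMr ?nm_gt0 // mul1r.
rewrite -(@ltr_pXn2r _ 2) ?nnegrE ?nm_ge0 // -subr_gt0.
have -> : normc (1 - conjc alpha * v) ^+ 2 - normc (alpha - v) ^+ 2 =
    (1 - normc alpha ^+ 2) * (1 - normc v ^+ 2).
  by rewrite !nm_sqr; case: alpha v {hv d0} => a b [x y] /=; ring.
by rewrite mulr_gt0 // subr_gt0 expr_lt1 ?nm_ge0.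
Qed.

Lemma mobiusK v : disk v -> mobius (mobius v) = v.
Proof.
move=> hv; have d0 := mobius_den_neq0 hv.
have d1 := mobius_den_neq0 (mobius_disk hv).
have aa : 1 - conjc alpha * alpha != 0 by exact: mobius_den_neq0.
have gen (a b x : C) : 1 - b * x != 0 -> 1 - b * a != 0 ->
   1 - b * ((a - x) / (1 - b * x)) != 0 ->
   (a - (a - x) / (1 - b * x)) / (1 - b * ((a - x) / (1 - b * x))) = x.
  move=> h1 h2 h3; apply: (mulIf h3); rewrite mulfVK //.
  by apply: (mulIf h1); rewrite !mulrBr !mulrBl !mulrA; field.
exact: gen.
Qed.

Hypothesis hkappa : normc kappa = 1.

Lemma u_alpha_neq0 v : disk v -> u_alpha beta alpha v != 0.
Proof.
move=> hv; have Re0 : 0 < complex.Re (1 - conjc alpha * v).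
  by apply: Re_one_sub; apply: disk_mul => //; exact: conj_disk.
rewrite /u_alpha cpow_hpow // mulf_neq0 ?invr_eq0 ?hpow_neq0 //.
by rewrite -nm_gt0 nm_real gtr0_norm kernel_scale_gt0.
Qed.

(** [JW] is injective on the values on the disk: its weight has no zeros and its
    symbol is onto. *)
Lemma JW_eq0 (h : C -> C) : (forall z, disk z -> JW beta kappa alpha h z = 0) ->
  forall w, disk w -> h w = 0.
Proof.
move=> h0 w hw; pose w' := w / kappa.
have k0 : kappa != 0 by rewrite -nm_eq0 hkappa oner_eq0.
have hw' : disk w' by rewrite /disk /mkset /w' nmM nmV hkappa invr1 mulr1.
have hv := mobius_disk hw'.
have := h0 _ (conj_disk hv); rewrite /JW /conjJ /wcomp conjcK => /eqP.
rewrite conjc_eq0 mulf_eq0 (negbTE (u_alpha_neq0 hv)) /= => /eqP.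
suff -> : theta_alpha kappa alpha (mobius w') = w by [].
change (kappa * mobius (mobius w') = w).
by rewrite mobiusK // /w' mulrC mulfVK.
Qed.

End Kernel.

(** * The operator *)

Section Operator.
Variable R : realType.
Local Notation C := (Cplx R).
Variables (beta : R) (n : nat) (alpha kappa : C) (theta u : C -> C).
Hypothesis hbeta : -1 < beta.
Hypothesis hn : (1 <= n)%N.
Hypothesis htheta : holomorphic_self_map theta.
Hypothesis hu : analytic_on_disk u.
Local Notation W := (wcomp_diff n u theta).
Local Notation e := (fun k : nat => fun z : C => z ^+ k).
Local Notation inner := (bergman_inner beta).
Implicit Types (f g h : C -> C) (z w : C).

Let bm k : bergman beta (e k). Proof. exact: bergman_monomial. Qed.

Lemma derive1n_monomial j w :
  derive1n n (e j) w = (j ^_ n)%:R * w ^+ (j - n).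
Proof.
rewrite (derive1n_pexp n (pexp_monomial j w)); case: leqP => nj.
  by rewrite -bin_ffact natrM -mulr_natr; ring.
by rewrite ffact_small // mulr0 mul0r.
Qed.

Lemma wcomp_diff_monomial j z : W (e j) z = u z * ((j ^_ n)%:R * theta z ^+ (j - n)).
Proof. by rewrite /wcomp_diff derive1n_monomial. Qed.

Lemma wcomp_diff_eq0 h : (forall z, disk z -> h z = 0) ->
  forall z, disk z -> W h z = 0.
Proof.
move=> h0 z hz; have htz : disk (theta z) by exact: htheta.2.
have [r [r0 hr]] := disk_nbhs htz.
have E w : normc w < r -> 0 = h (theta z + w) by move=> /hr /h0.
have p0 := eq_pexp r0 E (@pexp_cst R 0 (theta z)).
rewrite /wcomp_diff (derive1n_pexp n p0).
by case: (n) => [|m]; rewrite mulr0 mulr0.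
Qed.

Lemma inner_zero_r f g : bergman beta f -> (forall z, disk z -> g z = 0) ->
  inner f g = 0.
Proof.
move=> hf g0; have b0 : bergman beta (fun z => 0 * f z) by exact: bergmanZ.
have E : eq_on_disk g (fun z => 0 * f z) by move=> z hz; rewrite g0 // mul0r.
rewrite (eq_inner beta (fun z _ => erefl : f z = f z) E).
by rewrite (inner_conj hbeta b0 hf) (innerZ hbeta _ hf hf) mul0r conjc0.
Qed.

Lemma analytic_eq_coef f g a : analytic_on_disk f -> analytic_on_disk g ->
  pexp f 0 a -> pexp g 0 a -> eq_on_disk f g.
Proof.
move=> af ag pf pg z hz; apply/eqP; rewrite -subr_eq0; apply/eqP.
have afg : analytic_on_disk (fun z => f z - g z).
  apply/analytic_pexp => w hw.
  have [b hb] := (analytic_pexp f).1 af w hw.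
  have [c hc] := (analytic_pexp g).1 ag w hw.
  by exists (fun k => b k - c k); exact: pexpB.
have p0 : pexp (fun z => f z - g z) 0 (fun=> 0).
  by apply: (pexp_zero_fun _ (pexpB pf pg)) => k; rewrite subrr.
exact: (analytic_identity afg p0 hz).
Qed.

(** ** Normality forces [alpha = 0] *)

Section AlphaZero.
Hypothesis halpha : disk alpha.
Hypothesis hkappa : normc kappa = 1.
Hypothesis hu_neq0 : exists z, disk z /\ u z <> 0.
Hypothesis hbounded : bounded_on_bergman beta W.
Hypothesis hsym : complex_symmetric beta W (JW beta kappa alpha).

(** [W] kills the constants, so by symmetry its adjoint kills the kernel function
    [g = JW 1]; by normality [W g = 0], although no derivative of [g] has a zero
    unless [alpha = 0]. *)
Lemma normal_alpha0 : normal_on_bergman beta W -> alpha = 0.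
Proof.
move=> [Ls' [[mLs' adj'] comm]]; apply/eqP; apply: contraT => a0; exfalso.
have [Ls [[mLs adj] sym]] := hsym.
have [mW _] := hbounded.
pose g := JW beta kappa alpha (fun=> 1).
have bg : bergman beta g.
  have [B hB] := kernel_bounded hbeta halpha.
  have := bergman_bounded hbeta (kernel_analytic hbeta halpha) hB.
  by apply: (eq_bergman hbeta) => z hz; rewrite /g JW_one.
have W1 z : disk z -> W (fun=> 1) z = 0.
  move=> _; have := wcomp_diff_monomial 0 z.
  by rewrite ffact_small // mul0r mulr0.
have Lsg : forall z, disk z -> Ls g z = 0.
  move=> w hw; apply: (JW_eq0 (beta := beta) halpha hkappa _ hw) => z hz.
  by have := sym _ (bm 0) z hz; rewrite W1.
have Ls'g : forall z, disk z -> Ls' g z = 0.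
  apply: (inner_positive_definite hbeta (mLs' _ bg)).
  rewrite -(adj' _ _ (mLs' _ bg) bg) (adj _ _ (mLs' _ bg) bg).
  exact: inner_zero_r (mLs' _ bg) Lsg.
have Wg : forall z, disk z -> W g z = 0.
  apply: (inner_positive_definite hbeta (mW _ bg)).
  rewrite (adj' _ _ bg (mW _ bg)); apply: inner_zero_r => // z hz.
  by rewrite -(comm _ bg z hz) wcomp_diff_eq0.
have [z [hz uz]] := hu_neq0.
have := Wg z hz; rewrite /wcomp_diff => /eqP; rewrite mulf_eq0.
move=> /orP[/eqP//|]; apply/negP.
by apply: kernel_derive_neq0 => //; exact: htheta.2.
Qed.

End AlphaZero.

(** ** The symmetric operators with [alpha = 0] *)

Section Origin.
Hypothesis hkappa : normc kappa = 1.
Hypothesis hu_neq0 : exists z, disk z /\ u z <> 0.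
Hypothesis hbounded : bounded_on_bergman beta W.
Hypothesis hsym : complex_symmetric beta W (JW beta kappa 0).
Hypothesis hfix : theta 0 = 0.

Lemma hpow1 (s : R) : hpow (1 : C) s = 1.
Proof.
rewrite /hpow /= mul0r atan0 mulr0 cos0 sin0 mulr1 mulr0.
by rewrite expr1n expr0n addr0 ln1 mulr0 expR0.
Qed.

Lemma conj_pow (x : C) k : conjc x ^+ k = conjc (x ^+ k).
Proof. by elim: k => [|k IH]; rewrite ?expr0 ?conjc1 // !exprS IH rmorphM. Qed.

Lemma JW0 f z : JW beta kappa 0 f z = conjc (f (- kappa * conjc z)).
Proof.
rewrite /JW /conjJ /wcomp /u_alpha /theta_alpha conjc0 !mul0r subr0 divr1.
rewrite nm0 expr0n subr0 powR1 cpow_hpow; last by rewrite /= ltr01.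
by rewrite hpow1 divr1 rmorph1 mul1r sub0r mulrN mulNr.
Qed.

Lemma JW0_pexp f a : pexp f 0 a ->
  pexp (JW beta kappa 0 f) 0 (fun k => conjc (a k * (- kappa) ^+ k)).
Proof.
move=> [r [r0 hr]]; exists r; split; [exact: r0|move=> w wr].
have wr' : normc (- kappa * conjc w) < r by rewrite nmM nmN hkappa nmJ mul1r.
have := csumJ (hr _ wr'); rewrite JW0 !add0r.
apply: eq_csum => k; rewrite exprMn mulrA rmorphM /=; congr (_ * _).
by rewrite -conj_pow conjcK.
Qed.

Lemma JW0_monomial j : JW beta kappa 0 (e j) = fun z => conjc ((- kappa) ^+ j) * e j z.
Proof.
apply/funext => z; rewrite JW0 exprMn rmorphM /=; congr (_ * _).
by rewrite -conj_pow conjcK.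
Qed.

(** The conjugation multiplies each monomial by a constant, so transposed entries of
    the matrix of [W] vanish together. *)
Lemma symmetric_coef_zero j k : inner (W (e k)) (e j) = 0 -> inner (W (e j)) (e k) = 0.
Proof.
move=> kj0; have [Ls [[mLs adj] sym]] := hsym; have [mW _] := hbounded.
pose g := Ls (JW beta kappa 0 (e j)).
have bJ : bergman beta (JW beta kappa 0 (e j)) by rewrite JW0_monomial; exact: bergmanZ.
have bg : bergman beta g by exact: mLs.
have gk : inner g (e k) = 0.
  rewrite (inner_conj hbeta (bm k) bg) -(adj _ _ (bm k) bJ) JW0_monomial.
  rewrite (inner_conj hbeta (bergmanZ hbeta _ (bm j)) (mW _ (bm k))).
  rewrite (innerZ hbeta _ (bm j) (mW _ (bm k))).
  by rewrite (inner_conj hbeta (mW _ (bm k)) (bm j)) kj0 conjc0 mulr0 !conjc0.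
have [b hb] := (analytic_pexp g).1 bg.1 0 (disk0 R).
have bk : b k = 0 by apply/(pexp_coef_eq0 hbeta k bg hb).
have [r [r0 hr]] := disk_nbhs (disk0 R).
have E w : normc w < r -> JW beta kappa 0 g (0 + w) = W (e j) (0 + w).
  by move=> /hr hw; rewrite (sym _ (bm j) _ hw).
have hW := eq_pexp r0 E (JW0_pexp hb).
by apply/(pexp_coef_eq0 hbeta k (mW _ (bm j)) hW); rewrite bk mul0r conjc0.
Qed.

Let W_pexp j : exists c, pexp (W (e j)) 0 c.
Proof. by have [mW _] := hbounded; exact: (analytic_pexp _).1 (mW _ (bm j)).1 0 (disk0 R). Qed.

Lemma W_coefP j k c : pexp (W (e j)) 0 c -> inner (W (e j)) (e k) = 0 <-> c k = 0.
Proof.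
have [mW _] := hbounded; move=> hc.
exact: (pexp_coef_eq0 hbeta k (mW _ (bm j)) hc).
Qed.

Lemma W_symmetric_coef j k c d : pexp (W (e j)) 0 c -> pexp (W (e k)) 0 d ->
  d j = 0 -> c k = 0.
Proof.
move=> hc hd dj; apply/(W_coefP k hc); apply: symmetric_coef_zero.
exact/(W_coefP j hd).
Qed.

Let theta_bigO : exists A r, [/\ 0 <= A, 0 < r &
  forall w, normc w < r -> normc (theta w) <= A * normc w].
Proof.
have [b hb] := (analytic_pexp theta).1 htheta.1 0 (disk0 R).
have [|A [r [A0 r0 hA]]] := pexp_bigO (k := 1) hb.
  by case=> // _; rewrite -(pexp_value hb) hfix.
by exists A, r; split => // w /hA; rewrite add0r expr1.
Qed.

Lemma W_monomial_low j k c : (j < n)%N -> pexp (W (e j)) 0 c -> c k = 0.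
Proof.
move=> jn hc; apply: (pexp_order_ball (A := 0) hc ltr01 _ (ltnSn k)) => w _.
by rewrite wcomp_diff_monomial ffact_small // mul0r mulr0 nm0 mul0r.
Qed.

(** [W e_k = 0] for [k < n], and the [n]-th column of the matrix is [n! u]. *)
Lemma u_low_coef a k : pexp u 0 a -> (k < n)%N -> a k = 0.
Proof.
move=> ha kn; have [d hd] := W_pexp k.
have hW : pexp (W (e n)) 0 (fun k => n`!%:R * a k).
  apply: (eq_pexp ltr01 _ (pexpZ n`!%:R ha)) => w _.
  by rewrite wcomp_diff_monomial subnn ffactnn expr0 mulr1 mulrC.
have /eqP := W_symmetric_coef hW hd (W_monomial_low n kn hd).
by rewrite mulf_eq0 -nm_eq0 nm_nat pnatr_eq0 eqn0Ngt fact_gt0 => /eqP.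
Qed.

(** As [u] vanishes to order [n] and [theta] to order [1], [W e_j] vanishes to
    order [j]. *)
Lemma W_order j c : (n <= j)%N -> pexp (W (e j)) 0 c -> forall i, (i < j)%N -> c i = 0.
Proof.
move=> nj hc; have [a ha] := (analytic_pexp u).1 hu 0 (disk0 R).
have [A [r [A0 r0 hA]]] := pexp_bigO ha (fun k => u_low_coef (k := k) ha).
have [B [r' [B0 r'0 hB]]] := theta_bigO.
have m0 : 0 < Num.min r r' by rewrite lt_min r0.
apply: (pexp_order_ball (A := A * ((j ^_ n)%:R * B ^+ (j - n))) hc m0).
move=> w; rewrite lt_min => /andP[/hA hw /hB hw'].
rewrite add0r in hw; rewrite add0r wcomp_diff_monomial nmM nmM nm_nat nmX.
have -> : A * ((j ^_ n)%:R * B ^+ (j - n)) * normc w ^+ j =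
   A * normc w ^+ n * ((j ^_ n)%:R * (B * normc w) ^+ (j - n)).
  have -> : normc w ^+ j = normc w ^+ n * normc w ^+ (j - n).
    by rewrite -exprD subnKC.
  by rewrite exprMn; ring.
apply: ler_pM => //; rewrite ?mulr_ge0 ?exprn_ge0 ?nm_ge0 //.
apply: ler_wpM2l => //; apply: lerXn2r => //; rewrite ?nnegrE ?nm_ge0 //.
by rewrite mulr_ge0 ?nm_ge0.
Qed.

(** The matrix is triangular from index [n] on by [W_order], hence diagonal by
    symmetry. *)
Lemma W_diagonal j c : (n <= j)%N -> pexp (W (e j)) 0 c ->
  eq_on_disk (W (e j)) (fun z => c j * z ^+ j).
Proof.
move=> nj hc; have [mW _] := hbounded.
have am : analytic_on_disk (fun z => c j * z ^+ j) by have [] := bergmanZ hbeta (c j) (bm j).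
have pm := pexpZ (c j) (pexp_monomial0 R j).
apply: (analytic_eq_coef (mW _ (bm j)).1 am _ pm).
suff -> : (fun k => c j * (k == j)%:R) = c by exact: hc.
apply/funext => k; case: (ltngtP k j) => [kj|jk|->]; last by rewrite mulr1.
  by rewrite mulr0 (W_order nj hc).
have [d hd] := W_pexp k.
rewrite mulr0; apply/esym/(W_symmetric_coef hc hd).
by apply: (W_order _ hd) => //; exact: leq_trans nj (ltnW jk).
Qed.

Lemma factn_neq0 m : (m`!%:R : C) != 0.
Proof. by rewrite -nm_eq0 nm_nat pnatr_eq0 -lt0n fact_gt0. Qed.

Theorem symmetric_origin_form z : disk z ->
  u z = (derive1n n u 0 / (n`!)%:R) * z ^+ n /\ theta z = derive1 theta 0 * z.
Proof.
have [c hc] := W_pexp n; have [d hd] := W_pexp n.+1.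
pose a := c n / n`!%:R.
have uE w : disk w -> u w = a * w ^+ n.
  move=> hw; have := W_diagonal (leqnn n) hc hw.
  rewrite wcomp_diff_monomial subnn ffactnn expr0 mulr1 => E.
  by apply: (mulIf (factn_neq0 n)); rewrite E /a mulrAC mulfVK ?factn_neq0.
have a0 : a != 0.
  apply/eqP => a0; have [w [hw]] := hu_neq0; apply.
  by rewrite uE // a0 mul0r.
pose b := d n.+1 / (a * (n.+1)`!%:R).
have nf0 := factn_neq0 n.+1.
have thE w : disk w -> theta w = b * w.
  move=> hw; have [->|w0] := eqVneq w 0; first by rewrite hfix mulr0.
  have := W_diagonal (leqnSn n) hd hw.
  rewrite wcomp_diff_monomial subSnn expr1 uE //.
  have -> : (n.+1 ^_ n = n.+1`!)%N by rewrite -ffactnn ffactnSr subSnn muln1.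
  have gen (x y F q D : C) : x != 0 -> y != 0 -> F != 0 ->
     x * y * (F * q) = D * (w * y) -> q = D / (x * F) * w.
    move=> x0 y0 F0 E; have h0 : x * y * F != 0 by rewrite !mulf_neq0.
    apply: (mulfI h0); have -> : x * y * F * q = x * y * (F * q) by ring.
    rewrite E; field.
    by rewrite x0 F0.
  rewrite exprS; apply: gen => //; exact: expf_neq0.
have [r [r0 hr]] := disk_nbhs (disk0 R).
have pu : pexp u 0 (fun k => a * (k == n)%:R).
  apply: (eq_pexp r0 _ (pexpZ a (pexp_monomial0 R n))) => w /hr hw.
  by rewrite uE.
have pth : pexp theta 0 (fun k => b * (k == 1%N)%:R).
  apply: (eq_pexp r0 _ (pexpZ b (pexp_monomial0 R 1))) => w /hr hw.
  by rewrite thE.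
have -> : derive1n n u 0 / n`!%:R = a.
  by rewrite (derive1n_pexp n pu) eqxx mulr1 mulrAC divff ?mul1r ?factn_neq0.
have -> : derive1 theta 0 = b.
  rewrite -[derive1 theta 0]/(derive1n 1 theta 0) (derive1n_pexp 1 pth).
  by rewrite eqxx mulr1 mul1r.
by move=> hz; split; [exact: uE|exact: thE].
Qed.

End Origin.

(** ** Diagonal operators are normal *)

(** The monomials are eigenvectors of [W], hence of its adjoint with the conjugate
    eigenvalues; so both products multiply the [k]-th inner product by
    [|lambda_k|^2]. *)
Lemma diagonal_normal (a c : C) (Ls : (C -> C) -> (C -> C)) :
  maps_bergman beta W -> is_adjoint beta W Ls ->
  (forall z, disk z -> u z = a * z ^+ n /\ theta z = c * z) ->
  normal_on_bergman beta W.
Proof.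
move=> mW [mLs adj] form; exists Ls; split; first by split.
pose lam k := a * ((k ^_ n)%:R * c ^+ (k - n)) : C.
have We k : eq_on_disk (W (e k)) (fun z => lam k * e k z).
  move=> z hz; rewrite wcomp_diff_monomial; have [-> ->] := form z hz.
  have [nk|kn] := leqP n k; last first.
    by rewrite /lam ffact_small // !(mul0r, mulr0).
  have zE : z ^+ k = z ^+ n * z ^+ (k - n) by rewrite -exprD subnKC.
  by rewrite /lam zE exprMn; ring.
have bW k := mW _ (bm k).
have iWe k f : bergman beta f -> inner (W (e k)) f = lam k * inner (e k) f.
  move=> hf; rewrite (eq_inner beta (We k) (fun z _ => erefl : f z = f z)).
  exact: innerZ.
have gJ k : conjc (gamma beta k) = gamma beta k :> C.
  by rewrite /gamma -(inner_conj hbeta (bm k) (bm k)).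
have iLs f k : bergman beta f -> inner (Ls f) (e k) = conjc (lam k) * inner f (e k).
  move=> hf; rewrite (inner_conj hbeta (bm k) (mLs _ hf)) -(adj _ _ (bm k) hf).
  by rewrite iWe // (inner_conj hbeta (bm k) hf) rmorphM.
have Lse k : eq_on_disk (Ls (e k)) (fun z => conjc (lam k) * e k z).
  apply: (eq_of_inner_monomials hbeta (mLs _ (bm k)) (bergmanZ hbeta _ (bm k))) => j.
  rewrite iLs // innerZ //; have [->//|jk] := eqVneq j k.
  by rewrite (inner_monomial_orthogonal hbeta) ?mulr0 // eq_sym.
have iW f k : bergman beta f -> inner (W f) (e k) = lam k * inner f (e k).
  move=> hf; rewrite (adj _ _ hf (bm k)).
  rewrite (eq_inner beta (fun z _ => erefl : f z = f z) (Lse k)).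
  rewrite (inner_conj hbeta (bergmanZ hbeta _ (bm k)) hf).
  rewrite (innerZ hbeta _ (bm k) hf) (inner_conj hbeta (bm k) hf).
  have gen (x y : C) : conjc (conjc x * y) = x * conjc y.
    by rewrite rmorphM /= conjcK.
  exact: gen.
move=> f hf; have hLf := mLs _ hf; have hWf := mW _ hf.
apply: (eq_of_inner_monomials hbeta (mW _ hLf) (mLs _ hWf)) => k.
by rewrite iW // !iLs // iW // mulrCA.
Qed.

End Operator.

Theorem theorem3 (R : realType) (beta : R) (n : nat) (alpha kappa : Cplx R)
    (theta u : Cplx R -> Cplx R)
    (hbeta : -1 < beta)
    (hn : (1 <= n)%N)
    (halpha : disk alpha)
    (hkappa : normc kappa = 1)
    (hkappa_alpha : kappa * alpha = conjc alpha)
    (htheta : holomorphic_self_map theta)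
    (hu : analytic_on_disk u)
    (hu_neq0 : exists z, disk z /\ u z <> 0)
    (hbounded : bounded_on_bergman beta (wcomp_diff n u theta))
    (hsym : complex_symmetric beta (wcomp_diff n u theta) (JW beta kappa alpha))
    (hfix : theta (conjc alpha) = conjc alpha) :
  normal_on_bergman beta (wcomp_diff n u theta) <->
  (forall z, disk z ->
     u z = (derive1n n u 0 / (n`!)%:R) * z ^+ n /\ theta z = derive1 theta 0 * z).
Proof.
split=> [hnormal|form].
  have a0 := normal_alpha0 hbeta hn htheta halpha hkappa hu_neq0 hbounded hsym hnormal.
  rewrite a0 in hsym; rewrite a0 conjc0 in hfix.
  exact: (symmetric_origin_form hbeta htheta hu hkappa hu_neq0 hbounded hsym hfix).
have [Ls [adj _]] := hsym.
exact (diagonal_normal hbeta hbounded.1 adj form).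
Qed.
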